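(* Let $k\in\mathbb N$ and suppose $f=f_0\mathbf 1_A$ with $f_0=1/\mathrm{Vol}(A)$ (the uniform case). Then, as $n\to\infty$, with $r=r(n)$, $$n^{-1}(f_0nr^d)^{(k-1)(d-1)}e^{f_0\theta nr^d}\,I_{n,k}=k^{-1}\alpha_k+O\big((nr^d)^{-1}\big).$$
   Context: Setting. Let $d\in\mathbb N$; $\|\cdot\|$ is the Euclidean norm, $B(x,s)=B_s(x)=\{y\in\mathbb R^d:\|y-x\|\le s\}$, $\mathrm{Vol}$ is Lebesgue measure, $\theta$ is the volume of the unit-radius ball in $\mathbb R^d$. Let $A\subset\mathbb R^d$ be compact with $\mathrm{Vol}(A)>0$. If $d\ge2$, $A$ has a $C^{1,1}$ boundary: for each $x\in\partial A$ there are a neighbourhood $U$ of $x$ and a real-valued function $\phi$, defined on an open set in $\mathbb R^{d-1}$ and differentiable with Lipschitz continuous partial derivatives, such that $\partial A\cap U$, after a rotation, is the graph of $\phi$. If $d=1$, $A$ is an interval. Let $X_1,X_2,\ldots$ be i.i.d. random vectors in $\mathbb R^d$ with distribution $\nu$ having density $f$ and support $A$; in this statement $f=f_0\mathbf 1_A$ with $f_0=1/\mathrm{Vol}(A)$. For real $n>0$ let $Z_n$ be Poisson with mean $n$, independent of $(X_i)$, and $\mathcal P_n=\{X_1,\ldots,X_{Z_n}\}$ (a Poisson process with intensity $nf$). For finite $\mathcal X\subset\mathbb R^d$ and $r>0$, $G(\mathcal X,r)$ is the graph on $\mathcal X$ with an edge between each pair of distinct points at distance at most $r$, and $K_{k,r}(\mathcal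 X)$ is the number of connected components of $G(\mathcal X,r)$ with exactly $k$ vertices. Put $S'_{n,k}=K_{k,r(n)}(\mathcal P_n)$ and $I_{n,k}=\mathbb E[S'_{n,k}]$. The sequence $r=r(n)>0$ satisfies $\lim_{n\to\infty}nr(n)^d=\infty$ and $\limsup_{n\to\infty}\frac{\theta nr(n)^d}{\log n}<\frac1{\max(f_0,\,d(f_0-f_1/2))}$, where in general $f_1=\inf_{\partial A}f$ and in the uniform case $f_1=f_0$, so that the bound is $\min(2/d,1)\,\mathrm{Vol}(A)$. Constants: $\alpha_1:=1$ and, for $j\in\mathbb N$, $\alpha_{j+1}:=\frac1{j!}\int_{(\mathbb R^d)^j}e^{-g(\mathbf z)}\,d\mathbf z$, where $g(\mathbf z):=\int_{\bigcup_{i=1}^jB(\frac12z_i,\|z_i\|/2)}\|x\|^{1-d}\,dx$ for $\mathbf z=(z_1,\ldots,z_j)$. *)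

(* Defs.v *)
From HB Require Import structures.
From mathcomp Require Import all_boot all_order all_algebra finmap.
From mathcomp Require Import all_classical all_reals all_analysis.

Set Implicit Arguments.
Unset Strict Implicit.
Unset Printing Implicit Defensive.

Import Order.TTheory GRing.Theory Num.Theory.
Import numFieldNormedType.Exports.

Local Open Scope classical_set_scope.
Local Open Scope ring_scope.

(* The product sigma-algebra on row vectors, as for tuples in the library.
   For T = R it is the Borel sigma-algebra of R^n. *)

Definition rV_display : measure_display -> measure_display.
Proof. exact. Qed.

Section measurable_rV.
Context {disp : measure_display} {T : sigmaRingType disp}.
Variable n : nat.

Let coor (i : 'I_n) (x : 'rV[T]_n) : T := x ord0 i.

Let rV_set0 : g_sigma_preimage coor set0.
Proof. exact: sigma_algebra0. Qed.

Let rV_setC A : g_sigma_preimage coor A -> g_sigma_preimage coor (~` A).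
Proof. exact: sigma_algebraC. Qed.

Let rV_bigcup (F : _^nat) : (forall i, g_sigma_preimage coor (F i)) ->
  g_sigma_preimage coor (\bigcup_i (F i)).
Proof. exact: sigma_algebra_bigcup. Qed.

HB.instance Definition _ := @isMeasurable.Build (rV_display disp)
  'rV[T]_n (g_sigma_preimage coor) rV_set0 rV_setC rV_bigcup.

End measurable_rV.

Lemma measurable_rV_coord (disp : measure_display) (T : sigmaRingType disp)
    n (i : 'I_n) : measurable_fun [set: 'rV[T]_n] (fun x => x ord0 i).
Proof.
move=> _ Y mY; rewrite setTI; apply: sub_sigma_algebra => /=.
rewrite -bigcup_seq/=; exists i => /=; first by rewrite mem_index_enum.
by exists Y => //; rewrite setTI.
Qed.

Lemma measurable_fun_rVP (d1 d2 : measure_display) (T1 : measurableType d1)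
    (T2 : measurableType d2) n (f : T1 -> 'rV[T2]_n) :
  measurable_fun [set: T1] f <->
  forall i, measurable_fun [set: T1] (fun x => f x ord0 i).
Proof.
apply: (@iff_trans _ (g_sigma_preimage
    (fun (i : 'I_n) => (fun x : 'rV[T2]_n => x ord0 i) \o f) `<=` measurable)).
  rewrite g_sigma_preimage_comp; split=> [mf A [/= C preC <-]|prefS].
    exact: mf.
  by move=> _ A mA; apply: prefS; exists A.
split=> [fS i|mf].
- move=> _ A mA.
  apply: fS; apply: sub_sigma_algebra.
  case: n i => [[] []//|n i] in f *.
  rewrite -bigcup_mkord_ord.
  exists i; first exact: ltn_ord.
  by exists A => //; rewrite inord_val.
- apply: smallest_sub; first exact: sigma_algebra_measurable.
  case: n => [|n] in f mf *; first by rewrite big_ord0.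
  rewrite -bigcup_mkord_ord; apply: bigcup_sub => i Ii.
  by move=> A [B mB <-]; exact: mf.
Qed.

(* Image of a sigma-finite measure under a measurable isomorphism. The hypotheses
   are arguments of iso_image so that unification finds the measure instances. *)
Section iso_image.
Context (d1 d2 : measure_display) (T1 : measurableType d1)
  (T2 : measurableType d2) (R : realType).
Variables (mu : {sigma_finite_measure set T1 -> \bar R}).
Variables (f : T1 -> T2) (g : T2 -> T1).
Hypotheses (mf : measurable_fun [set: T1] f) (mg : measurable_fun [set: T2] g).
Hypotheses (fK : cancel f g) (gK : cancel g f).

Definition iso_image of measurable_fun [set: T1] f &
  measurable_fun [set: T2] g & cancel f g & cancel g f := pushforward mu f.

Local Notation im := (iso_image mf mg fK gK).

Let im0 : im set0 = 0%E.
Proof. by rewrite /iso_image /pushforward preimage_set0 measure0. Qed.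

Let im_ge0 A : (0 <= im A)%E.
Proof. exact: measure_ge0. Qed.

Let im_sigma_additive : semi_sigma_additive im.
Proof.
move=> F mF tF mUF; rewrite /iso_image /pushforward preimage_bigcup.
apply: measure_semi_sigma_additive.
- by move=> n; rewrite -[X in measurable X]setTI; exact: mf.
- apply/trivIsetP => /= i j _ _ ij; rewrite -preimage_setI.
  by move/trivIsetP : tF => /(_ _ _ _ _ ij) ->//; rewrite preimage_set0.
- by rewrite -preimage_bigcup -[X in measurable X]setTI; exact: mf.
Qed.

HB.instance Definition _ := isMeasure.Build _ _ _ im
  im0 im_ge0 im_sigma_additive.

Let im_sigma_finite : sigma_finite [set: T2] im.
Proof.
have [F UF mF] := sigma_finiteT mu.
exists (fun n => g @^-1` F n).
  by rewrite -preimage_bigcup -UF preimage_setT.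
move=> n; have [mFn Fnoo] := mF n; split.
  by rewrite -[X in measurable X]setTI; exact: mg.
rewrite /iso_image /pushforward -comp_preimage.
by rewrite (_ : g \o f = id)//; apply/funext => x /=; rewrite fK.
Qed.

HB.instance Definition _ := Measure_isSigmaFinite.Build _ _ _ im
  im_sigma_finite.

End iso_image.

(* The library's sigma-finiteness instance for [\x] is shadowed by the one for
   probability measures, hence this named copy. *)
Section prod_sf.
Local Open Scope ereal_scope.
Context (d1 d2 : measure_display) (T1 : measurableType d1)
  (T2 : measurableType d2) (R : realType).
Variables (m1 : {sigma_finite_measure set T1 -> \bar R})
          (m2 : {sigma_finite_measure set T2 -> \bar R}).

Definition prod_sf : set (T1 * T2) -> \bar R := m1 \x m2.

HB.instance Definition _ := Measure.copy prod_sf (m1 \x m2).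

Let prod_sf_sigma_finite : sigma_finite [set: T1 * T2] prod_sf.
Proof.
have /sigma_finiteP[F [TF ndF Foo]] := sigma_finiteT m1.
have /sigma_finiteP[G [TG ndG Goo]] := sigma_finiteT m2.
exists (fun n => F n `*` G n).
  rewrite -setXTT TF TG predeqE => -[x y]; split.
    move=> [/= [n _ Fnx] [k _ Gky]]; exists (maxn n k) => //; split.
    - by move: x Fnx; exact/subsetPset/ndF/leq_maxl.
    - by move: y Gky; exact/subsetPset/ndG/leq_maxr.
  by move=> [n _ []/= ? ?]; split; exists n.
move=> k; have [? ?] := Foo k; have [? ?] := Goo k.
split; first exact: measurableX.
by rewrite /prod_sf product_measure1E// lte_mul_pinfty// ge0_fin_numE.
Qed.

HB.instance Definition _ := Measure_isSigmaFinite.Build _ _ _ prod_sf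
  prod_sf_sigma_finite.

End prod_sf.

Section product_power.
Context {disp : measure_display} {T : measurableType disp} {R : realType}.

Definition tcons n (p : T * n.-tuple T) : n.+1.-tuple T := [tuple of p.1 :: p.2].
Definition tuncons n (t : n.+1.-tuple T) : T * n.-tuple T :=
  (thead t, [tuple of behead t]).

Lemma measurable_tcons n : measurable_fun [set: T * n.-tuple T] (@tcons n).
Proof. exact: measurable_cons. Qed.

Lemma measurable_tuncons n :
  measurable_fun [set: n.+1.-tuple T] (@tuncons n).
Proof.
apply/measurable_fun_pairP; split; first exact: measurable_tnth.
exact: measurable_behead.
Qed.

Lemma tconsK n : cancel (@tcons n) (@tuncons n).
Proof. by move=> [x t]; congr pair; exact: val_inj. Qed.

Lemma tunconsK n : cancel (@tuncons n) (@tcons n).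
Proof. by move=> t; rewrite [RHS]tuple_eta; exact: val_inj. Qed.

Fixpoint mpow (mu : {sigma_finite_measure set T -> \bar R}) (n : nat) :
    {sigma_finite_measure set (n.-tuple T) -> \bar R} :=
  match n with
  | 0 => [the {sigma_finite_measure set (0.-tuple T) -> \bar R}
            of \d_[tuple]]
  | n'.+1 => [the {sigma_finite_measure set (n'.+1.-tuple T) -> \bar R}
      of iso_image (prod_sf mu (mpow mu n')) (@measurable_tcons n')
           (@measurable_tuncons n') (@tconsK n') (@tunconsK n')]
  end.

End product_power.

Section lebesgue_rV.
Context {R : realType}.
Variable n : nat.

Definition rV_of_tuple (t : n.-tuple (measurableTypeR R)) : 'rV[R]_n :=
  \row_i tnth t i.
Definition tuple_of_rV (x : 'rV[R]_n) : n.-tuple (measurableTypeR R) :=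
  [tuple x ord0 i | i < n].

Lemma measurable_rV_of_tuple : measurable_fun setT rV_of_tuple.
Proof.
apply/measurable_fun_rVP => i.
rewrite (_ : (fun _ => _) = (fun t => tnth t i)); first exact: measurable_tnth.
by apply/funext => t; rewrite mxE.
Qed.

Lemma measurable_tuple_of_rV : measurable_fun setT tuple_of_rV.
Proof.
apply/measurable_fun_tnthP => i.
rewrite (_ : _ \o _ = (fun x : 'rV[R]_n => x ord0 i)).
  exact: measurable_rV_coord.
by apply/funext => x /=; rewrite tnth_mktuple.
Qed.

Lemma rV_of_tupleK : cancel rV_of_tuple tuple_of_rV.
Proof. by move=> t; apply: eq_from_tnth => i; rewrite tnth_mktuple mxE. Qed.

Lemma tuple_of_rVK : cancel tuple_of_rV rV_of_tuple.
Proof. by move=> x; apply/rowP => i; rewrite mxE tnth_mktuple. Qed.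

(* Lebesgue measure on R^n; see vol_box below. *)
Definition vol : {sigma_finite_measure set 'rV[R]_n -> \bar R} :=
  [the {sigma_finite_measure set 'rV[R]_n -> \bar R} of
    iso_image (mpow lebesgue_measure n) measurable_rV_of_tuple
      measurable_tuple_of_rV rV_of_tupleK tuple_of_rVK].

End lebesgue_rV.
Arguments vol {R} n.

Section boxes.
Local Open Scope ereal_scope.
Context {R : realType}.

Lemma mpow_box (disp : measure_display) (T : measurableType disp)
    (mu : {sigma_finite_measure set T -> \bar R}) n (B : 'I_n -> set T) :
  (forall i, measurable (B i)) ->
  mpow mu n [set t | forall i, B i (tnth t i)] = \prod_(i < n) mu (B i).
Proof.
elim: n B => [|n IH] B mB.
  rewrite big_ord0 /= diracE mem_set//= => -[] //.
rewrite big_ord_recl -IH; last by move=> i; exact: mB.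
rewrite /= /iso_image /pushforward -product_measure1E//.
- congr product_measure1; apply/seteqP; split => -[x t] /=.
    move=> h; split; first exact: (h ord0).
    by move=> i; have := h (lift ord0 i); rewrite tnthS.
  move=> [Bx Bt] i; case: (unliftP ord0 i) => [j ->|->] //.
  by rewrite tnthS.
- rewrite (_ : [set _ | _] = \big[setI/setT]_(i < n)
     ((fun t : n.-tuple T => tnth t i) @^-1` B (lift ord0 i))).
    apply: bigsetI_measurable => i _; rewrite -[X in measurable X]setTI.
    exact: measurable_tnth.
  by apply/seteqP; split => t /= => [h|]; rewrite -?bigcap_seq; [move=> i _; exact: h|move=> h i; apply: h => /=; rewrite mem_index_enum].
Qed.

Lemma vol_box n (B : 'I_n -> set R) :
  (forall i, measurable (B i : set (measurableTypeR R))) ->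
  vol n [set x | forall i, B i (x ord0 i)] =
  \prod_(i < n) lebesgue_measure (B i).
Proof.
move=> mB; rewrite -mpow_box// /vol /= /iso_image /pushforward.
by congr (mpow _ _ _); apply/seteqP; split => t h i; have := h i; rewrite mxE.
Qed.

End boxes.

Section euclidean.
Context {R : realType} {d : nat}.
Implicit Types (x y : 'rV[R]_d) (A : set 'rV[R]_d).

Definition enorm x : R := Num.sqrt (\sum_(i < d) x ord0 i ^+ 2).

Definition eball x (s : R) : set 'rV[R]_d := [set y | enorm (y - x) <= s].

Definition boundary A : set 'rV[R]_d := closure A `\` interior A.

End euclidean.

Definition theta {R : realType} (d : nat) : R :=
  fine (vol d (eball (0 : 'rV[R]_d) 1)).

Section regularity.
Context {R : realType}.

Definition rotation d (Q : 'M[R]_d) : Prop := Q *m Q^T = 1%:M /\ \det Q = 1.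

Definition C11_on p (phi : 'rV[R]_p -> R) (V : set 'rV[R]_p) : Prop :=
  (forall v, V v -> differentiable phi v) /\
  forall j : 'I_p, exists L : R, forall u v, V u -> V v ->
    `|'D_(delta_mx ord0 j) phi u - 'D_(delta_mx ord0 j) phi v|
      <= L * enorm (u - v).

(* The vectors y whose last coordinate is the value of phi at the remaining
   ones; col' i y deletes the i-th coordinate. *)
Definition last_coord_graph d (phi : 'rV[R]_d.-1 -> R) (V : set 'rV[R]_d.-1) :
    set 'rV[R]_d :=
  [set y | exists i : 'I_d,
    [/\ i.+1 = d, V (col' i y) & y ord0 i = phi (col' i y)]].

Definition C11_boundary d (A : set 'rV[R]_d) : Prop :=
  forall x, boundary A x ->
  exists (U : set 'rV[R]_d) (Q : 'M[R]_d)
         (V : set 'rV[R]_d.-1) (phi : 'rV[R]_d.-1 -> R),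
    [/\ nbhs x U, rotation Q, open V, C11_on phi V &
        [set y *m Q | y in boundary A `&` U] = last_coord_graph phi V].

(* Meant for d = 1, where 'rV_d is the real line. *)
Definition interval1 d (A : set 'rV[R]_d) : Prop :=
  exists2 I : set R, is_interval I & A = [set x | forall i, I (x ord0 i)].

End regularity.

Section uniform_density.
Context {R : realType} {d : nat}.
Variable A : set 'rV[R]_d.

Definition f0 : R := (fine (vol d A))^-1.

Definition unif_density (x : 'rV[R]_d) : R := f0 * \1_A x.

Definition f1 : R := inf [set unif_density x | x in boundary A].

End uniform_density.

Section probability_notions.
Context {disp : measure_display} {Omega : measurableType disp} {R : realType}.
Variable P : probability Omega R.

Definition msupport d (mu : set 'rV[R]_d -> \bar R) : set 'rV[R]_d :=
  [set x | forall U, open U -> U x -> (0 < mu U)%E].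

Definition has_density d (X : {RV P >-> 'rV[R]_d}) (f : 'rV[R]_d -> R) : Prop :=
  forall B, measurable B ->
    distribution P X B = (\int[vol d]_(x in B) (f x)%:E)%E.

Definition poisson_rv (N : {RV P >-> nat}) (rate : R) : Prop :=
  forall j : nat, P (N @^-1` [set j]) = (poisson_pmf rate j)%:E.

Definition sigma_rv (disp' : measure_display) (T : measurableType disp')
    (X : Omega -> T) : set (set Omega) :=
  preimage_set_system setT X measurable.

Definition mutually_independent (disp' : measure_display)
    (T : measurableType disp') (X : nat -> Omega -> T) : Prop :=
  forall (J : {fset nat}) (E : nat -> set Omega),
    (forall i, i \in J -> sigma_rv (X i) (E i)) ->
    P (\bigcap_(i in [set` J]) E i) = (\prod_(i <- J) P (E i))%E.

Definition independent_of_sequence (disp1 disp2 : measure_display)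
    (T1 : measurableType disp1) (T2 : measurableType disp2)
    (N : Omega -> T1) (X : nat -> Omega -> T2) : Prop :=
  forall E F, sigma_rv N E -> <<s \bigcup_i sigma_rv (X i) >> F ->
    P (E `&` F) = (P E * P F)%E.

End probability_notions.

Section geometric_graph.
Context {R : realType} {d : nat}.

Definition geo_edge (r : R) (S : {fset 'rV[R]_d}) : rel S :=
  fun x y => (x != y) && (enorm (val x - val y) <= r).

Definition components (r : R) (S : {fset 'rV[R]_d}) : {set {set S}} :=
  equivalence_partition (connect (@geo_edge r S)) [set: S]%SET.

Definition num_components (k : nat) (r : R) (S : {fset 'rV[R]_d}) : nat :=
  #|[set C in components r S | #|C| == k]%SET|.

(* The set {X_1, ..., X_N}; the library sequence X starts at index 0. *)
Definition sample (disp : measure_display) (Omega : measurableType disp)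
    (X : nat -> Omega -> 'rV[R]_d) (N : Omega -> nat) (w : Omega) :
    {fset 'rV[R]_d} :=
  [fset X i w | i in iota 0 (N w)]%fset.

(* The expectation is finite since there are at most N components. *)
Definition expected_clusters (disp : measure_display)
    (Omega : measurableType disp) (P : probability Omega R)
    (X : nat -> Omega -> 'rV[R]_d) (N : Omega -> nat) (k : nat) (r : R) : R :=
  fine 'E_P[fun w => (num_components k r (sample X N w))%:R].

End geometric_graph.

Section constants.
Context {R : realType}.
Variable d : nat.

(* [^- d.-1] is the power 1 - d, with the value 0 at the null vector if
   1 < d; the integral is finite, the domain being bounded. *)
Definition gfun j (z : j.-tuple 'rV[R]_d) : R :=
  \int[vol d]_(x in \bigcup_(i in [set: 'I_j])
      eball (2^-1 *: tnth z i) (enorm (tnth z i) / 2)) (enorm x ^- d.-1).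

Definition alpha (k : nat) : R :=
  match k with
  | j'.+2 => let j := j'.+1 in
      (j`!%:R)^-1 * \int[mpow (vol d) j]_z expR (- gfun z)
  | _ => 1
  end.

End constants.
Arguments alpha {R} d k.

(* Main.v *)
Require Import Defs.
From mathcomp Require Import all_boot all_order all_algebra finmap.
From mathcomp Require Import all_classical all_reals all_analysis.
From mathcomp Require Import measurable_realfun.
From mathcomp Require Import ring lra.

Set Implicit Arguments.
Unset Strict Implicit.
Unset Printing Implicit Defensive.

Import Order.TTheory GRing.Theory Num.Theory.
Import numFieldNormedType.Exports.

Local Open Scope classical_set_scope.
Local Open Scope ring_scope.

(** Put lam = f_0 n r^d. By the Mecke formula, I_{n,k} is n^k / k! times the integral, over the
    k-tuples y in A connected at scale r, of exp(-n nu(union of the B(y_i, r))) with respect to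
    nu^k. If y_1 is further than (k + 1) r from the boundary, scaling reduces the integral over
    the other points to
      J(lam) = int 1{(0, z) connected at scale 1} exp(-lam Vol(B(0, 1) u U_i B(z_i, 1))) dz.
    Substituting z / lam for z, and comparing both sides in polar coordinates,
      Vol(B(0, 1) u U_i B(z_i / lam, 1)) = theta + g(z) / lam + O(|z|^2 / lam^2),
    so that lam^((k-1) d) e^(lam theta) J(lam) = (k - 1)! alpha_k + O(1 / lam).
    The boundary layer has volume O(r). For y_1 in it, the ball B(y_1, r) has at least the volume
    (theta / 2 - eps) r^d in common with A, as A contains almost a half-ball at scale r around
    each of its points. The layer therefore contributes, after normalisation, at most a constant
    times lam^((k-1) d) r e^(lam (theta / 2 + eps)), which is O(1 / lam) by the hypothesis on the
    upper limit. *)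

(** * Substitution in product integrals *)

(** The normalisation balances because [n^-1 lam^((k-1)(d-1)) (n f_0)^k r^((k-1)d) = f_0
    lam^((k-1)d)]; the main term then carries [f_0 Vol(A) = 1], and every error has to be
    [O(1 / lam)]. The expansion of the volume is not uniform in [z]. It serves for [|z| <= lam];
    beyond, and for domination, a linear lower bound on the excess of the volume over [theta] is
    needed. It holds on connected configurations, whose diameter at scale 1 is bounded, and rests on
    the monotonicity of [Vol(B(W, 1) \ B(0, 1))] in [W] along rays. A boundary chart does not say on
    which side of the graph [A] lies. The proof therefore works with the interior of [A] and carries
    membership along segments that avoid the boundary. Volumes of tubes and slabs are bounded by
    packing disjoint translates instead of integrating in charts. *)

Definition image_measure (d1 d2 : measure_display) (T1 : measurableType d1)
    (T2 : measurableType d2) (R : realType) (mu : {measure set T1 -> \bar R})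
    (f : T1 -> T2) (mf : measurable_fun setT f) :=
  measure_function_pushforward__canonical__measure_function_Measure mu mf.

Section substitution.
Context {disp : measure_display} {T : measurableType disp} {R : realType}.

(** [c] is the inverse of the Jacobian of [phi]. Stating the rule for all nonnegative measurable
    integrands lets it pass to product powers by Tonelli, from the line to ['rV[R]_d] and then to
    tuples of vectors, with no determinant involved. *)
Definition int_subst (mu : {measure set T -> \bar R}) (phi : T -> T) (c : R) :=
  [/\ measurable_fun setT phi, 0 <= c & forall F : T -> \bar R,
    measurable_fun setT F -> (forall x, (0 <= F x)%E) ->
    (\int[mu]_x F (phi x) = c%:E * \int[mu]_x F x)%E].

End substitution.

Section mpow_integral.
Local Open Scope ereal_scope.
Context {disp : measure_display} {T : measurableType disp} {R : realType}.
Variable mu : {sigma_finite_measure set T -> \bar R}.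

Lemma integral_mpow0 (F : 0.-tuple T -> \bar R) :
  measurable_fun setT F -> \int[mpow mu 0]_t F t = F [tuple].
Proof. by move=> mF; rewrite integral_dirac// diracT mul1e. Qed.

Section succ.
Variables (n : nat) (F : n.+1.-tuple T -> \bar R).
Hypotheses (mF : measurable_fun setT F) (F0 : forall t, 0 <= F t).

Let mFc : measurable_fun setT (F \o @tcons _ T n).
Proof. by apply: measurableT_comp => //; exact: measurable_tcons. Qed.

Lemma integral_mpowS :
  \int[mpow mu n.+1]_t F t = \int[mu]_x \int[mpow mu n]_t F (tcons (x, t)).
Proof.
rewrite [LHS](ge0_integral_pushforward (@measurable_tcons _ T n) (prod_sf mu (mpow mu n)))//.
rewrite preimage_setT.
exact: (fubini_tonelli1 (m1 := mu) (m2 := mpow mu n) _ mFc (fun z => F0 _)).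
Qed.

Lemma integral_mpowS_swap :
  \int[mpow mu n.+1]_t F t = \int[mpow mu n]_t \int[mu]_x F (tcons (x, t)).
Proof.
rewrite [LHS](ge0_integral_pushforward (@measurable_tcons _ T n) (prod_sf mu (mpow mu n)))//.
rewrite preimage_setT.
exact: (fubini_tonelli2 (m1 := mu) (m2 := mpow mu n) _ mFc (fun z => F0 _)).
Qed.

Lemma measurable_mpow_inner :
  measurable_fun setT (fun x => \int[mpow mu n]_t F (tcons (x, t))).
Proof.
exact: (measurable_fun_fubini_tonelli_F (m2 := mpow mu n) _ mFc (fun z => F0 _)).
Qed.

End succ.
End mpow_integral.

(** Induction by Tonelli: the substitution is made in the tail under the outer integral, then in the
    head. The maps may differ between coordinates because a translation of ['rV[R]_d] has a
    different offset in each. *)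
Lemma int_subst_mpow (disp : measure_display) (T : measurableType disp)
    (R : realType) (mu : {sigma_finite_measure set T -> \bar R}) (c : R) n
    (phi : 'I_n -> T -> T) :
  (forall i, int_subst mu (phi i) c) ->
  int_subst (mpow mu n) (fun t => [tuple phi i (tnth t i) | i < n]) (c ^+ n).
Proof.
elim: n phi => [|n IH] phi H.
  split => // [|F mF F0].
    apply/measurable_fun_tnthP => -[] //.
  by rewrite expr0 mul1e; apply: eq_integral => t _; congr (F _); apply: eq_from_tnth => -[].
have mphi i : measurable_fun setT (phi i) by case: (H i).
have c0 : 0 <= c by case: (H ord0).
have mPhi m (psi : 'I_m -> T -> T) : (forall i, measurable_fun setT (psi i)) ->
   measurable_fun setT (fun t : m.-tuple T => [tuple psi i (tnth t i) | i < m]).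
  move=> mpsi; apply/measurable_fun_tnthP => i.
  rewrite (_ : _ \o _ = (fun t : m.-tuple T => psi i (tnth t i))).
    by apply: measurableT_comp => //; exact: measurable_tnth.
  by apply/funext => t /=; rewrite tnth_mktuple.
split; [exact: mPhi|exact: exprn_ge0|move=> F mF F0].
rewrite integral_mpowS//; last exact: (measurableT_comp mF (mPhi _ _ mphi)).
have E x t : [tuple phi i (tnth (tcons (x, t)) i) | i < n.+1] =
    tcons (phi ord0 x, [tuple phi (lift ord0 i) (tnth t i) | i < n]).
  apply: eq_from_tnth => i; rewrite tnth_mktuple.
  case: (unliftP ord0 i) => [j ->|->] //; by rewrite !tnthS tnth_mktuple.
have [_ _ IH'] := IH (fun i => phi (lift ord0 i)) (fun i => H (lift ord0 i)).
have mF1 x : measurable_fun setT (fun t => F (tcons (x, t))).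
  apply: (measurableT_comp mF).
  exact: (measurableT_comp (measurable_tcons (n := n)) (pair1_measurable x)).
transitivity (\int[mu]_x ((c ^+ n)%:E * \int[mpow mu n]_t F (tcons (phi ord0 x, t))))%E.
  apply: eq_integral => x _; rewrite -(IH' (fun t => F (tcons (_, t))))//.
  by apply: eq_integral => t _; rewrite E.
have mI := measurable_mpow_inner mu mF F0.
rewrite ge0_integralZl//; last 3 first.
- by apply: measurableT_comp mI _.
- by move=> x _; apply: integral_ge0.
- by rewrite lee_fin exprn_ge0.
have [_ _ H0] := H ord0.
rewrite (H0 (fun x => \int[mpow mu n]_t F (tcons (x, t))))%E//; last first.
  by move=> x; apply: integral_ge0.
by rewrite muleA -EFinM -exprSr integral_mpowS.
Qed.

Section lebesgue_affine.
Context {R : realType}.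
Variables (a b : R).
Hypothesis a0 : a != 0.

Let aff (x : R) := a * x + b.

Let maff : measurable_fun (setT : set (measurableTypeR R)) (aff : measurableTypeR R -> measurableTypeR R).
Proof. by apply: measurable_funD => //; exact: mulrl_measurable. Qed.

Let preimage_itv (u v : R) : aff @^-1` `]u, v]%classic =
  if 0 < a then `](u - b) / a, (v - b) / a]%classic
  else `[(v - b) / a, (u - b) / a[%classic.
Proof.
rewrite /aff; apply/seteqP; split => x; case: ltgtP a0 => // ha _ /=; rewrite !in_itv/=.
- by rewrite ltr_pdivrMr// ler_pdivlMr// (mulrC x); lra.
- by rewrite ler_ndivrMr// ltr_ndivlMr// (mulrC x); lra.
- by rewrite ltr_pdivrMr// ler_pdivlMr// (mulrC x); lra.
- by rewrite ler_ndivrMr// ltr_ndivlMr// (mulrC x); lra.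
Qed.

(** The image measure scaled by [|a|] agrees with Lebesgue measure on half-open intervals, and these
    determine it. For [a < 0] the preimage is closed at the other end, which leaves its length
    unchanged. *)
Lemma lebesgue_affine :
  int_subst (lebesgue_measure : {measure set measurableTypeR R -> \bar R}) aff (`|a|^-1).
Proof.
have ca : 0 < `|a| by rewrite normr_gt0.
split; [exact: maff|by rewrite invr_ge0|move=> F mF F0].
transitivity (\int[image_measure lebesgue_measure maff]_x F x)%E.
  by rewrite (ge0_integral_pushforward maff).
pose k := NngNum (ltW ca).
have E : forall A : set (measurableTypeR R), measurable A -> lebesgue_measure A =
    mscale k (image_measure lebesgue_measure maff) A.
  move=> A mA; apply: (@lebesgue_measure_unique R (mscale k (image_measure lebesgue_measure maff))) => // _ [[u v] _ <-] /=.
  rewrite /mscale/= [X in (_ = _ * X)%E](_ : _ =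
     lebesgue_measure (aff @^-1` `]u, v]%classic))//.
  rewrite preimage_itv lebesgue_measure_itv /= lte_fin.
  move: (a0); rewrite neq_lt => /orP[ha|ha].
    rewrite [0 < a]ltNge (ltW ha)/= lebesgue_measure_itv /= lte_fin ltr_nM2r ?invr_lt0// ltrD2r.
    case: ifPn => _; last by rewrite mule0.
    rewrite -!EFinB -EFinM ltr0_norm//; congr EFin; field; exact: a0.
  rewrite ha lebesgue_measure_itv /= lte_fin ltr_pM2r ?invr_gt0// ltrD2r.
  case: ifPn => _; last by rewrite mule0.
  rewrite -!EFinB -EFinM gtr0_norm//; congr EFin; field; exact: a0.
rewrite [X in (_ = _ * X)%E](eq_measure_integral (mscale k (image_measure lebesgue_measure maff))); last by move=> A mA _; exact: E.
rewrite ge0_integral_mscale//= muleA -EFinM mulVf ?mul1e//; exact: lt0r_neq0.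
Qed.

End lebesgue_affine.

Section vol_affine.
Context {R : realType}.
Variable d : nat.

Lemma integral_vol (F : 'rV[R]_d -> \bar R) :
  measurable_fun setT F -> (forall x, 0 <= F x)%E ->
  (\int[vol d]_x F x = \int[mpow lebesgue_measure d]_t F (rV_of_tuple t))%E.
Proof.
move=> mF F0.
rewrite [LHS](ge0_integral_pushforward (@measurable_rV_of_tuple R d) (mpow lebesgue_measure d))//.
Qed.

Lemma vol_affine (a : R) (b : 'rV[R]_d) : a != 0 ->
  int_subst (vol d) (fun x => a *: x + b) (`|a|^-1 ^+ d).
Proof.
move=> a0; split; last 2 first.
- by rewrite exprn_ge0 // invr_ge0.
- move=> F mF F0.
  have mphi : measurable_fun setT (fun x : 'rV[R]_d => a *: x + b).
    apply/measurable_fun_rVP => i; rewrite (_ : (fun x => _) = (fun x : 'rV[R]_d => a * x ord0 i + b ord0 i)); last by apply/funext => x; rewrite !mxE.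
    apply: measurable_funD => //; apply: measurable_funM => //; exact: measurable_rV_coord.
  rewrite integral_vol//; last exact: measurableT_comp mF mphi.
  rewrite integral_vol//.
  have [_ _ H] := @int_subst_mpow _ _ _ lebesgue_measure _ d _ (fun i => @lebesgue_affine R a (b ord0 i) a0).
  rewrite -(H (fun t => F (rV_of_tuple t)))//; last exact: measurableT_comp mF (measurable_rV_of_tuple (n := d)).
  apply: eq_integral => t _; congr F; apply/rowP => i.
  by rewrite !mxE tnth_mktuple.
- apply/measurable_fun_rVP => i; rewrite (_ : (fun x => _) = (fun x : 'rV[R]_d => a * x ord0 i + b ord0 i)); last by apply/funext => x; rewrite !mxE.
  apply: measurable_funD => //; apply: measurable_funM => //; exact: measurable_rV_coord.
Qed.

End vol_affine.

(** * The Euclidean norm, measurability and ball volumes *)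

Section dot_product.
Context {R : realType} {d : nat}.
Implicit Types x y z : 'rV[R]_d.

Definition dot x y : R := \sum_(i < d) x ord0 i * y ord0 i.

Lemma dotC x y : dot x y = dot y x.
Proof. by apply: eq_bigr => i _; rewrite mulrC. Qed.

Lemma dotDl x y z : dot (x + y) z = dot x z + dot y z.
Proof. by rewrite -big_split; apply: eq_bigr => i _; rewrite mxE mulrDl. Qed.

Lemma dotZl a x y : dot (a *: x) y = a * dot x y.
Proof. by rewrite mulr_sumr; apply: eq_bigr => i _; rewrite mxE mulrA. Qed.

Lemma dotNl x y : dot (- x) y = - dot x y.
Proof. by rewrite -scaleN1r dotZl mulN1r. Qed.

Lemma dotBl x y z : dot (x - y) z = dot x z - dot y z.
Proof. by rewrite dotDl dotNl. Qed.

Lemma dotDr x y z : dot x (y + z) = dot x y + dot x z.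
Proof. by rewrite dotC dotDl !(dotC _ x). Qed.

Lemma dotZr a x y : dot x (a *: y) = a * dot x y.
Proof. by rewrite dotC dotZl dotC. Qed.

Lemma dotNr x y : dot x (- y) = - dot x y.
Proof. by rewrite dotC dotNl dotC. Qed.

Lemma dotBr x y z : dot x (y - z) = dot x y - dot x z.
Proof. by rewrite dotDr dotNr. Qed.

Lemma dotxx_ge0 x : 0 <= dot x x.
Proof. by apply: sumr_ge0 => i _; rewrite -expr2 sqr_ge0. Qed.

Lemma enorm_ge0 x : 0 <= enorm x.
Proof. exact: sqrtr_ge0. Qed.

Lemma enorm_sqr x : enorm x ^+ 2 = dot x x.
Proof.
rewrite sqr_sqrtr; last by apply: sumr_ge0 => i _; exact: sqr_ge0.
by apply: eq_bigr => i _; rewrite expr2.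
Qed.

Lemma coord_le_enorm x i : `|x ord0 i| <= enorm x.
Proof.
rewrite -(@ler_pXn2r _ 2)// ?nnegrE ?enorm_ge0// enorm_sqr real_normK ?num_real//.
rewrite /dot (bigD1 i)//= -expr2 lerDl; apply: sumr_ge0 => j _.
by rewrite -expr2 sqr_ge0.
Qed.

Lemma enorm_eq0 x : (enorm x == 0) = (x == 0).
Proof.
apply/eqP/eqP => [x0|->].
  apply/rowP => i; apply/eqP; rewrite mxE -normr_le0 -x0; exact: coord_le_enorm.
by rewrite /enorm big1 ?sqrtr0// => i _; rewrite mxE expr0n.
Qed.

Lemma enorm0 : enorm (0 : 'rV[R]_d) = 0.
Proof. by apply/eqP; rewrite enorm_eq0. Qed.

Lemma enormZ a x : enorm (a *: x) = `|a| * enorm x.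
Proof.
apply/eqP; rewrite -(@eqrXn2 _ 2)// ?mulr_ge0 ?enorm_ge0//.
by rewrite exprMn !enorm_sqr dotZl dotZr real_normK ?num_real// mulrA expr2.
Qed.

Lemma enormN x : enorm (- x) = enorm x.
Proof. by rewrite -scaleN1r enormZ normrN1 mul1r. Qed.

Lemma enormBC x y : enorm (x - y) = enorm (y - x).
Proof. by rewrite -enormN opprB. Qed.

Lemma cauchy_schwarz x y : `|dot x y| <= enorm x * enorm y.
Proof.
rewrite -(@ler_pXn2r _ 2)// ?nnegrE ?mulr_ge0 ?enorm_ge0//.
rewrite real_normK ?num_real// exprMn !enorm_sqr.
have [y0|y0] := eqVneq y 0.
  by rewrite y0 /dot [X in X ^+ 2]big1 ?expr0n ?mulr_ge0 ?dotxx_ge0// => i _; rewrite mxE mulr0.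
have Y0 : 0 < dot y y.
  by rewrite lt0r dotxx_ge0 andbT -enorm_sqr sqrf_eq0 enorm_eq0.
have := dotxx_ge0 (dot y y *: x - dot x y *: y).
rewrite dotBl !dotBr !dotZl !dotZr (dotC y x) => H.
have : 0 <= dot y y * (dot x x * dot y y - dot x y ^+ 2) by lra.
by rewrite pmulr_rge0// subr_ge0.
Qed.

Lemma enormD x y : enorm (x + y) <= enorm x + enorm y.
Proof.
rewrite -(@ler_pXn2r _ 2)// ?nnegrE ?addr_ge0 ?enorm_ge0//.
rewrite sqrrD !enorm_sqr dotDl !dotDr (dotC y x) -!addrA lerD2l.
have := cauchy_schwarz x y; have := ler_norm (dot x y); lra.
Qed.

Lemma enormB_le x y z : enorm (x - z) <= enorm (x - y) + enorm (y - z).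
Proof. by apply: le_trans (enormD _ _); rewrite addrA subrK. Qed.

Lemma coord_le_norm x i : `|x ord0 i| <= `|x|.
Proof.
rewrite (_ : `|x| = mx_norm x)// mx_normrE; apply/bigmax_geP; right.
by exists (ord0, i).
Qed.

Lemma norm_le_enorm x : `|x| <= enorm x.
Proof.
rewrite (_ : `|x| = mx_norm x)// mx_normrE; apply/bigmax_leP; split; first exact: enorm_ge0.
by move=> [i j] _ /=; rewrite (ord1 i); exact: coord_le_enorm.
Qed.

Lemma enorm_le_norm x : enorm x <= d%:R * `|x|.
Proof.
rewrite -(@ler_pXn2r _ 2)// ?nnegrE ?mulr_ge0 ?enorm_ge0//.
rewrite enorm_sqr; apply: (@le_trans _ _ (d%:R * `|x| ^+ 2)).
  rewrite mulr_natl -[X in _ *+ X](card_ord d) -sumr_const; apply: ler_sum => i _.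
  rewrite -expr2 -[leLHS]real_normK ?num_real// ler_pXn2r ?nnegrE//.
  exact: coord_le_norm.
by rewrite exprMn ler_wpM2r ?sqr_ge0// -natrX ler_nat; case: (d) => // n; rewrite leq_pmulr.
Qed.

Lemma nbhs_enormP x (U : set 'rV[R]_d) :
  nbhs x U <-> exists2 e : R, 0 < e & forall y, enorm (y - x) < e -> U y.
Proof.
split => [/nbhs_ballP[e /= e0 H]|[e e0 H]].
  exists e => // y yx; apply: H; rewrite mx_norm_ball /ball_ /=.
  by rewrite distrC; apply: le_lt_trans (norm_le_enorm _) yx.
apply/nbhs_ballP; exists (e / (d%:R + 1)) => /=.
  by rewrite divr_gt0// ltr_wpDl.
move=> y; rewrite mx_norm_ball /ball_ /= distrC => yx; apply: H.
apply: le_lt_trans (enorm_le_norm _) _.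
move: yx; rewrite ltr_pdivlMr ?ltr_wpDl// mulrDr mulr1 mulrC => yx.
by apply: le_lt_trans yx; rewrite lerDl.
Qed.

Lemma open_eball_lt x s : open [set y : 'rV[R]_d | enorm (y - x) < s].
Proof.
rewrite openE => y /= ys; apply/nbhs_enormP; exists (s - enorm (y - x)) => [|z zy].
  by rewrite subr_gt0.
by rewrite /=; apply: le_lt_trans (enormB_le z y x) _; lra.
Qed.

End dot_product.

Section measurability.
Context {disp : measure_display} {T : measurableType disp} {R : realType} {d : nat}.
Implicit Types f g : T -> 'rV[R]_d.

Lemma measurable_rVD f g : measurable_fun setT f -> measurable_fun setT g ->
  measurable_fun setT (fun x => f x + g x).
Proof.
move=> /measurable_fun_rVP mf /measurable_fun_rVP mg; apply/measurable_fun_rVP => i.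
rewrite (_ : (fun x => _) = (fun x => f x ord0 i + g x ord0 i)); last by apply/funext => x; rewrite mxE.
exact: measurable_funD.
Qed.

Lemma measurable_rVZ (h : T -> R) g : measurable_fun setT h -> measurable_fun setT g ->
  measurable_fun setT (fun x => h x *: g x).
Proof.
move=> mh /measurable_fun_rVP mg; apply/measurable_fun_rVP => i.
rewrite (_ : (fun x => _) = (fun x => h x * g x ord0 i)); last by apply/funext => x; rewrite mxE.
exact: measurable_funM.
Qed.

Lemma measurable_rVB f g : measurable_fun setT f -> measurable_fun setT g ->
  measurable_fun setT (fun x => f x - g x).
Proof.
move=> mf mg; apply: measurable_rVD => //.
rewrite (_ : (fun x => _) = (fun x => cst (-1 : R) x *: g x)); last first.
  by apply/funext => x; rewrite scaleN1r.
exact: measurable_rVZ.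
Qed.

Lemma measurable_dot f g : measurable_fun setT f -> measurable_fun setT g ->
  measurable_fun setT (fun x => dot (f x) (g x)).
Proof.
move=> /measurable_fun_rVP mf /measurable_fun_rVP mg; apply: measurable_sum => i.
exact: measurable_funM.
Qed.

Lemma measurable_enorm f : measurable_fun setT f ->
  measurable_fun setT (fun x => enorm (f x)).
Proof.
move=> mf; rewrite (_ : (fun x => _) = Num.sqrt \o (fun x => dot (f x) (f x))).
  apply: measurableT_comp; last exact: measurable_dot.
  by apply: continuous_measurable_fun => x; exact: sqrt_continuous.
by apply/funext => x /=; congr Num.sqrt; apply: eq_bigr => i _; rewrite expr2.
Qed.

Lemma measurable_bool_fun (b : T -> bool) :
  measurable_fun setT b -> measurable_fun setT (fun x => (b x)%:R%:E : \bar R).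
Proof.
move=> mb; apply: (measurableT_comp (f := fun c : bool => c%:R%:E : \bar R)) mb.
by move=> _ Y mY; exact: I.
Qed.

Lemma measurable_bool_set (b : T -> bool) :
  measurable_fun setT b -> measurable [set x | b x].
Proof.
move=> mb; rewrite (_ : [set x | b x] = setT `&` b @^-1` [set true]).
  exact: mb.
by rewrite setTI; apply/seteqP; split.
Qed.

Lemma measurable_forall (I : finType) (b : I -> T -> bool) :
  (forall i, measurable_fun setT (b i)) ->
  measurable_fun setT (fun x => [forall i, b i x]).
Proof.
move=> mb; rewrite (_ : (fun x => _) = (fun x => \big[andb/true]_(i <- index_enum I) b i x)); last first.
  by apply/funext => x; rewrite big_andE.
elim: (index_enum I) => [|i s IH].
  by rewrite (_ : (fun x => _) = cst true)//; apply/funext => x; rewrite big_nil.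
rewrite (_ : (fun x => _) = (fun x => b i x && \big[andb/true]_(i <- s) b i x)).
  exact: measurable_and.
by apply/funext => x; rewrite big_cons.
Qed.

Lemma measurable_exists (I : finType) (b : I -> T -> bool) :
  (forall i, measurable_fun setT (b i)) ->
  measurable_fun setT (fun x => [exists i, b i x]).
Proof.
move=> mb; rewrite (_ : (fun x => _) = (fun x => ~~ [forall i, ~~ b i x])).
  by apply: measurable_neg; apply: measurable_forall => i; exact: measurable_neg.
by apply/funext => x; rewrite negb_forall; apply: eq_existsb => i; rewrite negbK.
Qed.

(** A predicate of finitely many measurable bits is a finite union over bit patterns. Connectedness
    of a tuple is measurable for this reason: it depends on the tuple through its adjacency table
    alone. *)
Lemma measurable_pattern (I : finType) (b : I -> T -> bool)
    (g : {ffun I -> bool} -> bool) :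
  (forall i, measurable_fun setT (b i)) ->
  measurable_fun setT (fun x => g [ffun i => b i x]).
Proof.
move=> mb; rewrite (_ : (fun x => _) =
    (fun x => [exists p : {ffun I -> bool}, g p && [forall i, b i x == p i]])).
  apply: measurable_exists => p; apply: measurable_and => //.
  apply: measurable_forall => i; case: (p i).
    by rewrite (_ : (fun x => _) = b i)//; apply/funext => x; rewrite eqb_id.
  rewrite (_ : (fun x => _) = (fun x => ~~ b i x)); first exact: measurable_neg.
  by apply/funext => x; rewrite eqbF_neg.
apply/funext => x; apply/idP/existsP => [gx|[p /andP[gp /forallP bp]]].
  by exists [ffun i => b i x]; rewrite gx; apply/forallP => i; rewrite ffunE.
by rewrite (_ : [ffun i => b i x] = p)//; apply/ffunP => i; rewrite ffunE; exact/eqP.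
Qed.

End measurability.

(** * Open and closed sets in the product sigma-algebra *)

Section open_measurable.
Context {R : realType} {d : nat}.

Lemma measurable_eball (x : 'rV[R]_d) s : measurable (eball x s).
Proof.
apply: (@measurable_bool_set _ _ (fun y : 'rV[R]_d => enorm (y - x) <= s)).
apply: measurable_fun_ler => //.
by apply: measurable_enorm; apply: measurable_rVB.
Qed.

Lemma measurable_set1_rV (x : 'rV[R]_d) : measurable [set x].
Proof.
rewrite (_ : [set x] = eball x 0); first exact: measurable_eball.
apply/seteqP; split => y /=; first by move=> ->; rewrite /eball/= subrr enorm0.
by rewrite /eball/= => yx; apply/eqP; rewrite -subr_eq0 -enorm_eq0 eq_le yx enorm_ge0.
Qed.

Lemma open_measurable_rV (U : set 'rV[R]_d) : open U -> measurable U.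
Proof.
move=> oU.
pose box (q : 'rV[rat]_d) (m : nat) : set 'rV[R]_d :=
  [set x | forall i, `|x ord0 i - ratr (q ord0 i)| < m.+1%:R^-1].
have mbox q m : measurable (box q m).
  rewrite (_ : box q m = [set x | [forall i, `|x ord0 i - ratr (q ord0 i)| < m.+1%:R^-1]]).
    apply: measurable_bool_set; apply: measurable_forall => i.
    apply: measurable_fun_ltr => //; apply: measurableT_comp => //.
    by apply: measurable_funB => //; exact: measurable_rV_coord.
  by apply/seteqP; split => x /= /forallP.
have -> : U = \bigcup_(qm in [set qm : 'rV[rat]_d * nat | box qm.1 qm.2 `<=` U]) box qm.1 qm.2.
  apply/seteqP; split => [x Ux|x [qm /=]]; last exact.
  have : nbhs x U by exact: open_nbhs_nbhs.
  move=> /nbhs_enormP[e e0 H].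
  (* Two points of one box differ by less than [2 / m.+1] in each coordinate, and [enorm] is at most
     [d] times the maximum norm, so this [m] makes the box fit into the [e]-ball. *)
  pose m := Num.truncn (2 * d%:R / e).
  have m0 : 0 < m.+1%:R^-1 :> R by rewrite invr_gt0.
  have m1 : 2 * d%:R * m.+1%:R^-1 < e.
    by rewrite ltr_pdivrMr// (mulrC e) -ltr_pdivrMr// truncnS_gt.
  have /choice[q hq] : forall i, exists q : rat, `|x ord0 i - ratr q| < m.+1%:R^-1.
    move: m0; move: (m.+1%:R^-1) => w w0 i.
    have xw : x ord0 i - w < x ord0 i by lra.
    have [q] := rat_in_itvoo xw.
    by rewrite in_itv/= => /andP[q1 q2]; exists q; rewrite ltr_norml; apply/andP; split; lra.
  exists (\row_i q i, m) => /=; last by move=> i; rewrite mxE.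
  move=> y hy; apply: H; apply: le_lt_trans (enorm_le_norm _) _.
  apply: le_lt_trans m1; rewrite (mulrC 2) -mulrA ler_wpM2l//.
  rewrite (_ : `|y - x| = mx_norm (y - x))// mx_normrE.
  move: m0 hy hq; rewrite /box/=; move: (m.+1%:R^-1) => w m0 hy hq.
  apply/bigmax_leP; split; first lra.
  move=> [i j] _ /=; rewrite (ord1 i) !mxE.
  have := hy j; have := hq j; rewrite mxE !ltr_norml ler_norml => /andP[a1 a2] /andP[b1 b2].
  by apply/andP; split; lra.
rewrite bigcup_mkcond; apply: countable_bigcupT_measurable; first exact: countableP.
by move=> qm; case: ifP.
Qed.

Lemma closed_measurable_rV (U : set 'rV[R]_d) : closed U -> measurable U.
Proof.
move=> cU; rewrite -(setCK U); apply: measurableC; apply: open_measurable_rV.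
exact: closed_openC.
Qed.

End open_measurable.

Lemma int_subst_measure (disp : measure_display) (T : measurableType disp)
    (R : realType) (mu : {measure set T -> \bar R}) phi c (S : set T) :
  int_subst mu phi c -> measurable S -> mu (phi @^-1` S) = (c%:E * mu S)%E.
Proof.
move=> [mphi c0 H] mS.
have mpS : measurable (phi @^-1` S) by rewrite -[X in measurable X]setTI; exact: mphi.
rewrite -[phi @^-1` S]setIT -[in RHS](setIT S) -!integral_indic//.
rewrite -(H (fun x => (\1_S x)%:E))//.
by apply: measurableT_comp => //; exact: measurable_indic.
Qed.

(** * Volumes of balls *)

Section ball_volume.
Context {R : realType} {d : nat}.
Implicit Types (x : 'rV[R]_d) (s : R).

Lemma vol_eball_scale x s : (0 < s)%R ->
  vol d (eball x s) = ((s ^+ d)%:E * vol d (eball (0%R : 'rV[R]_d) 1%R))%E.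
Proof.
move=> s0; have s1 : s^-1 != 0%R by rewrite invr_eq0 gt_eqF.
have := int_subst_measure (vol_affine (- (s^-1 *: x)) s1) (measurable_eball (0 : 'rV[R]_d) 1).
rewrite gtr0_norm ?invr_gt0// invrK => <-; congr (vol d _).
apply/seteqP; split => y; rewrite /eball/= subr0 -scalerBr enormZ gtr0_norm ?invr_gt0//;
  by rewrite ler_pdivrMl// mulr1.
Qed.

Lemma measurable_cube (a b : R) :
  measurable [set x : 'rV[R]_d | forall i, `[a, b]%classic (x ord0 i)].
Proof.
rewrite (_ : [set _ | _] = [set x : 'rV[R]_d | [forall i, (a <= x ord0 i) && (x ord0 i <= b)]]).
  apply: measurable_bool_set; apply: measurable_forall => i.
  by apply: measurable_and; apply: measurable_fun_ler => //; exact: measurable_rV_coord.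
apply/seteqP; split => x /= h; first by apply/forallP => i; have := h i; rewrite in_itv.
by move=> i; move/forallP : h => /(_ i); rewrite in_itv.
Qed.

Lemma vol_eball1_lty : (vol d (eball (0%R : 'rV[R]_d) 1%R) < +oo)%E.
Proof.
apply: (@le_lt_trans _ _ (\prod_(i < d) lebesgue_measure (`[(-1)%R, 1%R]%classic : set R))%E).
  rewrite -vol_box//; apply: le_measure; rewrite ?inE; [exact: measurable_eball| |].
    exact: measurable_cube.
  move=> x; rewrite /eball/= subr0 => x1 i; rewrite in_itv/= -ler_norml.
  exact: le_trans (coord_le_enorm _ _) x1.
rewrite (eq_bigr (fun=> 2%:E)); last first.
  move=> i _; rewrite lebesgue_measure_itv/= lte_fin ifT; last lra.
  by rewrite -EFinB opprK.
by rewrite prodEFin ltry.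
Qed.

Lemma thetaE : vol d (eball (0 : 'rV[R]_d) 1) = (theta d)%:E.
Proof. by rewrite fineK// ge0_fin_numE// vol_eball1_lty. Qed.

Lemma vol_eball x s : (0 < s)%R -> vol d (eball x s) = (s ^+ d * theta d)%:E.
Proof. by move=> s0; rewrite vol_eball_scale// thetaE -EFinM. Qed.

Lemma theta_gt0 : (0 < theta d :> R)%R.
Proof.
rewrite -lte_fin -thetaE.
(* A cube of half-side [1 / (d + 1)] lies in the unit ball because [enorm] is at most [d] times the
   maximum norm. *)
pose e : R := (d%:R + 1)^-1%R; have e0 : (0 < e)%R by rewrite invr_gt0 ltr_wpDl.
apply: (@lt_le_trans _ _ (\prod_(i < d) lebesgue_measure (`[(- e)%R, e]%classic : set R))%E).
  rewrite (eq_bigr (fun=> (2 * e)%:E)); last first.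
    move=> i _; rewrite lebesgue_measure_itv/= lte_fin ifT; last lra.
    by rewrite -EFinB; congr EFin; lra.
  by rewrite prodEFin lte_fin prodr_gt0// => i _; lra.
rewrite -vol_box//; apply: le_measure; rewrite ?inE; [|exact: measurable_eball|].
  exact: measurable_cube.
move=> x /= h; rewrite /eball/= subr0; apply: le_trans (enorm_le_norm _) _.
apply: (@le_trans _ _ (d%:R * e)%R).
  rewrite ler_wpM2l// (_ : `|x|%R = mx_norm x)// mx_normrE.
  apply/bigmax_leP; split; first exact: ltW.
  by move=> [i j] _ /=; rewrite (ord1 i) ler_norml; have := h j; rewrite in_itv.
by rewrite /e ler_pdivrMr ?mul1r ?lerDl// ltr_wpDl.
Qed.

End ball_volume.

(** * Polar coordinates *)

Lemma measurable_nneg_inv (disp : measure_display) (T : measurableType disp)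
    (R : realType) (f : T -> R) :
  (forall x, 0 <= f x) -> measurable_fun setT f -> measurable_fun setT (fun x => (f x)^-1).
Proof.
move=> f0 mf; rewrite (_ : (fun x => _) = (@powR R ^~ (-1)) \o f).
  by apply: measurableT_comp => //; exact: measurable_powR.
by apply/funext => x /=; rewrite powR_inv1.
Qed.

Lemma measurable_bool_real (disp : measure_display) (T : measurableType disp)
    (R : realType) (b : T -> bool) :
  measurable_fun setT b -> measurable_fun setT (fun x => (b x)%:R : R).
Proof. by move=> mb; apply: (measurableT_comp (f := fun c : bool => c%:R : R)) mb. Qed.

Section inverse_square.
Context {R : realType}.
Notation leb := (@lebesgue_measure R).

(** The constraint says [N / 2 < s <= N], where the primitive [- s^-1] gains [N^-1]. In
    [polar_integral] this is the factor left at a point of norm [N] once the radial integral is done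
    first. *)
Lemma integral_inv_sqr (N : R) : 0 < N ->
  (\int[leb]_s (((0 < s) && ((s <= N) && (N < 2 * s)))%:R * s ^- 2)%:E = (N^-1)%:E)%E.
Proof.
move=> N0.
have m2 : measurable_fun setT (fun s : R => s ^- 2).
  apply: measurable_nneg_inv => [x|]; [exact: sqr_ge0|exact: exprn_measurable].
transitivity (\int[leb]_(s in `[(N / 2)%R, N]) (s ^- 2)%:E)%E.
  rewrite -integral_itv_obnd_cbnd; last first.
    by apply: measurableT_comp => //; exact: measurable_funTS.
  rewrite [RHS]integral_mkcond; apply: eq_integral => s _; rewrite patchE.
  have -> : ((0 < s) && ((s <= N) && (N < 2 * s))) = (s \in `](N / 2)%R, N]%classic).
    apply/idP/idP; rewrite inE/= in_itv/= => /andP[h1 h2]; last first.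
      by apply/andP; split; [lra|apply/andP; split; lra].
    by move/andP: h2 => [h2 h3]; apply/andP; split; lra.
  by case: ifP => _; rewrite ?mul1r ?mul0r.
have dF (s : R) : s != 0 -> is_derive s (1 : R) (fun s => - s^-1) (s ^- 2).
  move=> s0; have := @is_deriveN _ _ _ _ _ _ _ (@is_deriveV _ id s 1 1 s0 (is_derive_id _ _)).
  by rewrite [X in _ (- X)](_ : _ = - s ^- 2) ?opprK //; exact: mulr1.
have cV (s : R) : s != 0 -> {for s, continuous (fun s : R => - s^-1)}.
  by move=> s0; apply: continuousN; exact: inv_continuous.
rewrite (@continuous_FTC2 _ (fun s => s ^- 2) (fun s => - s^-1)).
- by rewrite -EFinB; congr EFin; field; rewrite gt_eqF.
- by lra.
- apply: continuous_in_subspaceT => s; rewrite inE/= in_itv/= => /andP[h _].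
  apply: (@continuous_comp R R R (fun s : R => s ^+ 2) (@GRing.inv R)).
    exact: exprn_continuous.
  by apply: inv_continuous; rewrite expf_eq0/= gt_eqF//; lra.
- split.
  + by move=> s; rewrite in_itv/= => /andP[h _]; have [] := dF s ltac:(by rewrite gt_eqF//; lra).
  + by apply: cvg_at_right_filter; apply: cV; rewrite gt_eqF//; lra.
  + by apply: cvg_at_left_filter; apply: cV; rewrite gt_eqF//; lra.
- move=> s; rewrite in_itv/= => /andP[h _]; rewrite derive1E.
  by have [_] := dF s ltac:(by rewrite gt_eqF//; lra).
Qed.

End inverse_square.

Section polar.
Context {R : realType} {d : nat}.
Hypothesis d0 : (0 < d)%N.
Notation leb := (@lebesgue_measure R).
Notation E := 'rV[R]_d.

(** Since the integral of [t^(1-d) t^(d-1)] over [1 <= t < 2] equals 1, the image of this density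
    under [x / |x|] is the surface measure of the unit sphere, and its total mass is the area of the
    sphere. *)
Definition shell_weight (x : E) : R :=
  ((1 <= enorm x) && (enorm x < 2))%:R * enorm x ^- d.-1.

Lemma shell_weight_ge0 x : 0 <= shell_weight x.
Proof. by rewrite mulr_ge0// invr_ge0 exprn_ge0// enorm_ge0. Qed.

Lemma shell_weightN_ge0 x : 0 <= shell_weight x * enorm x.
Proof. by apply: mulr_ge0; [exact: shell_weight_ge0|exact: enorm_ge0]. Qed.

Lemma measurable_shell_weight : measurable_fun setT shell_weight.
Proof.
apply: measurable_funM; last first.
  apply: measurable_nneg_inv => [x|]; first by rewrite exprn_ge0// enorm_ge0.
  by apply: measurable_funX; exact: measurable_enorm.
apply: measurable_bool_real; apply: measurable_and.
  by apply: measurable_fun_ler => //; exact: measurable_enorm.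
by apply: measurable_fun_ltr => //; exact: measurable_enorm.
Qed.

Variable F : E -> R.
Hypotheses (mF : measurable_fun setT F) (F0 : forall x, 0 <= F x).

Let mN : measurable_fun setT (fun x : E => enorm x).
Proof. exact: measurable_enorm. Qed.

Let pos (s : R) : R := (0 < s)%R%:R.

Let mpos : measurable_fun setT pos.
Proof. by apply: measurable_bool_real; apply: measurable_fun_ltr. Qed.

Let pos0 s : 0 <= pos s. Proof. by []. Qed.

Let mscale : measurable_fun setT (fun p : measurableTypeR R * E => F (p.1 *: p.2)).
Proof.
by apply: measurableT_comp => //; apply: measurable_rVZ.
Qed.

Let mscale2 : measurable_fun setT (fun p : E * measurableTypeR R => F (p.2 *: p.1)).
Proof. by apply: measurableT_comp => //; apply: measurable_rVZ. Qed.

Let ray_average x : 1 <= enorm x ->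
  (\int[leb]_t (pos t * F (t *: ((enorm x)^-1 *: x)))%:E =
   (enorm x)%:E * \int[leb]_s (pos s * F (s *: x))%:E)%E.
Proof.
move=> Nx; have N0 : 0 < enorm x by lra.
have a0 : (enorm x)^-1 != 0 by rewrite invr_eq0 gt_eqF.
have [_ _ H] := lebesgue_affine 0 a0.
have := H (fun s => (pos s * F (s *: x))%:E).
rewrite gtr0_norm ?invr_gt0// invrK => <-.
- apply: eq_integral => t _; congr EFin; rewrite addr0 scalerA (mulrC t); congr (_ * _).
  by rewrite /pos pmulr_rgt0// invr_gt0.
- apply/measurable_EFinP; apply: measurable_funM => //.
  apply: measurableT_comp => //; apply: measurable_rVZ => //.
- by move=> s; rewrite lee_fin mulr_ge0.
Qed.

(** The substitution [y = s *: x] leaves [s ^- 2] in every dimension: the Jacobian gives [s^(-d)],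
    the weight [s^(d-1)] and the norm [s^(-1)]. *)
Let shell_rescale s : 0 < s ->
  (\int[vol d]_x (shell_weight x * enorm x * F (s *: x))%:E =
   \int[vol d]_y (((s <= enorm y) && (enorm y < 2 * s))%:R * s ^- 2 *
     (enorm y ^- d.-1 * enorm y * F y))%:E)%E.
Proof.
move=> s0; have [_ _ H] := vol_affine (0 : E) (lt0r_neq0 s0).
have mG : measurable_fun setT
    (fun y : E => (shell_weight (s^-1 *: y) * enorm (s^-1 *: y) * F y)%:E).
  have mz : measurable_fun setT (fun y : E => s^-1 *: y) by exact: measurable_rVZ.
  apply/measurable_EFinP; apply: measurable_funM => //; apply: measurable_funM.
    exact: measurableT_comp measurable_shell_weight mz.
  exact: measurable_enorm.
have := H _ mG; rewrite gtr0_norm// => H'.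
transitivity (((s^-1 ^+ d)%:E * \int[vol d]_y (shell_weight (s^-1 *: y) * enorm (s^-1 *: y) * F y)%:E)%E).
  rewrite -H'; last first.
    by move=> y; rewrite lee_fin mulr_ge0// shell_weightN_ge0.
  by apply: eq_integral => x _; rewrite addr0 scalerA mulVf ?scale1r// gt_eqF.
rewrite -ge0_integralZl//; last 2 first.
- by move=> y _; rewrite lee_fin mulr_ge0// shell_weightN_ge0.
- by rewrite lee_fin exprn_ge0// invr_ge0 ltW.
apply: eq_integral => y _; rewrite -EFinM; congr EFin.
rewrite /shell_weight enormZ gtr0_norm ?invr_gt0//.
rewrite ler_pdivlMl// ltr_pdivrMl// mulr1 (mulrC s 2).
rewrite (_ : s^-1 ^+ d = s^-1 * s^-1 ^+ d.-1); last by rewrite -exprS prednK.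
rewrite exprMn invfM exprVn invrK.
have sp : s ^+ d.-1 != 0 by rewrite expf_eq0 gt_eqF ?andbF.
move: (enorm y ^- d.-1) sp; move: (s ^+ d.-1) => a b sp; field.
by rewrite sp gt_eqF.
Qed.

(* Averaging over the shell [1 <= |x| < 2] replaces the surface measure of the sphere. *)
Lemma polar_integral :
  (\int[vol d]_x ((x != 0)%R%:R * enorm x ^- d.-1 * F x)%:E =
   \int[vol d]_x ((shell_weight x)%:E * \int[leb]_t ((0 < t)%R%:R * F (t *: ((enorm x)^-1 *: x)))%:E))%E.
Proof.
have msw := measurable_shell_weight.
transitivity (\int[vol d]_x \int[leb]_s (shell_weight x * enorm x * (pos s * F (s *: x)))%:E)%E; last first.
  apply: eq_integral => x _.
  have mI : measurable_fun setT (fun s : measurableTypeR R => (pos s * F (s *: x))%:E).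
    apply/measurable_EFinP; apply: measurable_funM => //.
    by apply: measurableT_comp => //; apply: measurable_rVZ.
  have [Nx|Nx] := boolP ((1 <= enorm x) && (enorm x < 2)); last first.
    rewrite /shell_weight (negbTE Nx) mul0r mul0e.
    by under eq_integral do rewrite !mul0r; rewrite integral0.
  rewrite ray_average; last by case/andP: Nx.
  rewrite muleA -EFinM -ge0_integralZl//.
  - by move=> s _; rewrite lee_fin mulr_ge0.
  - by rewrite lee_fin shell_weightN_ge0.
have m1 : measurable_fun setT (fun p : E * measurableTypeR R =>
    (shell_weight p.1 * enorm p.1 * (pos p.2 * F (p.2 *: p.1)))%:E).
  apply/measurable_EFinP; apply: measurable_funM.
    apply: measurable_funM; first exact: measurableT_comp msw measurable_fst.
    exact: measurable_enorm.
  apply: measurable_funM => //; exact: (measurableT_comp mpos measurable_snd).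
rewrite [RHS](fubini_tonelli _ m1); last first.
  by move=> p; rewrite lee_fin mulr_ge0 ?shell_weightN_ge0// mulr_ge0.
(* Rescaling at fixed [s] frees the argument of [F] from [s]. After exchanging the integrals again,
   the one in [s] at fixed [y] is [integral_inv_sqr]. *)
transitivity (\int[leb]_s \int[vol d]_y (((0 < s) && ((s <= enorm y) && (enorm y < 2 * s)))%:R * s ^- 2 *
     (enorm y ^- d.-1 * enorm y * F y))%:E)%E; last first.
  apply: eq_integral => s _ /=.
  have [s0|s0] := boolP (0 < s); last first.
    rewrite !integral0_eq// => x _; first by rewrite /pos (negbTE s0) !mul0r mulr0.
    by rewrite !mul0r.
  rewrite -[LHS]shell_rescale//; apply: eq_integral => y _.
  by rewrite /pos s0 mul1r.
have m2 : measurable_fun setT (fun p : E * measurableTypeR R =>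
   (((0 < p.2) && ((p.2 <= enorm p.1) && (enorm p.1 < 2 * p.2)))%:R * p.2 ^- 2 *
     (enorm p.1 ^- d.-1 * enorm p.1 * F p.1))%:E).
  have mN1 : measurable_fun setT (fun p : E * measurableTypeR R => enorm p.1).
    exact: measurable_enorm.
  apply/measurable_EFinP; apply: measurable_funM; last first.
    apply: measurable_funM; last exact: measurableT_comp mF measurable_fst.
    apply: measurable_funM => //; apply: measurable_nneg_inv => [p|].
      by rewrite exprn_ge0// enorm_ge0.
    exact: measurable_funX.
  apply: measurable_funM.
    apply: measurable_bool_real; apply: measurable_and; first exact: measurable_fun_ltr.
    apply: measurable_and; first exact: measurable_fun_ler.
    by apply: measurable_fun_ltr => //; exact: measurable_funM.
  apply: measurable_nneg_inv => [p|]; first exact: sqr_ge0.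
  by apply: measurable_funX.
rewrite -[RHS](fubini_tonelli _ m2); last first.
  move=> p; rewrite lee_fin !mulr_ge0 ?invr_ge0 ?sqr_ge0 ?exprn_ge0 ?enorm_ge0//.
apply: eq_integral => y _ /=.
under eq_integral do rewrite mulrC EFinM.
have mJ : measurable_fun setT (fun s : measurableTypeR R =>
    (((0 < s) && ((s <= enorm y) && (enorm y < 2 * s)))%:R * s ^- 2)%:E).
  apply/measurable_EFinP; apply: measurable_funM.
    apply: measurable_bool_real; apply: measurable_and; first exact: measurable_fun_ltr.
    apply: measurable_and; first exact: measurable_fun_ler.
    by apply: measurable_fun_ltr => //; exact: measurable_funM.
  apply: measurable_nneg_inv => [p|]; first exact: sqr_ge0.
  exact: measurable_funX.
rewrite ge0_integralZl//; last 2 first.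
- by move=> s _; rewrite lee_fin mulr_ge0// invr_ge0 sqr_ge0.
- by rewrite lee_fin !mulr_ge0 ?invr_ge0 ?exprn_ge0 ?enorm_ge0.
have [->|y0] := eqVneq y 0.
  by rewrite enorm0 !mul0r mulr0 !mul0r mul0e.
have N0 : 0 < enorm y by rewrite lt0r enorm_ge0 enorm_eq0 y0.
rewrite integral_inv_sqr// -EFinM; congr EFin.
rewrite mul1r; move: (enorm y ^- d.-1) => b; field.
by rewrite gt_eqF.
Qed.
End polar.

Section radial_shells.
Context {R : realType} {d : nat}.
Hypothesis d0 : (0 < d)%N.
Notation leb := (@lebesgue_measure R).
Notation E := 'rV[R]_d.

Lemma vol_set1 (x : E) : vol d [set x] = 0%E.
Proof.
have m1 : measurable [set x] by exact: measurable_set1_rV.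
apply/eqP; rewrite eq_le measure_ge0 andbT; apply/lee_addgt0Pr => e e0; rewrite add0e.
pose s : R := Num.min 1 (e / theta d).
have th0 := @theta_gt0 R d.
have s0 : 0 < s by rewrite lt_min ltr01 divr_gt0.
apply: (@le_trans _ _ (vol d (eball x s))).
  apply: le_measure; rewrite ?inE//; first exact: measurable_eball.
  by move=> _ ->; rewrite /eball/= subrr enorm0 ltW.
rewrite vol_eball// lee_fin; apply: (@le_trans _ _ (s * theta d)).
  rewrite ler_pM2r// -(prednK d0) exprS ger_pMr// exprn_ile1//; first exact: ltW.
  by rewrite /s ge_min lexx.
by rewrite -ler_pdivlMr// ge_min lexx orbT.
Qed.

(** With density [enorm x ^- d.-1] every ray carries plain length, so the region contributes the
    length [b x] in the direction of [x], wherever it starts. The start [a = 0] gives [gfun] and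
    [a = 1] the part of a nearby ball outside the unit ball; their agreement to first order comes
    from here. *)
Lemma integral_radial_shell (a : R) (b : E -> R) : 0 <= a ->
  measurable_fun setT b -> (forall x, 0 <= b x) ->
  (forall t x, 0 < t -> b (t *: x) = b x) ->
  (\int[vol d]_x (((a < enorm x) && (enorm x <= a + b x))%:R * enorm x ^- d.-1)%:E =
   \int[vol d]_x (shell_weight x * b x)%:E)%E.
Proof.
move=> a0 mb b0 bhom.
pose F (x : E) : R := ((a < enorm x) && (enorm x <= a + b x))%:R.
have mN : measurable_fun setT (fun x : E => enorm x) by exact: measurable_enorm.
have mF : measurable_fun setT F.
  apply: measurable_bool_real; apply: measurable_and; first exact: measurable_fun_ltr.
  by apply: measurable_fun_ler => //; exact: measurable_funD.
transitivity (\int[vol d]_x ((x != 0)%R%:R * enorm x ^- d.-1 * F x)%:E)%E.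
  apply: eq_integral => x _; congr EFin; rewrite /F.
  have [->|x0] := eqVneq x 0; last by rewrite mul1r mulrC.
  by rewrite enorm0 ltNge a0 !mul0r.
rewrite polar_integral//; apply: eq_integral => x _.
have [Nx|Nx] := boolP ((1 <= enorm x) && (enorm x < 2)); last first.
  by rewrite /shell_weight (negbTE Nx) !mul0r mul0e.
have N0 : 0 < enorm x by case/andP: Nx => h _; lra.
rewrite [RHS]EFinM; congr (_ * _)%E.
transitivity (\int[leb]_t (\1_(`]a, (a + b x)%R]%classic : set R) t)%:E)%E.
  apply: eq_integral => t _; congr EFin; rewrite /F indicE.
  have -> : (t \in `]a, (a + b x)%R]%classic) = (a < t) && (t <= a + b x).
    by apply/idP/idP; rewrite inE/= in_itv.
  have [t0|t0] := boolP (0 < t); last first.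
    by rewrite mul0r; case: ltP => // h; case/negP: t0; lra.
  rewrite mul1r enormZ enormZ gtr0_norm// gtr0_norm ?invr_gt0// mulVf ?gt_eqF// mulr1.
  by rewrite !bhom// invr_gt0.
rewrite integral_indic//; first (rewrite setIT [LHS](lebesgue_measure_itv `]a, (a + b x)%R])/= lte_fin).
have := b0 x; case: ltP => h h'; first by rewrite -EFinB; congr EFin; lra.
by congr EFin; lra.
Qed.

Lemma integral_shell_weight_lty :
  (\int[vol d]_x (@shell_weight R d x)%:E < +oo)%E.
Proof.
apply: (@le_lt_trans _ _ (\int[vol d]_x (\1_(eball (0 : E) 2) x)%:E)%E).
  apply: ge0_le_integral => //.
  - by move=> x _; rewrite lee_fin shell_weight_ge0.
  - by apply/measurable_EFinP; exact: measurable_shell_weight.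
  - by apply/measurable_EFinP; apply: measurable_indic; exact: measurable_eball.
  move=> x _; rewrite lee_fin /shell_weight indicE.
  have [/andP[h1 h2]|_] := boolP ((1 <= enorm x) && (enorm x < 2)); last by rewrite mul0r.
  rewrite mul1r (_ : x \in _); last by rewrite inE /eball/= subr0 ltW.
  by rewrite invf_le1 ?exprn_ege1// exprn_gt0//; lra.
rewrite integral_indic ?setIT//; last exact: measurable_eball.
by change (vol d (eball (0 : E) 2) < +oo)%E; rewrite vol_eball ?ltry.
Qed.

End radial_shells.

(** * Unions of unit balls with nearby centres *)

Section ball_unions.
Context {R : realType} {d : nat}.
Notation E := 'rV[R]_d.

Definition ball_union n (r : R) (w : n.-tuple E) : set E :=
  [set x | [exists i, enorm (x - tnth w i) <= r]].

Lemma measurable_ball_union n r (w : n.-tuple E) : measurable (ball_union r w).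
Proof.
apply: measurable_bool_set; apply: measurable_exists => i.
by apply: measurable_fun_ler => //; apply: measurable_enorm; exact: measurable_rVB.
Qed.

(* In polar form, [B(w_i / 2, |w_i| / 2)] is [{x | |x| <= w_i.x / |x|}]; hence [gfun w] is
   the integral of [|x|^(1-d) rho w x] over the shell [1 <= |x| < 2], up to the polar
   normalisation of [shell_weight]. *)
Definition rho n (w : n.-tuple E) (x : E) : R :=
  \big[Num.max/0]_(i < n) (dot (tnth w i) x / enorm x).

Lemma rho_ge0 n (w : n.-tuple E) x : 0 <= rho w x.
Proof. by apply/bigmax_geP; left. Qed.

Lemma rho_hom n (w : n.-tuple E) t x : 0 < t -> rho w (t *: x) = rho w x.
Proof.
move=> t0; apply: eq_bigr => i _.
rewrite dotZr enormZ gtr0_norm// invfM mulrACA divff ?mul1r// gt_eqF//.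
Qed.

Lemma le_rho n (w : n.-tuple E) c x : 0 < c -> c <= rho w x ->
  exists i, c <= dot (tnth w i) x / enorm x.
Proof.
move=> c0 /bigmax_geP[|[i _ h]]; first by rewrite leNgt c0.
by exists i.
Qed.

Lemma rho_le n (w : n.-tuple E) s x : 0 <= s ->
  (forall i, enorm (tnth w i) <= s) -> rho w x <= s.
Proof.
move=> s0 ws; apply/bigmax_leP; split => // i _.
have [->|x0] := eqVneq x 0; first by rewrite enorm0 invr0 mulr0.
have N0 : 0 < enorm x by rewrite lt0r enorm_ge0 enorm_eq0 x0.
rewrite ler_pdivrMr//; apply: le_trans (ler_norm _) _.
apply: le_trans (cauchy_schwarz _ _) _; by rewrite ler_pM2r.
Qed.

End ball_unions.

Section rho_measurable.
Context {disp : measure_display} {T : measurableType disp} {R : realType} {d : nat}.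
Notation E := 'rV[R]_d.

Lemma measurable_rho_fun n (w : T -> n.-tuple E) (x : T -> E) :
  measurable_fun setT w -> measurable_fun setT x ->
  measurable_fun setT (fun t => rho (w t) (x t)).
Proof.
move=> mw mx; rewrite /rho.
have mi i : measurable_fun setT (fun t => dot (tnth (w t) i) (x t) / enorm (x t)).
  apply: measurable_funM.
    apply: measurable_dot => //.
    exact: (measurableT_comp (measurable_tnth i) mw).
  by apply: measurable_nneg_inv => [t|]; [exact: enorm_ge0|exact: measurable_enorm].
elim: (index_enum _) => [|i s IH].
  by rewrite (_ : (fun t => _) = cst 0)//; apply/funext => t; rewrite big_nil.
rewrite (_ : (fun t => _) = (fun t => Num.max (dot (tnth (w t) i) (x t) / enorm (x t))
   (\big[Num.max/0]_(j <- s) (dot (tnth (w t) j) (x t) / enorm (x t))))).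
  exact: measurable_maxr.
by apply/funext => t; rewrite big_cons.
Qed.

End rho_measurable.

Section lens.
Context {R : realType} {d : nat}.
Hypothesis d0 : (0 < d)%N.
Notation E := 'rV[R]_d.

(** Thales: this is the ball with diameter from [0] to [w]. *)
Lemma half_ballP (w x : E) :
  (enorm (x - 2^-1 *: w) <= enorm w / 2) = (enorm x ^+ 2 <= dot w x).
Proof.
rewrite -(@ler_pXn2r _ 2)// ?nnegrE ?divr_ge0 ?enorm_ge0//.
rewrite exprMn !enorm_sqr dotBl !dotBr !dotZl !dotZr (dotC x w).
by apply/idP/idP => h; lra.
Qed.

(* To second order, the unit ball centred at [w] reaches out to [1 + w.x / |x|] in the direction
   of [x]. *)
Lemma lens_upper (w x : E) : 1 < enorm x -> enorm (x - w) <= 1 ->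
  enorm x <= 1 + dot w x / enorm x.
Proof.
move=> x1; have N0 : 0 < enorm x by lra.
rewrite -(@ler_pXn2r _ 2)// ?nnegrE ?enorm_ge0// enorm_sqr dotBl !dotBr (dotC x w) -!enorm_sqr => h.
set q := dot w x / enorm x.
have qE : dot w x = q * enorm x by rewrite /q divfK ?gt_eqF.
have qw : q ^+ 2 <= enorm w ^+ 2.
  rewrite /q exprMn exprVn ler_pdivrMr ?exprn_gt0//.
  rewrite -exprMn -[leLHS]real_normK ?num_real// ler_pXn2r ?nnegrE ?mulr_ge0 ?enorm_ge0//.
  exact: cauchy_schwarz.
clearbody q; move: h qw; rewrite qE; clear qE; move: (enorm x) (enorm w) q x1 => N W q0 N1 h qw.
have : (N - q0) ^+ 2 <= 1 by nra.
by move=> h2; rewrite leNgt; apply/negP => h3; nra.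
Qed.

(** With [q = w.x / |x|], the exact reach is [q + sqrt (1 - (|w|^2 - q^2))]. Since
    [sqrt (1 - u) >= 1 - u] on [[0, 1]], giving up [s ^+ 2] is enough to stay inside the ball. *)
Lemma lens_lower (w x : E) s : 0 <= s -> s <= 1 -> enorm w <= s -> 0 < enorm x ->
  1 < enorm x -> enorm x <= 1 + (dot w x / enorm x - s ^+ 2) ->
  enorm (x - w) <= 1.
Proof.
move=> s0 s1 ws N0 x1.
move=> hx; rewrite -(@ler_pXn2r _ 2)// ?nnegrE ?enorm_ge0// enorm_sqr dotBl !dotBr (dotC x w) -!enorm_sqr.
set q := dot w x / enorm x.
have qE : dot w x = q * enorm x by rewrite /q divfK ?gt_eqF.
have qw : q ^+ 2 <= enorm w ^+ 2.
  rewrite /q exprMn exprVn ler_pdivrMr ?exprn_gt0//.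
  rewrite -exprMn -[leLHS]real_normK ?num_real// ler_pXn2r ?nnegrE ?mulr_ge0 ?enorm_ge0//.
  exact: cauchy_schwarz.
have W0 := enorm_ge0 w.
clearbody q; move: qw hx; rewrite qE; clear qE; move: (enorm x) (enorm w) q x1 W0 ws => N W q0 N1 W0 ws qw h.
rewrite mulfK in h; last by rewrite gt_eqF//; lra.
have W2 : W ^+ 2 <= s ^+ 2 by rewrite ler_pXn2r.
have s2 : s ^+ 2 <= 1 by rewrite expr_le1.
have q1 : q0 <= 1 by nra.
have a1 : 0 <= N - q0 by lra.
have a2 : N - q0 <= 1 - s ^+ 2 by lra.
have : (N - q0) ^+ 2 <= (1 - s ^+ 2) ^+ 2 by rewrite ler_pXn2r// nnegrE; lra.
have : (1 - s ^+ 2) ^+ 2 <= 1 - s ^+ 2.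
  move: (s ^+ 2) s2 (sqr_ge0 s) => u u1 u0; nra.
rewrite expr1n.
nra.
Qed.

Definition radial_gauge n (w : n.-tuple E) : \bar R :=
  (\int[vol d]_x (shell_weight x * rho w x)%:E)%E.

Notation c2 := (\int[vol d]_x (@shell_weight R d x)%:E)%E.

Lemma measurable_rho n (w : n.-tuple E) : measurable_fun setT (rho w).
Proof. exact: (measurable_rho_fun (w := fun=> w) (x := id)). Qed.

Lemma integral_half_balls n (w : n.-tuple E) :
  (\int[vol d]_(x in \bigcup_(i in [set: 'I_n])
      eball (2^-1 *: tnth w i) (enorm (tnth w i) / 2)) (enorm x ^- d.-1)%:E
   = radial_gauge w)%E.
Proof.
set S := \bigcup_(i in _) _.
have mS : measurable S.
  rewrite (_ : S = [set x | [exists i, enorm (x - 2^-1 *: tnth w i) <= enorm (tnth w i) / 2]]).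
    apply: measurable_bool_set; apply: measurable_exists => i.
    by apply: measurable_fun_ler => //; apply: measurable_enorm; exact: measurable_rVB.
  apply/seteqP; split => x; first by move=> [i _ h]; apply/existsP; exists i.
  by move=> /existsP[i h]; exists i.
have mNi : measurable_fun setT (fun x : E => (enorm x ^- d.-1)%:E).
  apply/measurable_EFinP; apply: measurable_nneg_inv => [x|].
    by rewrite exprn_ge0// enorm_ge0.
  by apply: measurable_funX; exact: measurable_enorm.
have m0 : measurable [set (0 : E)].
  rewrite (_ : [set 0] = eball (0:E) 0); first exact: measurable_eball.
  apply/seteqP; split => y; rewrite /eball/=; first by move=> ->; rewrite subrr enorm0.
  by rewrite le_eqVlt ltNge enorm_ge0 orbF enorm_eq0 subr_eq0 => /eqP.
(* The origin belongs to every half-ball but not to the polar region [0 < enorm x], so this null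
   point is removed first. *)
transitivity (\int[vol d]_(x in S `\` [set (0%R : E)]) (enorm x ^- d.-1)%:E)%E.
  apply: ge0_negligible_integral => //; first exact: measurable_funTS.
    by move=> x _; rewrite lee_fin invr_ge0 exprn_ge0// enorm_ge0.
  exact: vol_set1.
rewrite integral_mkcond /radial_gauge -(integral_radial_shell d0 (lexx 0))//; last 3 first.
- exact: measurable_rho.
- exact: rho_ge0.
- by move=> t x; exact: rho_hom.
apply: eq_integral => x _; rewrite patchE add0r.
have -> : (x \in S `\` [set (0 : E)]) = (0 < enorm x) && (enorm x <= rho w x).
  apply/idP/idP; rewrite inE.
    move=> [[i _ h] x0].
    have N0 : 0 < enorm x by rewrite lt0r enorm_ge0 enorm_eq0 andbT; apply/eqP => x0'; exact: x0.
    rewrite N0/=; apply/bigmax_geP; right; exists i => //.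
    by rewrite ler_pdivlMr// -expr2 -half_ballP.
  move=> /andP[N0 /(le_rho N0)[i h]]; split; last by move=> x0; rewrite x0 enorm0 ltxx in N0.
  exists i => //; rewrite /eball/= half_ballP.
  by move: h; rewrite ler_pdivlMr// -expr2.
by case: ifP => _; rewrite ?mul1r ?mul0r.
Qed.

Lemma radial_gauge_le n (w : n.-tuple E) s : 0 <= s ->
  (forall i, enorm (tnth w i) <= s) -> (radial_gauge w <= s%:E * c2)%E.
Proof.
move=> s0 ws; rewrite -ge0_integralZl//; last 2 first.
- by apply/measurable_EFinP; exact: measurable_shell_weight.
- by move=> x _; rewrite lee_fin shell_weight_ge0.
apply: ge0_le_integral => //.
- by move=> x _; rewrite lee_fin mulr_ge0 ?shell_weight_ge0 ?rho_ge0.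
- apply/measurable_EFinP; apply: measurable_funM; first exact: measurable_shell_weight.
  exact: measurable_rho.
- apply/measurable_EFinP; apply: measurable_funM => //; exact: measurable_shell_weight.
by move=> x _; rewrite -EFinM lee_fin mulrC ler_wpM2r ?shell_weight_ge0// rho_le.
Qed.

Lemma radial_gauge_lty n (w : n.-tuple E) : (radial_gauge w < +oo)%E.
Proof.
apply: le_lt_trans (radial_gauge_le (s := \sum_(i < n) enorm (tnth w i)) _ _) _.
- by apply: sumr_ge0 => i _; exact: enorm_ge0.
- by move=> i; rewrite (bigD1 i)//= lerDl; apply: sumr_ge0 => j _; exact: enorm_ge0.
- rewrite lte_mul_pinfty ?integral_shell_weight_lty//.
  by rewrite lee_fin; apply: sumr_ge0 => i _; exact: enorm_ge0.
Qed.

(** A single ball of diameter [W = |w_i|] through the origin has volume [(W / 2)^d theta], and the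
    density is at least [W^(1-d)] on it. This linear growth makes [expR (- gauge z)] integrable. *)
Lemma radial_gauge_ge n (w : n.-tuple E) i :
  ((enorm (tnth w i) * (theta d / 2 ^+ d))%:E <= radial_gauge w)%E.
Proof.
set W := enorm (tnth w i).
have [W0|W0] := eqVneq W 0.
  rewrite W0 mul0r; apply: integral_ge0 => x _.
  by rewrite lee_fin; apply: mulr_ge0; [exact: shell_weight_ge0|exact: rho_ge0].
have Wgt0 : 0 < W by rewrite lt0r W0 enorm_ge0.
have msw := @measurable_shell_weight R d.
pose B := eball (2^-1 *: tnth w i) (W / 2).
have mB : measurable B by exact: measurable_eball.
rewrite /radial_gauge -(integral_radial_shell d0 (lexx 0))//; last 3 first.
- exact: measurable_rho.
- exact: rho_ge0.
- by move=> t x; exact: rho_hom.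
have m0 : measurable [set (0 : E)].
  rewrite (_ : [set 0] = eball (0:E) 0); first exact: measurable_eball.
  apply/seteqP; split => y; rewrite /eball/=; first by move=> ->; rewrite subrr enorm0.
  by rewrite le_eqVlt ltNge enorm_ge0 orbF enorm_eq0 subr_eq0 => /eqP.
apply: (@le_trans _ _ (\int[vol d]_x (W ^- d.-1 * \1_(B `\` [set (0%R : E)]) x)%:E)%E).
  under eq_integral do rewrite EFinM.
  rewrite ge0_integralZl//; last 2 first.
  - by apply/measurable_EFinP; apply: measurable_indic; exact: measurableD.
  - by rewrite lee_fin invr_ge0 exprn_ge0// ltW.
  rewrite integral_indic//; last exact: measurableD.
  rewrite setIT.
  have E1 : vol d (B `\` [set (0%R : E)]) = vol d B.
    rewrite [RHS](measureDI (vol d) mB m0) -[LHS]adde0; congr (_ + _)%E.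
    apply/esym/eqP; rewrite eq_le measure_ge0 andbT -(vol_set1 d0 (0 : E)).
    by apply: le_measure; rewrite ?inE//; exact: measurableI.
  rewrite [X in (_ <= _ * X)%E](_ : _ = vol d B); last exact: E1.
  rewrite vol_eball ?divr_gt0// -EFinM lee_fin exprMn exprVn.
  rewrite (_ : W ^+ d = W * W ^+ d.-1); last by rewrite -exprS prednK.
  have b0 : 2 ^+ d != 0 :> R by rewrite expf_neq0.
  have := expf_neq0 d.-1 W0; move: (W ^+ d.-1) (2 ^+ d) b0 => a b b0 a0.
  by rewrite le_eqVlt; apply/orP; left; apply/eqP; field; rewrite a0 b0.
apply: ge0_le_integral => //.
- by move=> x _; rewrite lee_fin mulr_ge0// invr_ge0 exprn_ge0// ltW.
- apply/measurable_EFinP; apply: measurable_funM => //.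
  by apply: measurable_indic; exact: measurableD.
- apply/measurable_EFinP; apply: measurable_funM; last first.
    apply: measurable_nneg_inv => [x|]; first by rewrite exprn_ge0// enorm_ge0.
    by apply: measurable_funX; exact: measurable_enorm.
  apply: measurable_bool_real; apply: measurable_and.
    by apply: measurable_fun_ltr => //; exact: measurable_enorm.
  apply: measurable_fun_ler; first exact: measurable_enorm.
  by apply: measurable_funD => //; exact: measurable_rho.
move=> x _; rewrite lee_fin indicE.
have [|_] := boolP (x \in _); last first.
  by rewrite mulr0 mulr_ge0// invr_ge0 exprn_ge0// enorm_ge0.
rewrite inE => -[xB x0].
have N0 : 0 < enorm x by rewrite lt0r enorm_ge0 enorm_eq0 andbT; apply/eqP => x0'; exact: x0.
move: xB; rewrite /B /eball /= half_ballP => xB.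
have hr : enorm x <= rho w x.
  by apply/bigmax_geP; right; exists i => //; rewrite ler_pdivlMr// -expr2.
rewrite N0 add0r hr mul1r mulr1 lef_pV2 ?posrE ?exprn_gt0//.
apply: lerXn2r; rewrite ?nnegrE ?enorm_ge0//.
rewrite -(@ler_pM2r _ (enorm x))// -expr2; apply: le_trans xB _.
exact: le_trans (ler_norm _) (cauchy_schwarz _ _).
Qed.

(** By [lens_upper] the set lies in [1 < |x| <= 1 + rho w x], where passing from the polar density
    to plain volume costs at most [|x|^(d-1) <= (1 + s)^(d-1)]. *)
Lemma vol_lens_le n (w : n.-tuple E) s : 0 <= s ->
  (forall i, enorm (tnth w i) <= s) ->
  (vol d (ball_union 1 w `\` eball (0 : E) 1) <= ((1 + s) ^+ d.-1)%:E * radial_gauge w)%E.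
Proof.
move=> s0 ws.
rewrite /radial_gauge -(integral_radial_shell d0 ler01)//; last 3 first.
- exact: measurable_rho.
- exact: rho_ge0.
- by move=> t x; exact: rho_hom.
have mB : measurable (ball_union 1 w `\` eball (0 : E) 1).
  by apply: measurableD; [exact: measurable_ball_union|exact: measurable_eball].
have mI : measurable_fun setT (fun x : E => (((1 < enorm x) && (enorm x <= 1 + rho w x))%:R * enorm x ^- d.-1)%:E).
  apply/measurable_EFinP; apply: measurable_funM; last first.
    apply: measurable_nneg_inv => [x|]; first by rewrite exprn_ge0// enorm_ge0.
    by apply: measurable_funX; exact: measurable_enorm.
  apply: measurable_bool_real; apply: measurable_and.
    by apply: measurable_fun_ltr => //; exact: measurable_enorm.
  apply: measurable_fun_ler; first exact: measurable_enorm.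
  by apply: measurable_funD => //; exact: measurable_rho.
rewrite -[X in vol d X]setIT -integral_indic// -ge0_integralZl//; last 2 first.
- by move=> x _; rewrite lee_fin mulr_ge0// invr_ge0 exprn_ge0// enorm_ge0.
- by rewrite lee_fin exprn_ge0//; lra.
apply: ge0_le_integral => //.
- by apply/measurable_EFinP; exact: measurable_indic.
- by apply: emeasurable_funM.
move=> x _; rewrite -EFinM lee_fin indicE.
have [|_] := boolP (x \in _); last first.
  by rewrite !mulr_ge0 ?exprn_ge0 ?invr_ge0 ?exprn_ge0 ?enorm_ge0//; lra.
rewrite inE => -[/= /existsP[i hi] h1].
have x1 : 1 < enorm x by rewrite ltNge; apply/negP => h; apply: h1; rewrite /eball/= subr0.
have N0 : 0 < enorm x by lra.
have hx : enorm x <= 1 + rho w x.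
  apply: le_trans (lens_upper x1 hi) _; rewrite lerD2l.
  by apply/bigmax_geP; right; exists i.
rewrite x1 hx/= mul1r mulrC ler_pdivlMl ?exprn_gt0// mulr1.
have := rho_le x s0 ws => rs.
by apply: lerXn2r; rewrite ?nnegrE; lra.
Qed.

(** Outside the unit ball plain volume dominates the polar density, and [lens_lower] loses at most
    the length [s ^+ 2] on each ray. *)
Lemma vol_lens_ge n (w : n.-tuple E) s : 0 <= s -> s <= 1 ->
  (forall i, enorm (tnth w i) <= s) ->
  (radial_gauge w <= vol d (ball_union 1 w `\` eball (0 : E) 1) + (s ^+ 2)%:E * c2)%E.
Proof.
move=> s0 s1 ws.
(* The truncation handles the directions in which [rho w x] is below the loss [s ^+ 2]. *)
pose b x := Num.max 0 (rho w x - s ^+ 2).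
have mb : measurable_fun setT b.
  by apply: measurable_maxr => //; apply: measurable_funB => //; exact: measurable_rho.
have b0 x : 0 <= b x by rewrite le_max lexx.
have msw := @measurable_shell_weight R d.
apply: (@le_trans _ _ (\int[vol d]_x (shell_weight x * b x)%:E + (s ^+ 2)%:E * c2)%E).
  rewrite -ge0_integralZl ?lee_fin ?sqr_ge0//; last 2 first.
  - exact/measurable_EFinP.
  - by move=> x _; rewrite lee_fin shell_weight_ge0.
  rewrite -ge0_integralD//; last 4 first.
  - by move=> x _; rewrite lee_fin mulr_ge0 ?shell_weight_ge0.
  - by apply/measurable_EFinP; exact: measurable_funM.
  - by move=> x _; rewrite -EFinM lee_fin mulr_ge0 ?shell_weight_ge0 ?sqr_ge0.
  - by apply/measurable_EFinP; exact: measurable_funM.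
  apply: ge0_le_integral => //.
  - by move=> x _; rewrite lee_fin mulr_ge0 ?shell_weight_ge0 ?rho_ge0.
  - by apply/measurable_EFinP; apply: measurable_funM => //; exact: measurable_rho.
  - apply: emeasurable_funD; apply/measurable_EFinP; exact: measurable_funM.
  move=> x _; rewrite -EFinM -EFinD lee_fin (mulrC (s ^+ 2)) -mulrDr.
  rewrite ler_wpM2l ?shell_weight_ge0//.
  by rewrite -lerBlDr le_max lexx orbT.
rewrite leeD2r// -(integral_radial_shell d0 ler01)//; last first.
  by move=> t x t0; rewrite /b rho_hom.
have mB : measurable (ball_union 1 w `\` eball (0 : E) 1).
  by apply: measurableD; [exact: measurable_ball_union|exact: measurable_eball].
rewrite -[X in vol d X]setIT -integral_indic//.
apply: ge0_le_integral => //.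
- by move=> x _; rewrite lee_fin mulr_ge0// invr_ge0 exprn_ge0// enorm_ge0.
- apply/measurable_EFinP; apply: measurable_funM; last first.
    apply: measurable_nneg_inv => [x|]; first by rewrite exprn_ge0// enorm_ge0.
    by apply: measurable_funX; exact: measurable_enorm.
  apply: measurable_bool_real; apply: measurable_and.
    by apply: measurable_fun_ltr => //; exact: measurable_enorm.
  apply: measurable_fun_ler; first exact: measurable_enorm.
  exact: measurable_funD.
- by apply/measurable_EFinP; exact: measurable_indic.
move=> x _; rewrite lee_fin.
have [/andP[x1 xb]|_] := boolP ((1 < enorm x) && (enorm x <= 1 + b x)); last by rewrite mul0r indicE.
have N0 : 0 < enorm x by lra.
rewrite mul1r indicE mem_set; last first.
  split; last by rewrite /eball/= subr0; apply/negP; rewrite -ltNge.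
  have b1 : 0 < b x by lra.
  have bE : b x = rho w x - s ^+ 2 by move: b1; rewrite /b maxElt; case: ifP => // _; rewrite ltxx.
  have r0 : 0 < rho w x by have := sqr_ge0 s; lra.
  have [i hi] := le_rho r0 (lexx _).
  apply/existsP; exists i; apply: (lens_lower s0 s1) => //.
  by apply: le_trans xb _; rewrite bE; lra.
by rewrite invf_le1 ?exprn_gt0// exprn_ege1// ltW.
Qed.

End lens.

(** * Excess volume of a union of unit balls over the ball at the origin *)

Section lens_volume.
Context {R : realType} {d : nat}.
Hypothesis d0 : (0 < d)%N.
Notation E := 'rV[R]_d.

Definition bvol n (w : n.-tuple E) : R := fine (vol d (ball_union 1 w)).

Lemma vol_ball_union_lty n r (w : n.-tuple E) : 0 < r -> (vol d (ball_union r w) < +oo)%E.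
Proof.
move=> r0; pose s : R := r + \sum_(i < n) enorm (tnth w i).
have s0 : 0 < s by apply: ltr_wpDr => //; apply: sumr_ge0 => i _; exact: enorm_ge0.
apply: (@le_lt_trans _ _ (vol d (eball (0 : E) s))); last by rewrite vol_eball// ltry.
apply: le_measure; rewrite ?inE; [exact: measurable_ball_union|exact: measurable_eball|].
move=> x /= /existsP[i hi]; rewrite /eball/= subr0.
rewrite -(subrK (tnth w i) x); apply: le_trans (enormD _ _) _; apply: lerD => //.
by rewrite (bigD1 i)//= lerDl; apply: sumr_ge0 => j _; exact: enorm_ge0.
Qed.

Lemma bvolE n (w : n.-tuple E) : vol d (ball_union 1 w) = (bvol w)%:E.
Proof. by rewrite fineK// ge0_fin_numE// vol_ball_union_lty. Qed.

Lemma ball_union_tcons n r (x : E) (w : n.-tuple E) :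
  ball_union r (tcons (x, w)) = eball x r `|` ball_union r w.
Proof.
apply/seteqP; split => y /=.
  move=> /existsP[i]; case: (unliftP ord0 i) => [j ->|->]; last by left.
  by rewrite tnthS => h; right; apply/existsP; exists j.
move=> [h|/existsP[i h]]; apply/existsP; first by exists ord0.
by exists (lift ord0 i); rewrite tnthS.
Qed.

Definition gauge n (w : n.-tuple E) : R := fine (radial_gauge w).

Lemma gaugeE n (w : n.-tuple E) : radial_gauge w = (gauge w)%:E.
Proof.
rewrite fineK// ge0_fin_numE ?radial_gauge_lty//.
by apply: integral_ge0 => x _; rewrite lee_fin; apply: mulr_ge0; [exact: shell_weight_ge0|exact: rho_ge0].
Qed.

Definition shell_mass : R := fine (\int[vol d]_x (@shell_weight R d x)%:E)%E.

Lemma shell_massE : (\int[vol d]_x (@shell_weight R d x)%:E = shell_mass%:E)%E.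
Proof.
rewrite fineK// ge0_fin_numE ?integral_shell_weight_lty//.
by apply: integral_ge0 => x _; rewrite lee_fin shell_weight_ge0.
Qed.

Lemma shell_mass_ge0 : 0 <= shell_mass.
Proof.
rewrite -lee_fin -shell_massE.
by apply: integral_ge0 => x _; rewrite lee_fin shell_weight_ge0.
Qed.

Lemma gfunE n (w : n.-tuple E) : gfun w = gauge w.
Proof. by rewrite /gfun /Rintegral integral_half_balls. Qed.

Definition lens n (w : n.-tuple E) : R :=
  fine (vol d (ball_union 1 w `\` eball (0 : E) 1)).

Lemma measurable_lens_set n (w : n.-tuple E) :
  measurable (ball_union 1 w `\` eball (0 : E) 1).
Proof. by apply: measurableD; [exact: measurable_ball_union|exact: measurable_eball]. Qed.

Lemma lensE n (w : n.-tuple E) :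
  vol d (ball_union 1 w `\` eball (0 : E) 1) = (lens w)%:E.
Proof.
rewrite fineK// ge0_fin_numE//.
apply: le_lt_trans (vol_ball_union_lty w ltr01).
by apply: le_measure; rewrite ?inE; [exact: measurable_lens_set|exact: measurable_ball_union|exact: subDsetl].
Qed.

Lemma bvol_tcons0 n (w : n.-tuple E) : bvol (tcons ((0 : E), w)) = theta d + lens w.
Proof.
apply: EFin_inj; rewrite EFinD -bvolE -lensE -thetaE ball_union_tcons.
have -> : eball (0 : E) 1 `|` ball_union 1 w = eball (0 : E) 1 `|` (ball_union 1 w `\` eball (0 : E) 1).
  by rewrite setUDr setDv setD0.
apply: measureU; [exact: measurable_eball|exact: measurable_lens_set|].
by rewrite setIDA setIC -setIDA setDv setI0.
Qed.

Lemma gauge_ge0 n (w : n.-tuple E) : 0 <= gauge w.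
Proof.
by rewrite fine_ge0// integral_ge0// => x _; rewrite lee_fin; apply: mulr_ge0; [exact: shell_weight_ge0|exact: rho_ge0].
Qed.

Lemma lens_ge0 n (w : n.-tuple E) : 0 <= lens w.
Proof. by rewrite fine_ge0. Qed.

Lemma gauge_ge n (w : n.-tuple E) i : enorm (tnth w i) * (theta d / 2 ^+ d) <= gauge w.
Proof. by rewrite -lee_fin -gaugeE; exact: radial_gauge_ge. Qed.

Lemma gauge_le n (w : n.-tuple E) s : 0 <= s ->
  (forall i, enorm (tnth w i) <= s) -> gauge w <= s * shell_mass.
Proof. by move=> s0 ws; rewrite -lee_fin -gaugeE EFinM -shell_massE; exact: radial_gauge_le. Qed.

(** A convex function lies below its chord over [[0, 1]]. *)
Lemma expr1D_le (s : R) p : 0 <= s -> s <= 1 -> (1 + s) ^+ p <= 1 + (2 ^+ p - 1) * s.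
Proof.
move=> s0 s1; elim: p => [|p IH]; first by rewrite !expr0 subrr mul0r addr0.
rewrite exprSr; apply: (@le_trans _ _ ((1 + (2 ^+ p - 1) * s) * (1 + s))).
  by rewrite ler_wpM2r//; lra.
have : 1 <= 2 ^+ p :> R by rewrite exprn_ege1//; lra.
rewrite exprS; move: (2 ^+ p) => a a1.
have : (a - 1) * (s * s) <= (a - 1) * s by rewrite ler_wpM2l//; [lra|exact: ler_piMl].
lra.
Qed.

(** The gauge itself is [O(s)], so the relative error [(1 + s)^(d-1) - 1 = O(s)] of the upper bound
    is of order [s ^+ 2], as is the loss in the lower one. *)
Lemma lens_gauge n (w : n.-tuple E) s : 0 <= s -> s <= 1 ->
  (forall i, enorm (tnth w i) <= s) ->
  `|lens w - gauge w| <= 2 ^+ d * shell_mass * s ^+ 2.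
Proof.
move=> s0 s1 ws.
have up : lens w <= (1 + s) ^+ d.-1 * gauge w.
  by rewrite -lee_fin -lensE EFinM -gaugeE; exact: vol_lens_le.
have lo : gauge w <= lens w + s ^+ 2 * shell_mass.
  by rewrite -lee_fin EFinD EFinM -lensE -gaugeE -shell_massE; exact: vol_lens_ge.
have g1 := gauge_le s0 ws; have g0 := gauge_ge0 w; have c0 := shell_mass_ge0.
have e1 := expr1D_le d.-1 s0 s1.
have p1 : 2 ^+ d = 2 * 2 ^+ d.-1 :> R by rewrite -exprS prednK.
have a1 : 1 <= 2 ^+ d.-1 :> R by rewrite exprn_ege1//; lra.
have s2 := sqr_ge0 s.
rewrite p1; move: (2 ^+ d.-1) ((1 + s) ^+ d.-1) (gauge w) (lens w) shell_mass e1 a1 up lo g1 g0 c0.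
move=> a q g l c e1 a1 up lo g1 g0 c0.
have cs : 0 <= c * s ^+ 2 by rewrite mulr_ge0.
rewrite ler_norml; apply/andP; split; first nra.
have h1 : (q - 1) * g <= ((a - 1) * s) * g by rewrite ler_wpM2r//; lra.
have h2 : ((a - 1) * s) * g <= ((a - 1) * s) * (s * c).
  by rewrite ler_wpM2l// mulr_ge0//; lra.
have h3 : 0 <= a * (c * s ^+ 2) by rewrite mulr_ge0//; lra.
lra.
Qed.

(** Unit balls have equal volumes, so it suffices to compare their intersections with the ball at
    [0]. Shifting the intersection for [W] by [v], which moves its centre from [W / 2] to [t W / 2],
    lands in the one for [t *: W]: each new vector to a centre is a convex combination of the two
    old ones. *)
Lemma lens1_le_scale (W : E) (t : R) : 0 <= t -> t <= 1 ->
  (vol d (eball (t *: W) 1 `\` eball (0%R : E) 1%R) <=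
   vol d (eball W 1 `\` eball (0%R : E) 1%R))%E.
Proof.
move=> t0 t1.
have mB (x : E) : measurable (eball x 1) by exact: measurable_eball.
have mI (x : E) : measurable (eball x 1 `&` eball 0 1) by exact: measurableI.
have vB (x : E) : vol d (eball x 1) = (theta d)%:E by rewrite vol_eball// expr1n mul1r.
have fI (x : E) : vol d (eball x 1 `&` eball 0 1) \is a fin_num.
  rewrite ge0_fin_numE//; apply: (@le_lt_trans _ _ (vol d (eball x 1))).
    by apply: le_measure; rewrite ?inE//; exact: subIsetl.
  by rewrite vB ltry.
rewrite -(leeD2rE _ _ (fI (t *: W))).
have DI (x : E) : (vol d (eball x 1 `\` eball (0%R : E) 1%R) + vol d (eball x 1%R `&` eball 0%R 1%R) = (theta d)%:E)%E.
  by rewrite -(vB x) (measureDI (vol d) (mB x) (mB 0)).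
rewrite DI -(DI W) leeD2l//.
pose v : E := - ((1 - t) / 2) *: W.
have := int_subst_measure (vol_affine v (oner_neq0 R)) (mI (t *: W)).
rewrite normr1 invr1 expr1n mul1e => <-.
apply: le_measure; rewrite ?inE//.
  have [mv _ _] := @vol_affine R d 1 v (oner_neq0 R).
  by rewrite -[X in measurable X]setTI; exact: mv.
move=> y; rewrite /eball/= !subr0 => -[h1 h2]; split.
- rewrite (_ : _ - _ = ((1 - t) / 2) *: y + ((1 + t) / 2) *: (y - W)).
    apply: le_trans (enormD _ _) _; rewrite !enormZ !ger0_norm; [|lra|lra].
    have := enorm_ge0 y; have := enorm_ge0 (y - W); nra.
  by apply/rowP => i; rewrite !mxE; lra.
- rewrite (_ : _ + _ = ((1 + t) / 2) *: y + ((1 - t) / 2) *: (y - W)).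
    apply: le_trans (enormD _ _) _; rewrite !enormZ !ger0_norm; [|lra|lra].
    have := enorm_ge0 y; have := enorm_ge0 (y - W); nra.
  by apply/rowP => i; rewrite !mxE; lra.
Qed.

Lemma lens1E (W : E) : ((lens [tuple W])%:E = vol d (eball W 1%R `\` eball (0%R : E) 1%R))%E.
Proof.
rewrite -lensE; congr (vol d (_ `\` _)); apply/seteqP; split => y /=.
  by move=> /existsP[i]; rewrite (ord1 i).
by move=> h; apply/existsP; exists ord0.
Qed.

Lemma lens1_le n (w : n.-tuple E) i : lens [tuple tnth w i] <= lens w.
Proof.
rewrite -lee_fin lens1E -lensE; apply: le_measure; rewrite ?inE.
- by apply: measurableD; exact: measurable_eball.
- exact: measurable_lens_set.
by move=> y [h1 h2]; split => //; apply/existsP; exists i.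
Qed.

(** For centres of norm at most [tau] the linear lower bound on the gauge beats the quadratic loss;
    longer centres are shrunk to norm [tau] by [lens1_le_scale], and [K] bounds the ratio lost. The
    bound fails without [K], as the excess volume of one ball is at most [theta]. *)
Lemma lens_linear_lower (K : R) : 0 < K -> exists2 c, 0 < c &
  forall n (w : n.-tuple E), (forall i, enorm (tnth w i) <= K) ->
    forall i, c * enorm (tnth w i) <= lens w.
Proof.
move=> K0; have th0 := @theta_gt0 R d.
pose kap : R := theta d / 2 ^+ d.
have kap0 : 0 < kap by rewrite divr_gt0// exprn_gt0.
have sm0 := shell_mass_ge0.
(* Chosen so that the loss [tau * shell_mass] is at most half of the slope [kap]; the added 1 keeps
   the denominator positive. *)
pose tau : R := Num.min 1 (kap / (2 * (shell_mass + 1))).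
have tau0 : 0 < tau by rewrite lt_min ltr01 divr_gt0//; lra.
have tau1 : tau <= 1 by rewrite /tau ge_min lexx.
have tauk : tau * shell_mass <= kap / 2.
  have : tau <= kap / (2 * (shell_mass + 1)) by rewrite /tau ge_min lexx orbT.
  rewrite ler_pdivlMr; last lra.
  by rewrite mulrDr mulr1 mulrDr; have := ltW tau0; lra.
have small (W : E) : enorm W <= tau -> enorm W * (kap / 2) <= lens [tuple W].
  move=> Wt; have W0 := enorm_ge0 W.
  have := @vol_lens_ge R d d0 1 [tuple W] (enorm W) W0 (le_trans Wt tau1).
  rewrite lensE gaugeE shell_massE -EFinM -EFinD lee_fin => /(_ _)h.
  have {}h : gauge [tuple W] <= lens [tuple W] + enorm W ^+ 2 * shell_mass.
    by apply: h => i; rewrite (ord1 i).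
  have := @gauge_ge 1 [tuple W] ord0; rewrite -/kap (_ : tnth _ _ = W)// => h2.
  have h3 : enorm W * (enorm W * shell_mass) <= enorm W * (kap / 2).
    by rewrite ler_wpM2l//; apply: le_trans tauk; rewrite ler_wpM2r.
  lra.
exists (Num.min (kap / 2) (tau * (kap / 2) / K)).
  by rewrite lt_min divr_gt0//= divr_gt0// mulr_gt0// divr_gt0.
move=> n w wK i; apply: le_trans (lens1_le w i).
set W := tnth w i; have W0 := enorm_ge0 W.
have [Wt|Wt] := leP (enorm W) tau.
  apply: le_trans (small _ Wt); rewrite mulrC ler_wpM2l//.
  by rewrite ge_min lexx.
have Wp : 0 < enorm W by lra.
apply: (@le_trans _ _ (tau * (kap / 2))).
  apply: (@le_trans _ _ (tau * (kap / 2) / K * enorm W)).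
    by rewrite ler_wpM2r// ge_min lexx orbT.
  rewrite mulrAC ler_pdivrMr// ler_wpM2l ?wK// mulr_ge0//; lra.
pose t := tau / enorm W.
have t0 : 0 <= t by rewrite divr_ge0// ltW.
have t1 : t <= 1 by rewrite ler_pdivrMr// mul1r ltW.
have := lens1_le_scale W t0 t1; rewrite -!lens1E lee_fin; apply: le_trans.
have Et : enorm (t *: W) = tau by rewrite enormZ ger0_norm// /t divfK// gt_eqF.
by have := small (t *: W); rewrite Et; apply.
Qed.

End lens_volume.

Lemma integral_bool (disp : measure_display) (T : measurableType disp) (R : realType)
    (mu : {measure set T -> \bar R}) (b : T -> bool) :
  measurable_fun setT b -> (\int[mu]_x (b x)%:R%:E = mu [set x | b x])%E.
Proof.
move=> mb; have mS := measurable_bool_set mb.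
rewrite -[X in mu X]setIT -integral_indic//; apply: eq_integral => x _.
by rewrite indicE (_ : (x \in _) = b x)//; apply/idP/idP; rewrite inE.
Qed.

Lemma measurable_mem (disp : measure_display) (T : measurableType disp) (D : set T) :
  measurable D -> measurable_fun setT (fun x => x \in D).
Proof.
move=> mD; apply: (measurable_fun_bool true); rewrite setTI (_ : _ @^-1` _ = D)//.
by apply/seteqP; split => x /= h; [exact: set_mem|exact: mem_set].
Qed.

Lemma measurable_section_measure (d1 d2 : measure_display) (T1 : measurableType d1)
    (T2 : measurableType d2) (R : realType)
    (mu : {sigma_finite_measure set T2 -> \bar R}) (b : T1 * T2 -> bool) :
  measurable_fun setT b -> measurable_fun setT (fun x => mu [set y | b (x, y)]).
Proof.
move=> mb.
have := measurable_fun_fubini_tonelli_F (m2 := mu) _ (measurable_bool_fun (R := R) mb).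
rewrite (_ : fubini_F _ _ = fun x => mu [set y | b (x, y)]); first by apply.
apply/funext => x; rewrite /fubini_F integral_bool//.
exact: (measurableT_comp mb (pair1_measurable x)).
Qed.

(** * Connected configurations *)

Section cluster_predicate.
Context {R : realType} {d : nat}.
Notation E := 'rV[R]_d.

Definition near_rel n (r : R) (t : n.-tuple E) : rel 'I_n :=
  fun a b => enorm (tnth t a - tnth t b) <= r.

Definition hconn n (r : R) (t : n.-tuple E) : bool :=
  [forall i, forall j, connect (near_rel r t) i j].

Lemma near_path n r (t : n.-tuple E) x p : 0 <= r -> path (near_rel r t) x p ->
  enorm (tnth t x - tnth t (last x p)) <= r * (size p)%:R.
Proof.
move=> r0; elim: p x => [|y p IH] x /=; first by rewrite subrr enorm0 mulr0.
move=> /andP[xy /IH h]; apply: le_trans (enormB_le _ (tnth t y) _) _.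
rewrite -natr1 mulrDr mulr1 addrC; exact: lerD.
Qed.

(** A path without repetitions among [n] indices has fewer than [n] steps, each of length at most
    [r]. *)
Lemma hconn_diam n r (t : n.-tuple E) i j : 0 <= r -> hconn r t ->
  enorm (tnth t i - tnth t j) <= r * n%:R.
Proof.
move=> r0 /forallP/(_ i)/forallP/(_ j)/connectP[p pp ->].
case/shortenP : pp => p' pp' up' _.
apply: le_trans (near_path r0 pp') _; rewrite ler_wpM2l// ler_nat.
have := max_card [in i :: p']; rewrite card_ord (card_uniqP up') /=; exact: ltnW.
Qed.

(** Every point is adjacent to the origin. Hence the connectedness indicator equals 1 on any fixed
    [z] once [z / lam] enters the unit ball, and no connectedness condition survives in [alpha]. *)
Lemma hconn_star n (z : n.-tuple E) : (forall i, enorm (tnth z i) <= 1) ->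
  hconn 1 (tcons ((0 : E), z)).
Proof.
move=> z1.
have near0 i : near_rel 1 (tcons ((0 : E), z)) ord0 i && near_rel 1 (tcons ((0 : E), z)) i ord0.
  rewrite /near_rel (_ : tnth _ ord0 = 0)// subr0 sub0r enormN andbb.
  by case: (unliftP ord0 i) => [j ->|->]; rewrite ?tnthS// (_ : tnth _ _ = 0)// enorm0.
apply/forallP => i; apply/forallP => j; have /andP[_ hi] := near0 i; have /andP[hj _] := near0 j.
by apply: (connect_trans (y := ord0)); exact: connect1.
Qed.

Lemma hconn_affine n r a (b : E) (t : n.-tuple E) : 0 < a ->
  hconn (a * r) [tuple a *: tnth t i + b | i < n] = hconn r t.
Proof.
move=> a0; apply: eq_forallb => i; apply: eq_forallb => j.
apply: eq_connect => x y; rewrite /near_rel !tnth_mktuple opprD addrACA subrr addr0.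
by rewrite -scalerBr enormZ gtr0_norm// ler_pM2l.
Qed.

Lemma measurable_hconn n r : measurable_fun setT (@hconn n r).
Proof.
pose g (p : {ffun 'I_n * 'I_n -> bool}) :=
  [forall i, forall j, connect (fun a b => p (a, b)) i j].
rewrite (_ : @hconn n r = fun t => g [ffun ij => near_rel r t ij.1 ij.2]); last first.
  apply/funext => t; apply: eq_forallb => i; apply: eq_forallb => j.
  by apply: eq_connect => x y; rewrite ffunE.
apply: measurable_pattern => -[i j]; apply: measurable_fun_ler => //.
by apply: measurable_enorm; apply: measurable_rVB; exact: measurable_tnth.
Qed.

Lemma measurable_in_ball_union n r :
  measurable_fun setT (fun p : n.-tuple E * E => [exists i, enorm (p.2 - tnth p.1 i) <= r]).
Proof.
apply: measurable_exists => i.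
apply: measurable_fun_ler => //; apply: measurable_enorm; apply: measurable_rVB => //.
exact: (measurableT_comp (measurable_tnth i) measurable_fst).
Qed.

Lemma measurable_bvol n : measurable_fun setT (@bvol R d n).
Proof.
apply: measurableT_comp => //.
exact: (measurable_section_measure (vol d) (@measurable_in_ball_union n 1)).
Qed.

Lemma measurable_radial_gauge n : measurable_fun setT (@radial_gauge R d n).
Proof.
have mf : measurable_fun setT (fun p : n.-tuple E * E =>
    (shell_weight p.2 * rho p.1 p.2)%:E).
  apply/measurable_EFinP; apply: measurable_funM.
    exact: (measurableT_comp (@measurable_shell_weight R d) measurable_snd).
  exact: measurable_rho_fun.
apply: (measurable_fun_fubini_tonelli_F (m2 := vol d) _ mf).
by move=> p; rewrite lee_fin; apply: mulr_ge0; [exact: shell_weight_ge0|exact: rho_ge0].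
Qed.

Lemma measurable_gauge n : measurable_fun setT (@gauge R d n).
Proof. by apply: measurableT_comp => //; exact: measurable_radial_gauge. Qed.

End cluster_predicate.

(** * Integrability of exponentials of the norm *)

Section exponential_integrals.
Local Open Scope ereal_scope.
Context {R : realType}.

Lemma integral_mpow_prod_lty (disp : measure_display) (T : measurableType disp)
    (mu : {sigma_finite_measure set T -> \bar R}) (f : T -> R) n :
  measurable_fun setT f -> (forall x, 0 <= f x)%R ->
  \int[mu]_x (f x)%:E < +oo ->
  \int[mpow mu n]_t (\prod_(i < n) f (tnth t i))%:E < +oo.
Proof.
move=> mf f0 foo.
have mP m : measurable_fun setT (fun t : m.-tuple T => (\prod_(i < m) f (tnth t i))%:E).
  apply/measurable_EFinP; apply: measurable_prod => i _.
  by apply: measurableT_comp => //; exact: measurable_tnth.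
have P0 m (t : m.-tuple T) : (0 <= \prod_(i < m) f (tnth t i))%R by apply: prodr_ge0.
elim: n => [|n IH]; first by rewrite integral_mpow0 ?ltry//; exact: mP.
rewrite (integral_mpowS mu (mP n.+1)); last by move=> t; rewrite lee_fin.
have E x : \int[mpow mu n]_t (\prod_(i < n.+1) f (tnth (tcons (x, t)) i))%:E =
    (f x)%:E * \int[mpow mu n]_t (\prod_(i < n) f (tnth t i))%:E.
  rewrite -ge0_integralZl ?lee_fin//; [|exact: mP|by move=> t _; rewrite lee_fin].
  apply: eq_integral => t _; rewrite big_ord_recl -EFinM; congr (_ * _)%:E.
  by apply: eq_bigr => i _; rewrite tnthS.
under eq_integral do rewrite E.
have fin : \int[mpow mu n]_t (\prod_(i < n) f (tnth t i))%:E \is a fin_num.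
  by rewrite ge0_fin_numE//; apply: integral_ge0 => t _; rewrite lee_fin.
rewrite -(fineK fin) ge0_integralZr//; last 3 first.
- exact/measurable_EFinP.
- by move=> x _; rewrite lee_fin.
- by rewrite lee_fin fine_ge0// integral_ge0// => t _; rewrite lee_fin.
rewrite muleC lte_mul_pinfty// lee_fin fine_ge0// integral_ge0// => t _.
by rewrite lee_fin.
Qed.

(** Up to the factor [c^-1], the integrand is dominated by the exponential density plus its
    reflection. *)
Lemma integral_exp_abs_lty (c : R) : (0 < c)%R ->
  \int[@lebesgue_measure R]_x (expR (- (c * `|x|)))%:E < +oo.
Proof.
move=> c0; pose f x := (c^-1 * (exponential_pdf c x + exponential_pdf c (- x)))%R.
have mp := @measurable_exponential_pdf R c.
have mN : measurable_fun setT (fun x : R => exponential_pdf c (- x)%R).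
  by apply: measurableT_comp => //; exact: oppr_measurable.
have p0 x : (0 <= exponential_pdf c x)%R by rewrite exponential_pdf_ge0// ltW.
have H : \int[@lebesgue_measure R]_x (exponential_pdf c (- x)%R)%:E = 1.
  have N1 : (-1 : R)%R != 0%R by rewrite oppr_eq0 oner_eq0.
  have [_ _ h] := lebesgue_affine 0%R N1.
  have := h (fun x => (exponential_pdf c x)%:E).
  rewrite normrN1 invr1 mul1e integral_exponential_pdf// => <-.
  - by apply: eq_integral => x _; rewrite mulN1r addr0.
  - exact/measurable_EFinP.
  - by move=> x; rewrite lee_fin.
apply: (@le_lt_trans _ _ (\int[@lebesgue_measure R]_x (f x)%:E)); last first.
  under eq_integral do rewrite EFinM EFinD.
  rewrite ge0_integralZl//; last 3 first.
  - by apply: emeasurable_funD; exact/measurable_EFinP.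
  - by move=> x _; rewrite -EFinD lee_fin addr_ge0.
  - by rewrite lee_fin invr_ge0 ltW.
  rewrite ge0_integralD//; last 4 first.
  - by move=> x _; rewrite lee_fin.
  - exact/measurable_EFinP.
  - by move=> x _; rewrite lee_fin.
  - exact/measurable_EFinP.
  by rewrite H integral_exponential_pdf// -EFinD -EFinM ltry.
apply: ge0_le_integral => //.
- by apply/measurable_EFinP; apply: measurableT_comp => //; apply: measurableT_comp => //; exact: measurable_funM.
- by apply/measurable_EFinP; apply: measurable_funM => //; exact: measurable_funD.
move=> x _; rewrite lee_fin /f ler_pdivlMl//.
have [x0|x0] := leP 0%R x.
  by rewrite exponential_pdfE// ger0_norm// mulNr lerDl.
rewrite ltr0_norm// (@exponential_pdfE _ _ (- x)%R); last lra.
by rewrite mulNr lerDr.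
Qed.

(** As [d * enorm x] dominates the sum of the [|x_i|], the integrand is bounded by a product of
    one-dimensional exponentials of rate [c / (d + 1)]. *)
Lemma integral_exp_enorm_lty d (c : R) : (0 < c)%R ->
  \int[vol d]_x (expR (- (c * enorm x)))%:E < +oo.
Proof.
move=> c0.
have me : measurable_fun setT (fun x : 'rV[R]_d => (expR (- (c * enorm x)))%:E).
  apply/measurable_EFinP; apply: measurableT_comp => //; apply: measurableT_comp => //.
  by apply: measurable_funM => //; exact: measurable_enorm.
rewrite integral_vol//.
pose c' : R := (c / (d%:R + 1))%R.
have dp : (0 < d%:R + 1 :> R)%R by rewrite ltr_wpDl.
have c'0 : (0 < c')%R by rewrite divr_gt0.
have H := @integral_mpow_prod_lty _ _ (@lebesgue_measure R) (fun x : R => expR (- (c' * `|x|))%R) d.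
apply: le_lt_trans (H _ _ _).
- apply: ge0_le_integral => //.
  + by apply: (measurableT_comp me); exact: measurable_rV_of_tuple.
  + apply/measurable_EFinP; apply: measurable_prod => i _.
    apply: measurableT_comp => //; apply: measurableT_comp => //; apply: measurable_funM => //.
    by apply: measurableT_comp => //; exact: measurable_tnth.
  move=> t _; rewrite lee_fin -expR_sum ler_expR sumrN lerN2 -mulr_sumr.
  have : (\sum_(i < d) `|tnth t i| <= d%:R * enorm (rV_of_tuple t))%R.
    rewrite mulr_natl -[X in (_ <= _ *+ X)%R](card_ord d) -sumr_const; apply: ler_sum => i _.
    by have := coord_le_enorm (rV_of_tuple t) i; rewrite mxE.
  move=> h; rewrite /c' mulrAC ler_pdivrMr// -mulrA ler_pM2l//.
  apply: le_trans h _; rewrite mulrDr mulr1 mulrC lerDl; exact: enorm_ge0.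
- by apply: measurableT_comp => //; apply: measurableT_comp => //; exact: measurable_funM.
- by move=> x; exact: expR_ge0.
- exact: integral_exp_abs_lty.
Qed.

End exponential_integrals.

(** * The cluster integral at high intensity *)

Section cluster_integral.
Context {R : realType} {d : nat}.
Hypothesis d0 : (0 < d)%N.
Variable n : nat.
Notation E := 'rV[R]_d.

Definition tscale (a : R) (b : E) (z : n.-tuple E) : n.-tuple E :=
  [tuple a *: tnth z i + b | i < n].

Definition cons0 (z : n.-tuple E) : n.+1.-tuple E := tcons ((0 : E), z).

Lemma tnth_cons00 z : tnth (cons0 z) ord0 = 0.
Proof. by []. Qed.

(** This is [J(lam)], with [n] for [k - 1]. Its value at [lam = 0] is the volume of the connected
    configurations and reappears in the boundary layer. *)
Definition cluster_integral (lam : R) : \bar R :=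
  (\int[mpow (vol d) n]_z ((hconn 1 (cons0 z))%:R * expR (- lam * bvol (cons0 z)))%:E)%E.

Definition gauge_integral : \bar R :=
  (\int[mpow (vol d) n]_z (expR (- gauge z))%:E)%E.

Lemma mpow_tscale (a : R) (b : E) : 0 < a ->
  int_subst (mpow (vol d) n) (tscale a b) (a ^- (n * d)).
Proof.
move=> a0; have := @int_subst_mpow _ _ _ (vol d) _ n _ (fun=> vol_affine b (lt0r_neq0 a0)).
by rewrite gtr0_norm// exprVn exprVn -exprM mulnC.
Qed.

Lemma measurable_cons0 : measurable_fun setT cons0.
Proof.
apply: (measurableT_comp (measurable_tcons (n := n))); exact: pair1_measurable.
Qed.

Lemma measurable_cluster_integrand lam : measurable_fun setT
  (fun z : n.-tuple E => (hconn 1 (cons0 z))%:R * expR (- lam * bvol (cons0 z))).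
Proof.
apply: measurable_funM.
  apply: measurable_bool_real; apply: (measurableT_comp (measurable_hconn (n := n.+1) 1)).
  exact: measurable_cons0.
apply: measurableT_comp => //; apply: measurable_funM => //.
exact: (measurableT_comp (measurable_bvol (n := n.+1)) measurable_cons0).
Qed.

Lemma measurable_tscale (a : R) (b : E) : measurable_fun setT (tscale a b).
Proof.
apply/measurable_fun_tnthP => i.
rewrite (_ : _ \o _ = fun z : n.-tuple E => cst a z *: tnth z i + cst b z).
  apply: measurable_rVD => //; apply: measurable_rVZ => //; exact: measurable_tnth.
by apply/funext => z; rewrite /= tnth_mktuple.
Qed.

(** What remains of the integrand of [J(lam)] after the substitution and after
    [expR (lam * theta d)] has cancelled the ball at the origin. *)
Definition scaled_integrand (lam : R) (z : n.-tuple E) : R :=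
  (hconn 1 (cons0 (tscale lam^-1 0 z)))%:R * expR (- (lam * lens (tscale lam^-1 0 z))).

Lemma measurable_scaled_integrand lam : measurable_fun setT (scaled_integrand lam).
Proof.
rewrite (_ : scaled_integrand lam = (fun z : n.-tuple E => (hconn 1 (cons0 z))%:R *
   expR (- lam * bvol (cons0 z)) * expR (lam * theta d)) \o tscale lam^-1 0).
  apply: measurableT_comp; last exact: measurable_tscale.
  by apply: measurable_funM => //; exact: measurable_cluster_integrand.
apply/funext => z; rewrite /scaled_integrand /= -mulrA -expRD bvol_tcons0; congr (_ * expR _).
lra.
Qed.

Lemma cluster_integral_scaled lam : 0 < lam ->
  ((lam ^+ (n * d) * expR (lam * theta d))%:E * cluster_integral lam =
   \int[mpow (vol d) n]_z (scaled_integrand lam z)%:E)%E.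
Proof.
move=> l0; have li : 0 < lam^-1 by rewrite invr_gt0.
have [_ _ H] := mpow_tscale 0 li.
have m1 := measurable_cluster_integrand lam.
pose G (z : n.-tuple E) : R := (hconn 1 (cons0 z))%:R * expR (- lam * bvol (cons0 z)).
have mG : measurable_fun setT (fun z => (G z)%:E) by exact/measurable_EFinP.
have G0 z : setT z -> (0%:E <= (G z)%:E)%E.
  by move=> _; rewrite lee_fin mulr_ge0// expR_ge0.
have k0 : (0%:E <= (expR (lam * theta d))%:E)%E by rewrite lee_fin expR_ge0.
rewrite EFinM -muleA -[cluster_integral lam]/(\int[mpow (vol d) n]_z (G z)%:E)%E.
rewrite -[X in (_ * X)%E](ge0_integralZl _ measurableT mG G0 k0).
have := H (fun z => (expR (lam * theta d))%:E * (G z)%:E)%E.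
rewrite exprVn invrK => <-.
- apply: eq_integral => z _; rewrite -EFinM /G mulrCA -expRD bvol_tcons0.
  by congr ((_ * expR _)%:E); lra.
- by apply: emeasurable_funM.
- by move=> z; rewrite mule_ge0// G0.
Qed.

Lemma rho_scale a (z : n.-tuple E) x : 0 <= a -> rho (tscale a 0 z) x = a * rho z x.
Proof.
move=> a0; rewrite /rho (big_morph (fun x => a * x) (op1 := Num.max) (id1 := 0)); last 2 first.
- by move=> u v; rewrite maxr_pMr.
- by rewrite mulr0.
by apply: eq_bigr => i _; rewrite tnth_mktuple addr0 dotZl mulrA.
Qed.

Lemma gauge_scale a (z : n.-tuple E) : 0 <= a -> gauge (tscale a 0 z) = a * gauge z.
Proof.
move=> a0; apply: EFin_inj; rewrite EFinM -!gaugeE// /radial_gauge -ge0_integralZl//.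
- by apply: eq_integral => x _; rewrite rho_scale// mulrCA EFinM.
- apply/measurable_EFinP; apply: measurable_funM; first exact: measurable_shell_weight.
  exact: measurable_rho.
- by move=> x _; rewrite lee_fin; apply: mulr_ge0; [exact: shell_weight_ge0|exact: rho_ge0].
Qed.

Lemma expR_diff_le (a b m : R) : m <= a -> m <= b ->
  `|expR (- a) - expR (- b)| <= `|a - b| * expR (- m).
Proof.
wlog ab : a b / a <= b => [H ma mb|ma mb].
  have [ab|ab] := leP a b; first exact: H.
  by rewrite distrC (distrC a); apply: H => //; exact: ltW.
rewrite ger0_norm; last by rewrite subr_ge0 ler_expR lerN2.
rewrite ler0_norm ?opprB ?subr_le0//.
have h1 : expR (- b) = expR (- a) * expR (- (b - a)) by rewrite -expRD; congr expR; lra.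
have h2 := expR_ge1Dx (- (b - a)).
have h3 : expR (- a) <= expR (- m) by rewrite ler_expR lerN2.
have h4 := expR_ge0 (- a).
apply: (@le_trans _ _ ((b - a) * expR (- a))); last by rewrite ler_wpM2l// subr_ge0.
rewrite h1; move: (expR (- a)) (expR (- (b - a))) h2 h4 => u v h2 h4.
have : 0 <= u * (v - (1 - (b - a))) by rewrite mulr_ge0//; lra.
lra.
Qed.

Definition tsum (z : n.-tuple E) : R := \sum_(i < n) enorm (tnth z i).

Lemma tsum_ge0 z : 0 <= tsum z.
Proof. by apply: sumr_ge0 => i _; exact: enorm_ge0. Qed.

Lemma enorm_le_tsum z i : enorm (tnth z i) <= tsum z.
Proof. by rewrite /tsum (bigD1 i)//= lerDl; apply: sumr_ge0 => j _; exact: enorm_ge0. Qed.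

(** Averaging over [i]; the divisor [n.+1] covers the empty tuple as well. *)
Lemma le_tsum (k g : R) z : 0 <= k -> 0 <= g -> (forall i, k * enorm (tnth z i) <= g) ->
  k / n.+1%:R * tsum z <= g.
Proof.
move=> k0 g0 H; rewrite mulrAC ler_pdivrMr// /tsum mulr_sumr.
apply: (@le_trans _ _ (\sum_(i < n) g)); first exact: ler_sum.
by rewrite sumr_const card_ord -[X in X <= _]mulr_natr ler_wpM2l// ler_nat.
Qed.

(** Both exponents are at least [c * tsum z], the first by [lens_linear_lower] on connected
    configurations and the second by [gauge_ge]. Half of this decay pays for the polynomial factors
    of the expansion, the other half remains in the conclusion and makes the error integrable. *)
Lemma integrands_close : exists c C : R, [/\ 0 < c, 0 <= C & forall lam z, 1 <= lam ->
  `|scaled_integrand lam z - expR (- gauge z)| <= C / lam * expR (- (c * tsum z))].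
Proof.
have th0 := @theta_gt0 R d.
(* [n.+1] bounds the distance from the origin in a connected configuration of [n.+1] points at scale
   1. *)
have [c1 c10 Hc1] := @lens_linear_lower R d d0 n.+1%:R (ltr0Sn R n).
pose kap : R := theta d / 2 ^+ d.
have kap0 : 0 < kap by rewrite divr_gt0// exprn_gt0.
pose c : R := Num.min kap c1 / n.+1%:R.
have m0 : 0 < Num.min kap c1 by rewrite lt_min kap0.
have c0 : 0 < c by rewrite divr_gt0.
pose C0 : R := 2 ^+ d * @shell_mass R d.
have C00 : 0 <= C0 by rewrite mulr_ge0 ?exprn_ge0// shell_mass_ge0.
exists (c / 2), (C0 * (4 / c) ^+ 2 + 2 / c); split; first by rewrite divr_gt0.
  apply: addr_ge0; first by apply: mulr_ge0 => //; exact: sqr_ge0.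
  by apply: divr_ge0 => //; exact: ltW.
move=> lam z l1; have l0 : 0 < lam by lra.
have li0 : 0 <= lam^-1 by rewrite invr_ge0 ltW.
set u := tscale lam^-1 0 z.
have uz i : enorm (tnth u i) = lam^-1 * enorm (tnth z i).
  by rewrite tnth_mktuple addr0 enormZ ger0_norm.
set s := tsum z; have s0 : 0 <= s by exact: tsum_ge0.
have gs : c * s <= gauge z.
  apply: le_tsum; [exact: ltW|exact: gauge_ge0|move=> i].
  apply: le_trans (gauge_ge d0 z i); rewrite mulrC ler_wpM2l ?enorm_ge0//.
  by rewrite ge_min lexx.
have as_ : hconn 1 (cons0 u) -> c * s <= lam * lens u.
  move=> hu; have un i : enorm (tnth u i) <= n.+1%:R.
    have := hconn_diam (lift ord0 i) ord0 ler01 hu.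
    by rewrite tnthS tnth_cons00 subr0 mul1r.
  apply: le_tsum; [exact: ltW|by rewrite mulr_ge0 ?lens_ge0 ?ltW|move=> i].
  have := Hc1 n u un i; rewrite uz => h.
  rewrite -ler_pdivrMl//; apply: le_trans h; rewrite mulrCA.
  by rewrite ler_wpM2r ?mulr_ge0 ?enorm_ge0// ge_min lexx orbT.
(* The inequality [y <= expR y] absorbs [s] and [s ^+ 2] into half of the exponent. *)
have e1 : s <= 2 / c * expR (c / 2 * s).
  have := expR_ge1Dx (c / 2 * s) => h.
  have : 2 / c * (c / 2 * s) = s by field; rewrite gt_eqF.
  have : 2 / c * (c / 2 * s) <= 2 / c * expR (c / 2 * s).
    by rewrite ler_wpM2l ?divr_ge0 ?ltW//; lra.
  lra.
have e2 : s ^+ 2 <= (4 / c) ^+ 2 * expR (c / 2 * s).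
  have h : s <= 4 / c * expR (c / 4 * s).
    have := expR_ge1Dx (c / 4 * s) => h.
    have : 4 / c * (c / 4 * s) = s by field; rewrite gt_eqF.
    have : 4 / c * (c / 4 * s) <= 4 / c * expR (c / 4 * s).
      by rewrite ler_wpM2l ?divr_ge0 ?ltW//; lra.
    lra.
  rewrite (_ : c / 2 * s = c / 4 * s + c / 4 * s); last by lra.
  rewrite expRD -expr2 -exprMn ler_pXn2r// nnegrE.
  by rewrite mulr_ge0 ?expR_ge0// divr_ge0// ltW.
have ee : expR (- (c * s)) * expR (c / 2 * s) = expR (- (c / 2 * s)).
  by rewrite -expRD; congr expR; lra.
have E0 := expR_ge0 (- (c * s)).
(* If [s <= lam], the scaled points lie in the unit ball, so connectedness is automatic and
   [lens_gauge] gives the error [lam * (s / lam) ^+ 2]. Otherwise each term is at most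
   [expR (- (c * s))], and the factor [s / lam], larger than 1, supplies the [1 / lam]. *)
have [sl|sl] := leP s lam.
  have u1 i : enorm (tnth u i) <= s / lam.
    by rewrite uz mulrC ler_wpM2r//; exact: enorm_le_tsum.
  have sl1 : s / lam <= 1 by rewrite ler_pdivrMr// mul1r.
  have sl0 : 0 <= s / lam by rewrite divr_ge0// ltW.
  have hu : hconn 1 (cons0 u) by apply: hconn_star => i; exact: le_trans (u1 i) sl1.
  rewrite /scaled_integrand -/u hu mul1r.
  apply: le_trans (expR_diff_le (as_ hu) gs) _.
  have gu : gauge z = lam * gauge u.
    by rewrite gauge_scale// mulrA divff ?mul1r// gt_eqF.
  rewrite [X in `|_ - X|]gu -mulrBr normrM gtr0_norm//.
  have := lens_gauge d0 sl0 sl1 u1; rewrite -/C0 => h.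
  apply: (@le_trans _ _ (C0 / lam * (s ^+ 2 * expR (- (c * s))))).
    rewrite mulrA ler_wpM2r//; apply: (@le_trans _ _ (lam * (C0 * (s / lam) ^+ 2))).
      by rewrite ler_wpM2l// ltW.
    by rewrite le_eqVlt; apply/orP; left; apply/eqP; field; rewrite gt_eqF.
  apply: (@le_trans _ _ (C0 / lam * ((4 / c) ^+ 2 * expR (- (c / 2 * s))))).
    rewrite -ee; apply: ler_wpM2l; first by apply: divr_ge0 => //; exact: ltW.
    by rewrite (mulrC (expR (- (c * s)))) mulrA; exact: ler_wpM2r.
  rewrite mulrA ler_wpM2r ?expR_ge0// mulrAC ler_wpM2r//.
  by rewrite lerDl divr_ge0// ltW.
have d1 : `|scaled_integrand lam z - expR (- gauge z)| <= expR (- (c * s)).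
  have g1 : expR (- gauge z) <= expR (- (c * s)) by rewrite ler_expR lerN2.
  have g2 : scaled_integrand lam z <= expR (- (c * s)).
    rewrite /scaled_integrand -/u; case: (boolP (hconn _ _)) => [hu|_]; last by rewrite mul0r.
    by rewrite mul1r ler_expR lerN2 as_.
  have g3 : 0 <= scaled_integrand lam z by rewrite mulr_ge0 ?expR_ge0.
  have := expR_ge0 (- gauge z); rewrite ler_norml => g4; apply/andP; split; lra.
apply: le_trans d1 _; apply: (@le_trans _ _ (s / lam * expR (- (c * s)))).
  by rewrite ler_peMl// ler_pdivlMr// mul1r ltW.
apply: (@le_trans _ _ (2 / c / lam * expR (- (c / 2 * s)))).
  rewrite -ee (mulrC (expR (- (c * s)))) mulrA; apply: ler_wpM2r => //.
  by rewrite mulrAC; exact: ler_wpM2r.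
apply: ler_wpM2r; first exact: expR_ge0.
by apply: ler_wpM2r => //; rewrite lerDr; apply: mulr_ge0 => //; exact: sqr_ge0.
Qed.

Lemma exp_tsum_integral_lty c : 0 < c ->
  (\int[mpow (vol d) n]_z (expR (- (c * tsum z)))%:E < +oo)%E.
Proof.
move=> c0; have me : measurable_fun setT (fun x : E => expR (- (c * enorm x))).
  apply: measurableT_comp => //; apply: measurableT_comp => //.
  by apply: measurable_funM => //; exact: measurable_enorm.
have := integral_mpow_prod_lty n me (fun x => expR_ge0 _) (integral_exp_enorm_lty d c0).
rewrite (eq_integral (fun z => (expR (- (c * tsum z)))%:E))// => z _.
by rewrite -expR_sum sumrN mulr_sumr.
Qed.

Lemma measurable_exp_tsum c :
  measurable_fun setT (fun z : n.-tuple E => (expR (- (c * tsum z)))%:E).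
Proof.
apply/measurable_EFinP; apply: measurableT_comp => //; apply: measurableT_comp => //.
apply: measurable_funM => //; apply: measurable_sum => i.
by apply: measurable_enorm; exact: measurable_tnth.
Qed.

Lemma measurable_exp_gauge :
  measurable_fun setT (fun z : n.-tuple E => (expR (- gauge z))%:E).
Proof.
apply/measurable_EFinP; apply: measurableT_comp => //; apply: measurableT_comp => //.
exact: measurable_gauge.
Qed.

Lemma gauge_integral_lty : (gauge_integral < +oo)%E.
Proof.
have th0 := @theta_gt0 R d.
pose kap : R := theta d / 2 ^+ d.
have kap0 : 0 < kap by rewrite divr_gt0// exprn_gt0.
pose c : R := kap / n.+1%:R; have c0 : 0 < c by rewrite divr_gt0.
apply: le_lt_trans (exp_tsum_integral_lty c0); apply: ge0_le_integral => //.
- exact: measurable_exp_gauge.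
- exact: measurable_exp_tsum.
move=> z _; rewrite lee_fin ler_expR lerN2; apply: le_tsum.
- exact: ltW.
- exact: gauge_ge0.
- by move=> i; rewrite mulrC; exact: gauge_ge.
Qed.

Lemma cluster_integral_asymptotics : exists2 C : R, 0 <= C &
  forall lam, 1 <= lam ->
    (cluster_integral lam < +oo)%E /\
    `|lam ^+ (n * d) * expR (lam * theta d) * fine (cluster_integral lam) -
      fine gauge_integral| <= C / lam.
Proof.
have [c [C [c0 C0 H]]] := integrands_close.
have boo := exp_tsum_integral_lty c0.
set B := (\int[mpow (vol d) n]_z _)%E in boo.
have B0 : (0 <= B)%E by apply: integral_ge0 => z _; rewrite lee_fin expR_ge0.
have Bf : B \is a fin_num by rewrite ge0_fin_numE.
exists (C * fine B); first by rewrite mulr_ge0// fine_ge0.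
move=> lam l1; have l0 : 0 < lam by lra.
have Cl : 0 <= C / lam by rewrite divr_ge0// ltW.
set M := (\int[mpow (vol d) n]_z (scaled_integrand lam z)%:E)%E.
have M0 : (0 <= M)%E by apply: integral_ge0 => z _; rewrite lee_fin mulr_ge0// expR_ge0.
have G0 : (0 <= gauge_integral)%E by apply: integral_ge0 => z _; rewrite lee_fin expR_ge0.
have Gf : gauge_integral \is a fin_num by rewrite ge0_fin_numE; [exact: gauge_integral_lty|exact: G0].
have mS : measurable_fun setT (fun z => (scaled_integrand lam z)%:E).
  by apply/measurable_EFinP; exact: measurable_scaled_integrand.
have mG := measurable_exp_gauge; have mB := measurable_exp_tsum c.
have S0 z : 0 <= scaled_integrand lam z by rewrite mulr_ge0// expR_ge0.
have mCB : measurable_fun setT (fun z : n.-tuple E => ((C / lam)%:E * (expR (- (c * tsum z)))%:E)%E).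
  exact: emeasurable_funM.
have CB0 z : (0 <= (C / lam)%:E * (expR (- (c * tsum z)))%:E)%E.
  by rewrite -EFinM lee_fin mulr_ge0// expR_ge0.
have ECB : ((C / lam)%:E * B = \int[mpow (vol d) n]_z ((C / lam)%:E * (expR (- (c * tsum z)))%:E))%E.
  by rewrite ge0_integralZl// => z _; rewrite lee_fin expR_ge0.
(* Two one-sided inequalities keep the integrands nonnegative, so that the finiteness of [M] is a
   conclusion and not a prerequisite. *)
have MG : (M <= gauge_integral + (C / lam)%:E * B)%E.
  rewrite ECB -ge0_integralD//.
  apply: (ge0_le_integral _ measurableT _ mS); [by move=> z _; rewrite lee_fin|exact: emeasurable_funD|].
  move=> z _; rewrite -EFinM -EFinD lee_fin.
  by have := H lam z l1; rewrite ler_norml => /andP[_]; lra.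
have GM : (gauge_integral <= M + (C / lam)%:E * B)%E.
  rewrite ECB -ge0_integralD//; last by move=> z _; rewrite lee_fin S0.
  apply: (ge0_le_integral _ measurableT _ mG); [by move=> z _; rewrite lee_fin expR_ge0|exact: emeasurable_funD|].
  move=> z _; rewrite -EFinM -EFinD lee_fin.
  by have := H lam z l1; rewrite ler_norml => /andP[+ _]; lra.
have Mf : M \is a fin_num.
  rewrite ge0_fin_numE//; apply: le_lt_trans MG _.
  by rewrite -(fineK Gf) -(fineK Bf) -EFinM -EFinD ltry.
have := cluster_integral_scaled l0; rewrite -/M => ME.
have J0 : (0 <= cluster_integral lam)%E.
  by apply: integral_ge0 => z _; rewrite lee_fin mulr_ge0// expR_ge0.
have k0 : 0 < lam ^+ (n * d) * expR (lam * theta d) by rewrite mulr_gt0 ?exprn_gt0 ?expR_gt0.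
have Jf : (cluster_integral lam < +oo)%E.
  rewrite ltey; apply/eqP => Joo; move: Mf; rewrite -ME Joo gt0_muley//.
split => //.
have Jfin : cluster_integral lam \is a fin_num by rewrite ge0_fin_numE.
have -> : lam ^+ (n * d) * expR (lam * theta d) * fine (cluster_integral lam) = fine M.
  by rewrite -ME -[in RHS](fineK Jfin) -EFinM.
move: MG GM; rewrite -(fineK Mf) -(fineK Gf) -(fineK Bf) -EFinM -!EFinD !lee_fin => h1 h2.
rewrite /= mulrAC; move: h1 h2.
move: (C / lam * fine B) (fine M) (fine gauge_integral) => u v w; clear => h1 h2.
by rewrite ler_norml; apply/andP; split; lra.
Qed.

End cluster_integral.

(** For [n = 0] the product power is a unit mass and the empty tuple has gauge 0, which agrees with
    the value 1 of [alpha]. *)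
Lemma alphaE (R : realType) (d n : nat) : (0 < d)%N ->
  alpha d n.+1 = (n`!%:R)^-1 * fine (@gauge_integral R d n).
Proof.
move=> d0; case: n => [|n].
  rewrite /= fact0 invr1 mul1r /gauge_integral integral_mpow0; last exact: measurable_exp_gauge.
  rewrite (_ : gauge _ = 0) ?oppr0 ?expR0//.
  by rewrite /gauge /radial_gauge integral0_eq// => x _; rewrite /rho big_ord0 mulr0.
have -> : @gauge_integral R d n.+1 =
    (\int[mpow (vol d) n.+1]_z (expR (- gfun z))%:E)%E.
  by apply: eq_integral => z _; rewrite gfunE.
by rewrite /alpha /Rintegral.
Qed.

(** * The Mecke formula for components *)

Section joint_law.
Context {d1 d2 : measure_display} {Omega : measurableType d1} {T : measurableType d2}
  {R : realType} (P : probability Omega R) (X : nat -> {RV P >-> T}).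
Hypothesis Xlaw : forall i B, measurable B ->
  distribution P (X i) B = distribution P (X 0%N) B.
Hypothesis Xindep : mutually_independent P (fun i => X i : Omega -> T).

Definition Xtuple m (s : m.-tuple nat) (w : Omega) : m.-tuple T :=
  [tuple X (tnth s i) w | i < m].

Lemma measurable_Xtuple m (s : m.-tuple nat) : measurable_fun setT (Xtuple s).
Proof.
apply/measurable_fun_tnthP => i.
by rewrite (_ : _ \o _ = X (tnth s i))//; apply/funext => w; rewrite /= tnth_mktuple.
Qed.

Definition tuple_boxes m : set (set (m.-tuple T)) :=
  [set A | exists B : 'I_m -> set T, (forall i, measurable (B i)) /\
     A = [set t | forall i, B i (tnth t i)]].

Lemma measurable_tuple_box m (B : 'I_m -> set T) : (forall i, measurable (B i)) ->
  measurable [set t : m.-tuple T | forall i, B i (tnth t i)].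
Proof.
move=> mB; rewrite (_ : [set _ | _] = [set t : m.-tuple T | [forall i, tnth t i \in B i]]).
  apply: measurable_bool_set; apply: measurable_forall => i.
  exact: (measurableT_comp (measurable_mem (mB i)) (measurable_tnth i)).
apply/seteqP; split => t /= h; first by apply/forallP => i; exact: mem_set.
by move=> i; apply: set_mem; move/forallP: h.
Qed.

Lemma measurable_tuple_boxesE m : measurable = <<s @tuple_boxes m >>.
Proof.
apply/seteqP; split.
  apply: smallest_sub; first exact: smallest_sigma_algebra.
  move=> A; rewrite -bigcup_seq/= => -[i _ [B mB <-]].
  apply: sub_sigma_algebra; exists (fun j => if j == i then B else setT); split.
    by move=> j; case: ifP.
  rewrite setTI; apply/seteqP; split => t /= h; last by have := h i; rewrite eqxx.
  by move=> j; case: eqP => // ->.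
apply: smallest_sub; first exact: sigma_algebra_measurable.
by move=> _ [B [mB ->]]; exact: measurable_tuple_box.
Qed.

Lemma joint_box m (s : m.-tuple nat) (B : 'I_m -> set T) : uniq s ->
  (forall i, measurable (B i)) ->
  P [set w | forall i, B i (X (tnth s i) w)] =
  (\prod_(i < m) distribution P (X 0%N) (B i))%E.
Proof.
move=> us mB; pose J := [fset x in (s : seq nat)]%fset.
(* Independence speaks of events indexed by natural numbers; as [s] has no repetitions, [B] can be
   carried along it. *)
pose B' j : set T := [set x | forall i, tnth s i = j -> B i x].
have B'E i : B' (tnth s i) = B i.
  apply/seteqP; split => x /= h; first exact: h.
  by move=> i' /tuple_uniqP h'; rewrite (h' us).
have := Xindep (J := J) (E := fun j => X j @^-1` B' j).
rewrite (_ : \bigcap_(i in [set` J]) _ = [set w | forall i, B i (X (tnth s i) w)]); last first.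
  apply/seteqP; split => w /= h.
    by move=> i; have := h (tnth s i); rewrite /= B'E; apply; rewrite in_fset/= mem_tnth.
  move=> j /=; rewrite in_fset/= => /tnthP[i ->]; by rewrite B'E.
move=> ->.
  rewrite (perm_big s)/=; last first.
    by apply: uniq_perm; [exact: fset_uniq|exact: us|move=> x; rewrite in_fset].
  rewrite big_tuple; apply: eq_bigr => i _; rewrite B'E -(Xlaw (tnth s i))//.
move=> j; rewrite in_fset/= => /tnthP[i ->]; exists (B i) => //.
by rewrite setTI B'E.
Qed.

(** The boxes are closed under intersection and generate the sigma-algebra, so agreement on them
    determines the law. *)
Lemma joint_law m (s : m.-tuple nat) (S : set (m.-tuple T)) : uniq s -> measurable S ->
  P (Xtuple s @^-1` S) = mpow (distribution P (X 0%N)) m S.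
Proof.
move=> us mS.
apply: (measure_unique (@tuple_boxes m) (fun=> setT) (@measurable_tuple_boxesE m) _ _ _
  (image_measure P (measurable_Xtuple s)) (mpow (distribution P (X 0%N)) m)) => //.
- move=> _ _ [A [mA ->]] [B [mB ->]]; exists (fun i => A i `&` B i); split.
    by move=> i; exact: measurableI.
  apply/seteqP; split => t /=; first by move=> [h1 h2] i; split.
  by move=> h; split => i; case: (h i).
- by move=> _; exists (fun=> setT); split => //; apply/seteqP; split.
- by rewrite bigcup_const//; exists 0%N.
- move=> _ [B [mB ->]]; apply: (etrans _ (esym (mpow_box (distribution P (X 0%N)) mB))).
  apply: (etrans _ (joint_box us mB)).
  change (P (Xtuple s @^-1` [set t | forall i, B i (tnth t i)]) = P [set w | forall i, B i (X (tnth s i) w)]).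
  by congr (P _); apply/seteqP; split => w /= h i; have := h i; rewrite tnth_mktuple.
- move=> _; change (P (Xtuple s @^-1` setT) < +oo)%E.
  by rewrite preimage_setT probability_setT ltry.
Qed.

Variable N : {RV P >-> nat}.
Hypothesis Nindep : independent_of_sequence P N (fun i => X i : Omega -> T).

Lemma joint_law_count m (s : m.-tuple nat) (S : set (m.-tuple T)) k : uniq s -> measurable S ->
  P ([set w | N w = k] `&` Xtuple s @^-1` S) =
  (P (N @^-1` [set k]) * mpow (distribution P (X 0%N)) m S)%E.
Proof.
move=> us mS; rewrite -(joint_law us mS); apply: Nindep.
  by exists [set k] => //; rewrite setTI.
(* Independence of [N] concerns the sigma-algebra generated by the samples, so the measurability of
   [Xtuple] is needed again, with respect to that one. *)
pose G := \bigcup_i sigma_rv (X i : Omega -> T).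
have : measurable_fun (setT : set (g_sigma_algebraType G)) (Xtuple s : g_sigma_algebraType G -> m.-tuple T).
  apply/measurable_fun_tnthP => i; rewrite (_ : _ \o _ = X (tnth s i)); last first.
    by apply/funext => w; rewrite /= tnth_mktuple.
  move=> _ B mB; apply: sub_sigma_algebra; exists (tnth s i) => //.
  by exists B.
by move=> /(_ measurableT S mS); rewrite setTI.
Qed.

End joint_law.

Lemma connect_homo (T T' : finType) (e : rel T) (e' : rel T') (f : T -> T') :
  (forall i j, e i j -> connect e' (f i) (f j)) ->
  forall i j, connect e i j -> connect e' (f i) (f j).
Proof.
move=> H i j /connectP[p]; elim: p i => [|c p IH] i /=; first by move=> _ ->.
move=> /andP[ic pc] jE; apply: connect_trans (H _ _ ic) _; exact: IH.
Qed.

(** * Components as sets of indices *)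

Section component_sets.
Context {R : realType} {d : nat}.
Notation E := 'rV[R]_d.

(** The vertex type of the graph varies with the sample, whereas subsets of ['I_m] can be summed
    over. The loops in the relation on indices do not affect [connect]. *)
Lemma num_componentsE m (x : 'I_m -> E) (S : {fset E}) k r : injective x ->
  (forall y, y \in S = [exists i, x i == y]) ->
  num_components k r S =
  #|[set J in equivalence_partition (connect (fun i j => enorm (x i - x j) <= r)) [set: 'I_m]
      | #|J| == k]%SET|.
Proof.
move=> xinj xS; set e := fun i j : 'I_m => enorm (x i - x j) <= r.
have xiS i : x i \in S by rewrite xS; apply/existsP; exists i.
pose v i : S := [` xiS i]%fset.
have vinj : injective v by move=> i j /(congr1 val)/= /xinj.
have vsurj (y : S) : exists i, v i = y.
  have := valP y; rewrite xS => /existsP[i /eqP xy]; exists i; exact: val_inj.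
have [v' v'K] : exists v' : S -> 'I_m, cancel v' v.
  by have /choice[v' h] := vsurj; exists v'.
have vK : cancel v v' by move=> i; apply: vinj; rewrite v'K.
have cE i j : connect (@geo_edge R d r S) (v i) (v j) = connect e i j.
  apply/idP/idP => [h|].
    rewrite -(vK i) -(vK j); apply: connect_homo h => a b /andP[_ h].
    by apply: connect1; rewrite /e -[x (v' a)]/(val (v (v' a))) -[x (v' b)]/(val (v (v' b))) !v'K.
  apply: connect_homo => a b h; have [->|ab] := eqVneq a b; first exact: connect0.
  by apply: connect1; rewrite /geo_edge (inj_eq vinj) ab.
rewrite /num_components /components.
rewrite -(card_imset _ (imset_inj vinj)); apply: eq_card => C; rewrite !inE.
have vD (D : {set S}) : v @: (v @^-1: D)%SET = D.
  apply/setP => z; apply/imsetP/idP => [[i hi ->]|hz]; first by rewrite inE in hi.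
  by exists (v' z); rewrite ?inE v'K.
apply/andP/imsetP => [[/imsetP[y _ ->] Ck]|[J]].
  exists (v @^-1: [set z in [set: S] | connect (@geo_edge R d r S) y z])%SET.
    rewrite inE; apply/andP; split.
      apply/imsetP; exists (v' y) => //; apply/setP => i; rewrite !inE.
      by rewrite -cE v'K.
    by rewrite -(card_imset _ vinj) vD.
  by rewrite vD.
rewrite inE => /andP[/imsetP[i _ ->] Jk] ->; rewrite card_imset//; split=> //.
apply/imsetP; exists (v i) => //; apply/setP => z; rewrite !inE.
apply/imsetP/idP => [[j]|h]; first by rewrite !inE => h ->; rewrite cE.
by exists (v' z); rewrite ?inE ?v'K// -cE v'K.
Qed.

(** A path starting in [J] cannot leave it when all other points are far. The first conjunct is a
    separate condition on each outside index, the second concerns [J] alone; the integral over the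
    outside points factors accordingly. *)
Lemma cluster_setP m (x : 'I_m -> E) r (J : {set 'I_m}) k (phi : 'I_k -> 'I_m) :
  (0 < k)%N -> 0 <= r -> injective phi -> (forall i, (i \in J) = [exists a, phi a == i]) ->
  (J \in equivalence_partition (connect (fun i j => enorm (x i - x j) <= r)) [set: 'I_m]) =
  [forall i, (i \notin J) ==> ~~ [exists a, enorm (x i - x (phi a)) <= r]] &&
  hconn r [tuple x (phi a) | a < k].
Proof.
move=> k0 r0 phi_inj phiJ; set e := fun i j : 'I_m => enorm (x i - x j) <= r.
have e_sym i j : e i j = e j i by rewrite /e enormBC.
have csym : connect_sym e by apply: sym_connect_sym => i j; exact: e_sym.
have phiJa a : phi a \in J by rewrite phiJ; apply/existsP; exists a.
have nearE a b : near_rel r [tuple x (phi a) | a < k] a b = e (phi a) (phi b).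
  by rewrite /near_rel !tnth_mktuple.
apply/imsetP/andP => [[i0 _ JE]|[/forallP far hc]].
  have inJ i : (i \in J) = connect e i0 i by rewrite JE !inE.
  split.
    apply/forallP => i; apply/implyP; apply: contra => /existsP[a h].
    rewrite inJ; apply: (@connect_trans _ _ (phi a)); first by rewrite -inJ.
    by apply: connect1; rewrite e_sym.
  have walk p a : path e (phi a) p -> exists2 b, phi b = last (phi a) p &
      connect (near_rel r [tuple x (phi a) | a < k]) a b.
    elim: p a => [|c p IH] a /=; first by exists a.
    move=> /andP[ac pc]; have : c \in J.
      rewrite inJ; apply: (@connect_trans _ _ (phi a)); first by rewrite -inJ.
      exact: connect1.
    rewrite phiJ => /existsP[a' /eqP a'c]; rewrite -a'c in ac pc *.
    have [b bE bc] := IH _ pc; exists b => //.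
    by apply: connect_trans bc; apply: connect1; rewrite nearE.
  apply/forallP => a; apply/forallP => b.
  have : connect e (phi a) (phi b).
    by apply: (@connect_trans _ _ i0); [rewrite csym -inJ|rewrite -inJ].
  move=> /connectP[p pp pE]; have [b' b'E] := walk _ _ pp.
  by rewrite -pE in b'E; rewrite (phi_inj _ _ b'E).
pose a0 : 'I_k := Ordinal k0; exists (phi a0) => //.
apply/setP => i; rewrite !inE; apply/idP/idP.
  rewrite phiJ => /existsP[a /eqP <-].
  have : connect (near_rel r [tuple x (phi a) | a < k]) a0 a.
    by move/forallP : hc => /(_ a0)/forallP.
  apply: connect_homo => b c h; apply: connect1; by rewrite -nearE.
move=> /connectP[p pp ->]; have : phi a0 \in J by exact: phiJa.
elim: p (phi a0) pp => [|c p IH] b//= /andP[bc pc] bJ; apply: IH => //.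
apply/negPn/negP => cJ; have := far c; rewrite cJ/= => /negP; apply.
move: bJ; rewrite phiJ => /existsP[a /eqP ab]; apply/existsP; exists a.
by rewrite ab -/(e c b) e_sym.
Qed.

End component_sets.

(** * Integrating out the points outside the cluster *)

Section mpow_split.
Local Open Scope ereal_scope.
Context {disp : measure_display} {T : measurableType disp} {R : realType}.
Variables (nu : {sigma_finite_measure set T -> \bar R}) (k : nat).
Variables (f : T * k.-tuple T -> bool) (q : k.-tuple T -> R).
Hypotheses (mf : measurable_fun setT f) (mq : measurable_fun setT q).
Hypothesis qE : forall y, nu [set x | f (x, y)] = (q y)%:E.

(** The outside points come first and the cluster last, so that the recursion on [l] is that of
    [mpow]. *)
Fixpoint lastk l : (l + k).-tuple T -> k.-tuple T :=
  match l with 0 => id | l'.+1 => fun t => @lastk l' (tuncons t).2 end.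

Fixpoint allpre l : (l + k).-tuple T -> bool :=
  match l with
  | 0 => xpredT
  | l'.+1 => fun t => f ((tuncons t).1, lastk (tuncons t).2) && @allpre l' (tuncons t).2
  end.

Lemma lastkS l x (t : (l + k).-tuple T) : @lastk l.+1 (tcons (x, t)) = lastk t.
Proof. by rewrite -[LHS]/(lastk (tuncons (tcons (x, t))).2) tconsK. Qed.

Lemma allpreS l x (t : (l + k).-tuple T) :
  @allpre l.+1 (tcons (x, t)) = f (x, lastk t) && allpre t.
Proof.
by rewrite -[LHS]/(f ((tuncons (tcons (x, t))).1, lastk (tuncons (tcons (x, t))).2)
  && allpre (tuncons (tcons (x, t))).2) tconsK.
Qed.

Lemma lastk_val l (t : (l + k).-tuple T) : val (lastk t) = drop l (val t).
Proof.
elim: l t => [|l IH] t /=; first by rewrite drop0.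
by rewrite IH; case: t => -[|a s].
Qed.

Lemma allpreE l (t : (l + k).-tuple T) :
  allpre t = all (fun x => f (x, lastk t)) (take l (val t)).
Proof.
elim: l t => [|l IH] t /=; first by rewrite take0.
by rewrite IH; case: t => -[|a s].
Qed.

Lemma measurable_tuncons2 n : measurable_fun setT (fun t : n.+1.-tuple T => (tuncons t).2).
Proof. exact: (measurableT_comp measurable_snd (measurable_tuncons (n := n))). Qed.

Lemma measurable_lastk l : measurable_fun setT (@lastk l).
Proof.
elim: l => [|l IH] //=.
exact: (measurableT_comp IH (@measurable_tuncons2 (l + k))).
Qed.

Lemma measurable_allpre l : measurable_fun setT (@allpre l).
Proof.
elim: l => [|l IH]; first exact: measurable_cst.
have m2 := @measurable_tuncons2 (l + k).
change (measurable_fun setT (fun t : (l + k).+1.-tuple T =>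
  f ((tuncons t).1, lastk (tuncons t).2) && allpre (tuncons t).2)).
apply: measurable_and; last exact: (measurableT_comp IH m2).
apply: (measurableT_comp mf).
apply: (measurable_fun_pair (f := fun t => (tuncons t).1) (g := fun t => lastk (tuncons t).2)).
  exact: (measurableT_comp measurable_fst (measurable_tuncons (n := l + k))).
exact: (measurableT_comp (@measurable_lastk l) m2).
Qed.

(** Given the cluster [y], each outside point integrates to [q y]. The induction removes one point
    and puts the factor into [G]. *)
Lemma integral_mpow_split l (G : k.-tuple T -> R) :
  measurable_fun setT G -> (forall y, 0 <= G y)%R ->
  \int[mpow nu (l + k)]_t ((allpre t)%:R * G (lastk t))%:E =
  \int[mpow nu k]_y (q y ^+ l * G y)%:E.
Proof.
have q0 y : (0 <= q y)%R by rewrite -lee_fin -qE.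
elim: l G => [|l IH] G mG G0.
  by apply: eq_integral => t _; rewrite expr0 !mul1r.
rewrite [LHS](@integral_mpowS_swap _ _ _ nu (l + k)); last 2 first.
- apply/measurable_EFinP; apply: measurable_funM.
    by apply: measurable_bool_real; exact: (@measurable_allpre l.+1).
  exact: (measurableT_comp mG (@measurable_lastk l.+1)).
- by move=> t; rewrite lee_fin mulr_ge0.
transitivity (\int[mpow nu (l + k)]_t ((allpre t)%:R * (q (lastk t) * G (lastk t)))%:E).
  apply: eq_integral => t _.
  transitivity (\int[nu]_x (((allpre t)%:R * G (lastk t))%:E * (f (x, lastk t))%:R%:E)).
    apply: eq_integral => x _.
    transitivity (((f (x, lastk t) && allpre t)%:R * G (lastk t))%:E).
      by rewrite -(allpreS x t) -[in RHS](lastkS x t).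
    rewrite -EFinM; congr EFin.
    by case: (f _); rewrite /= ?mulr1 ?mulr0 ?mul0r.
  have mfx : measurable_fun setT (fun x => f (x, lastk t)).
    exact: (measurableT_comp mf (pair2_measurable (lastk t))).
  rewrite ge0_integralZl//; last 2 first.
  - exact: measurable_bool_fun.
  - by rewrite lee_fin mulr_ge0.
  rewrite integral_bool// [X in _ * X](_ : _ = (q (lastk t))%:E); last exact: qE.
  by rewrite -EFinM; congr EFin; rewrite -mulrA (mulrC (G _)).
rewrite (IH (fun y => q y * G y)%R).
- by apply: eq_integral => y _; rewrite exprSr mulrA.
- exact: measurable_funM.
- by move=> y; rewrite mulr_ge0.
Qed.

End mpow_split.

(** The integral of a nonnegative function is a supremum over simple functions below it, hence
    monotone without any measurability. *)
Lemma le_ge0_integral (disp : measure_display) (T : measurableType disp) (R : realType)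
    (mu : {measure set T -> \bar R}) (f g : T -> \bar R) :
  (forall x, 0 <= f x)%E -> (forall x, f x <= g x)%E ->
  (\int[mu]_x f x <= \int[mu]_x g x)%E.
Proof.
move=> f0 fg; have g0 x : (0 <= g x)%E by exact: le_trans (f0 x) (fg x).
rewrite !ge0_integralTE//; apply: le_ereal_sup => _ [h hf <-].
by exists h => // x; exact: le_trans (hf x) (fg x).
Qed.

(* [f] need not be measurable. *)
Lemma integral_ae_on (disp : measure_display) (T : measurableType disp) (R : realType)
    (mu : {measure set T -> \bar R}) (f g : T -> \bar R) (D : set T) :
  measurable D -> mu (~` D) = 0%E -> (forall x, 0 <= f x)%E -> (forall x, 0 <= g x)%E ->
  measurable_fun setT g -> (forall x, D x -> f x = g x) ->
  (\int[mu]_x f x = \int[mu]_x g x)%E.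
Proof.
move=> mD D0 f0 g0 mg fg.
have mDm := measurable_mem mD.
have neg h : (forall x, D x -> h x = g x) -> ae_eq mu setT h g.
  move=> hg; exists (~` D); split => //; first exact: measurableC.
  by move=> x /= h1 h2; apply: h1 => _; exact: hg.
(* [lo] and [hi] are measurable, equal [g] off a null set and enclose [f]. *)
pose lo x := if x \in D then g x else 0%E.
pose hi x := if x \in D then g x else +oo%E.
have mlo : measurable_fun setT lo by apply: measurable_fun_ifT.
have mhi : measurable_fun setT hi by apply: measurable_fun_ifT.
have Elo : (\int[mu]_x lo x = \int[mu]_x g x)%E.
  apply: ae_eq_integral => //; apply: neg => x Dx; by rewrite /lo mem_set.
have Ehi : (\int[mu]_x hi x = \int[mu]_x g x)%E.
  apply: ae_eq_integral => //; apply: neg => x Dx; by rewrite /hi mem_set.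
apply/eqP; rewrite eq_le -{1}Ehi -Elo; apply/andP; split; apply: le_ge0_integral => // x.
- rewrite /hi; case: ifPn => [/set_mem Dx|_]; last exact: leey.
  by rewrite fg.
- by rewrite /lo; case: ifP.
- rewrite /lo; case: ifPn => [/set_mem Dx|//]; by rewrite fg.
Qed.

Lemma nneseries_exp (R : realType) (x : R) : 0 <= x ->
  (\sum_(l <oo) ((x ^+ l / l`!%:R)%:E) = (expR x)%:E)%E.
Proof.
move=> x0; rewrite /expR -EFin_lim; last exact: is_cvg_series_exp_coeff.
by apply/congr_lim/funext => n; rewrite /= /series/= -sumEFin.
Qed.

Lemma nneseries_single (R : realType) (f : nat -> \bar R) l0 :
  (forall l, 0 <= f l)%E -> (forall l, l != l0 -> f l = 0%E) ->
  (\sum_(l <oo) f l = f l0)%E.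
Proof.
move=> f0 f1; rewrite (nneseries_split 0 l0.+1)//.
rewrite eseries0 ?adde0; last first.
  by move=> i h _; apply: f1; rewrite gtn_eqF.
rewrite add0n big_nat_recr//= big1_seq ?add0e// => i /andP[_].
by rewrite mem_index_iota => /andP[_ h]; apply: f1; rewrite ltn_eqF.
Qed.

(** * Summing over the number of points and the index sets *)

Section mecke.
Context {d : nat} {disp : measure_display} {Omega : measurableType disp} {R : realType}.
Notation E := 'rV[R]_d.
Variables (P : probability Omega R) (X : nat -> {RV P >-> E}) (N : {RV P >-> nat}).
Variables (k : nat) (r rate : R).
Hypotheses (k0 : (0 < k)%N) (r0 : 0 <= r) (rate0 : 0 < rate).
Hypothesis Xlaw : forall i B, measurable B ->
  distribution P (X i) B = distribution P (X 0%N) B.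
Hypothesis Xindep : mutually_independent P (fun i => X i : Omega -> E).
Hypothesis Xatomless : forall x, distribution P (X 0%N) [set x] = 0%E.
Hypothesis Nindep : independent_of_sequence P N (fun i => X i : Omega -> E).
Hypothesis Npoisson : poisson_rv N rate.

Notation nu := (distribution P (X 0%N)).

Definition cluster_event m (J : {set 'I_m}) (w : Omega) : bool :=
  J \in equivalence_partition
    (connect (fun i j : 'I_m => enorm (X i w - X j w) <= r)) [set: 'I_m].

Definition far_from (p : E * k.-tuple E) : bool :=
  ~~ [exists a, enorm (p.1 - tnth p.2 a) <= r].

(** The factor contributed by each point outside the cluster: the probability that a fresh sample
    point is not adjacent to [y]. *)
Definition avoid (y : k.-tuple E) : R := fine (nu [set x | far_from (x, y)]).

Lemma measurable_far_from : measurable_fun setT far_from.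
Proof.
apply: measurable_neg; apply: measurable_exists => i.
apply: measurable_fun_ler => //; apply: measurable_enorm; apply: measurable_rVB => //.
exact: (measurableT_comp (measurable_tnth i) measurable_snd).
Qed.

Lemma avoidE y : nu [set x | far_from (x, y)] = (avoid y)%:E.
Proof.
rewrite fineK// ge0_fin_numE//; apply: le_lt_trans (ltry 1).
apply: probability_le1; apply: measurable_bool_set.
exact: (measurableT_comp measurable_far_from (pair2_measurable y)).
Qed.

Lemma avoid_ge0 y : 0 <= avoid y.
Proof. by rewrite -lee_fin -avoidE. Qed.

Lemma measurable_avoid : measurable_fun setT avoid.
Proof.
apply: measurableT_comp => //.
have mf : measurable_fun setT (fun p : k.-tuple E * E => far_from (p.2, p.1)).
  apply: (measurableT_comp measurable_far_from); exact: (measurable_fun_pair measurable_snd measurable_fst).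
exact: (measurable_section_measure nu mf).
Qed.

(** Listing the indices outside [J] before those of [J] turns the event into one about a tuple of
    independent points, whose law is the same for every [J] of size [k]. *)
Lemma cluster_event_prob l (J : {set 'I_(l + k)}) : #|J| = k ->
  measurable_fun setT (fun w => (N w == (l + k)%N) && cluster_event J w) /\
  P [set w | (N w == (l + k)%N) && cluster_event J w] =
    (P (N @^-1` [set (l + k)%N]) * \int[mpow nu k]_y (avoid y ^+ l * (hconn r y)%:R)%:E)%E.
Proof.
move=> Jk; pose m := (l + k)%N.
pose js : seq 'I_m := enum (~: J) ++ enum J.
have sJ : size (enum J) = k by rewrite -cardE.
have sC : size (enum (~: J)) = l.
  by rewrite -cardE cardsCs finset.setCK card_ord Jk /m addnK.
have sjs : size (map val js) == (l + k)%N by rewrite size_map size_cat sC sJ.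
pose s : (l + k).-tuple nat := Tuple sjs.
have us : uniq s.
  rewrite /= map_inj_uniq; last exact: val_inj.
  rewrite cat_uniq !enum_uniq/= andbT; apply/hasPn => i; rewrite !mem_enum.
  by rewrite inE negbK.
have sJ' : size (enum J) == k by rewrite sJ.
pose tJ : k.-tuple 'I_m := Tuple sJ'.
pose phi : 'I_k -> 'I_m := tnth tJ.
have phi_inj : injective phi by apply/tuple_uniqP; exact: enum_uniq.
have phiJ i : (i \in J) = [exists a, phi a == i].
  rewrite -mem_enum; apply/(tnthP tJ)/existsP => -[a]; first by move=> ->; exists a.
  by move=> /eqP <-; exists a.
have XE w : val (Xtuple X s w) = [seq X i w | i <- s].
  by rewrite -[in RHS](map_tnth_enum s) -map_comp.
have lastE w : lastk (Xtuple X s w) = [tuple X (phi a) w | a < k].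
  apply: val_inj; rewrite lastk_val XE -map_drop /= map_cat drop_size_cat ?size_map//.
  have ET : [seq phi a | a <- enum 'I_k] = enum J := map_tnth_enum tJ.
  by rewrite -ET -!map_comp.
have allE w : allpre far_from (Xtuple X s w) =
    [forall i : 'I_m, (i \notin J) ==> ~~ [exists a, enorm (X i w - X (phi a) w) <= r]].
  rewrite allpreE lastE XE -map_take /= map_cat take_size_cat ?size_map// !all_map.
  have fE (i : 'I_m) : far_from (X i w : E, [tuple X (phi a) w | a < k]) =
     ~~ [exists a, enorm (X i w - X (phi a) w) <= r].
    by congr (~~ _); apply: eq_existsb => a; rewrite tnth_mktuple.
  apply/allP/forallP => h i.
    by apply/implyP => iJ; rewrite -fE; apply: h; rewrite mem_enum inE.
  by rewrite mem_enum inE => iJ; rewrite /= fE; move: (h i); rewrite iJ.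
have clE w : cluster_event J w = allpre far_from (Xtuple X s w) && hconn r (lastk (Xtuple X s w)).
  by rewrite /cluster_event (cluster_setP (fun i : 'I_m => X i w) k0 r0 phi_inj phiJ) allE lastE.
pose S : set ((l + k).-tuple E) := [set t | allpre far_from t && hconn r (lastk t)].
have mb : measurable_fun setT (fun t : (l + k).-tuple E => allpre far_from t && hconn r (lastk t)).
  apply: measurable_and; first exact: (measurable_allpre measurable_far_from).
  exact: (measurableT_comp (@measurable_hconn R d k r) (@measurable_lastk _ E k l)).
have mS : measurable S by exact: measurable_bool_set.
split.
  apply: measurable_and.
    by apply: (measurableT_comp (f := fun i : nat => i == (l + k)%N)).
  rewrite (_ : cluster_event J = (fun t => allpre far_from t && hconn r (lastk t)) \o Xtuple X s).
    exact: (measurableT_comp mb (measurable_Xtuple _ s)).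
  by apply/funext => w; rewrite clE.
have -> : [set w | (N w == (l + k)%N) && cluster_event J w] =
    [set w | N w = (l + k)%N] `&` Xtuple X s @^-1` S.
  apply/seteqP; split => w /=; first by move=> /andP[/eqP -> ]; rewrite clE.
  by move=> [-> h]; rewrite eqxx clE.
rewrite (joint_law_count Xlaw Xindep Nindep _ us mS); congr (_ * _)%E.
rewrite -(integral_mpow_split measurable_far_from measurable_avoid avoidE l); last 2 first.
- by apply: measurable_bool_real; exact: measurable_hconn.
- by [].
rewrite -(integral_bool _ mb); apply: eq_integral => t _.
by congr EFin; rewrite -mulnb natrM.
Qed.

Definition distinct_samples : set Omega :=
  \bigcap_(ij in [set ij : nat * nat | ij.1 != ij.2]) [set w | X ij.1 w != X ij.2 w].

Lemma measurable_neq i j : measurable_fun setT (fun w => X i w != X j w).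
Proof.
rewrite (_ : (fun w => _) = fun w => 0 < enorm (X i w - X j w)).
  by apply: measurable_fun_ltr => //; apply: measurable_enorm; exact: measurable_rVB.
by apply/funext => w; rewrite lt0r enorm_ge0 andbT enorm_eq0 subr_eq0.
Qed.

Lemma prob_eq0 i j : i != j -> P [set w | ~~ (X i w != X j w)] = 0%E.
Proof.
move=> ij; pose s : 2.-tuple nat := [tuple i; j].
have us : uniq s by rewrite /= inE ij.
pose b (t : 2.-tuple E) : bool := tnth t ord0 == tnth t (lift ord0 ord0).
have mb : measurable_fun setT b.
  rewrite (_ : b = fun t => enorm (tnth t ord0 - tnth t (lift ord0 ord0)) <= 0).
    apply: measurable_fun_ler => //; apply: measurable_enorm.
    by apply: measurable_rVB; exact: measurable_tnth.
  by apply/funext => t; rewrite /b le_eqVlt ltNge enorm_ge0 orbF enorm_eq0 subr_eq0.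
have -> : [set w | ~~ (X i w != X j w)] = Xtuple X s @^-1` [set t | b t].
  by apply/seteqP; split => w /=; rewrite negbK /b !tnth_mktuple.
rewrite (joint_law Xlaw Xindep us (measurable_bool_set mb)).
rewrite -(integral_bool _ mb) [LHS](@integral_mpowS_swap _ _ _ nu 1); last 2 first.
- exact: measurable_bool_fun.
- by [].
apply: integral0_eq => t _.
rewrite (_ : (fun x => _) = fun x => ((x \in [set tnth t ord0])%:R)%:E); last first.
  apply/funext => x; congr (_%:R%:E); rewrite /b tnthS.
  rewrite (_ : tnth (tcons (x, t)) ord0 = x)//=.
  by congr nat_of_bool; apply/idP/idP => [/eqP h|/set_mem h]; [exact: mem_set|exact/eqP].
rewrite integral_bool; last first.
  apply: measurable_mem; rewrite (_ : [set _] = eball (tnth t ord0) 0); first exact: measurable_eball.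
  apply/seteqP; split => y; rewrite /eball/=; first by move=> ->; rewrite subrr enorm0.
  by rewrite le_eqVlt ltNge enorm_ge0 orbF enorm_eq0 subr_eq0 => /eqP.
rewrite -[RHS](Xatomless (tnth t ord0)); congr (nu _).
by apply/seteqP; split => y /=; [move/set_mem|move=> h; apply: mem_set].
Qed.

Lemma measurable_distinct : measurable distinct_samples.
Proof.
rewrite /distinct_samples -[X in measurable X]setCK; apply: measurableC.
rewrite setC_bigcap bigcup_mkcond; apply: countable_bigcupT_measurable; first exact: countableP.
move=> ij; case: ifP => // _; apply: measurableC.
exact: measurable_bool_set (measurable_neq _ _).
Qed.

Lemma prob_distinct : P (~` distinct_samples) = 0%E.
Proof.
apply/negligibleP; first by apply: measurableC; exact: measurable_distinct.
pose F i j := if i == j then set0 else [set w | ~~ (X i w != X j w)].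
apply: (@negligibleS _ _ _ _ (\bigcup_i \bigcup_j F i j)).
  rewrite /distinct_samples setC_bigcap => w [[i j] /= ij h]; exists i => //; exists j => //.
  by rewrite /F (negbTE ij) /=; apply/negP.
apply: negligible_bigcup => i; apply: negligible_bigcup => j.
rewrite /F; case: eqP => [_|/eqP ij]; first exact: negligible_set0.
apply/negligibleP; last exact: prob_eq0.
by apply: measurable_bool_set; apply: measurable_neg; exact: measurable_neq.
Qed.

(** At most the term [l = N w - k] differs from 0. The series gives [J] a type that does not depend
    on [w], so that it can be integrated term by term. *)
Definition cluster_count (w : Omega) : \bar R :=
  (\sum_(l <oo) \sum_(J : {set 'I_(l + k)} | #|J| == k)
     (((N w == (l + k)%N) && cluster_event J w)%:R%:E))%E.

Lemma num_components_count w : distinct_samples w ->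
  ((num_components k r (sample (fun i => X i : Omega -> E) N w))%:R%:E = cluster_count w)%E.
Proof.
move=> Dw; have Xinj i j : X i w = X j w -> i = j.
  by move=> h; apply/eqP/negPn/negP => ij; have := Dw (i, j) ij; rewrite /= h eqxx.
pose m := N w.
have numE : num_components k r (sample (fun i => X i : Omega -> E) N w) =
    #|[set J in [set J : {set 'I_m} | cluster_event J w] | #|J| == k]%SET|.
  rewrite (@num_componentsE _ _ m (fun i : 'I_m => X i w)).
  - by apply: eq_card => J; rewrite !inE.
  - by move=> i j /Xinj h; exact: val_inj.
  move=> y; rewrite /sample; apply/imfsetP/existsP => /= [[i]|[i /eqP <-]].
    by rewrite mem_iota/= => im ->; exists (Ordinal im).
  by exists (val i) => //; rewrite mem_iota/= ltn_ord.
have countE l : (\sum_(J : {set 'I_(l + k)} | #|J| == k)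
     (((N w == (l + k)%N) && cluster_event J w)%:R%:E : \bar R) =
   if N w == (l + k)%N then (#|[set J in [set J : {set 'I_(l + k)} | cluster_event J w] | #|J| == k]%SET|%:R)%:E else 0)%E.
  case: ifP => _; last by rewrite big1.
  rewrite sumEFin -natr_sum; congr (_%:R%:E).
  rewrite -sum1_card [RHS]big_mkcond [LHS]big_mkcond/=; apply: eq_bigr => J _.
  by rewrite !inE andbC; case: (_ == k); case: (cluster_event J w).
have [km|mk] := leqP k m.
  rewrite /cluster_count (@nneseries_single _ _ (m - k)%N).
  - rewrite countE numE; move: (subnK km); rewrite -/m.
    by move: (m - k + k)%N => m' ->; rewrite eqxx.
  - by move=> l; apply: sume_ge0 => J _.
  - move=> l lm; rewrite countE; case: eqP => // h; case/negP: lm; apply/eqP.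
    by rewrite /m h addnK.
rewrite /cluster_count eseries0; last first.
  by move=> l _ _; rewrite countE; case: eqP => // h; move: mk; rewrite /m h ltnNge leq_addl.
rewrite numE (_ : [set J in _ | _]%SET = finset.set0) ?cards0//.
apply/setP => J; rewrite !inE; apply/negbTE/negP => /andP[_ /eqP Jk].
by have := max_card (mem J); rewrite Jk card_ord leqNgt mk.
Qed.

Let summand l (w : Omega) : \bar R := (\sum_(J : {set 'I_(l + k)} | #|J| == k)
     (((N w == (l + k)%N) && cluster_event J w)%:R%:E))%E.

Let measurable_term l (J : {set 'I_(l + k)}) : #|J| == k ->
  measurable_fun setT (fun w => (((N w == (l + k)%N) && cluster_event J w)%:R%:E) : \bar R).
Proof.
by move=> /eqP Jk; apply: measurable_bool_fun; case: (cluster_event_prob Jk).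
Qed.

Let measurable_summand l : measurable_fun setT (summand l).
Proof.
rewrite (_ : summand l = fun w => \sum_(J : {set 'I_(l + k)}) if #|J| == k then
    ((N w == (l + k)%N) && cluster_event J w)%:R%:E else 0%E)%E; last first.
  by apply/funext => w; rewrite /summand big_mkcond.
by apply: emeasurable_sum => J; have [Jk|Jk] := boolP (#|J| == k); [exact: measurable_term|exact: measurable_cst].
Qed.

Lemma measurable_cluster_count : measurable_fun setT cluster_count.
Proof.
apply: ge0_emeasurable_sum => l; last by move=> _; exact: measurable_summand.
by move=> w _ _; apply: sume_ge0.
Qed.

Let I_ l : \bar R := (\int[mpow nu k]_y (avoid y ^+ l * (hconn r y)%:R)%:E)%E.

Let mh : measurable_fun setT (fun y : k.-tuple E => (hconn r y)%:R : R).
Proof. by apply: measurable_bool_real; exact: measurable_hconn. Qed.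

Let integral_summand l : (\int[P]_w summand l w =
  ((rate ^+ k / k`!%:R)%:E * \int[mpow nu k]_y
    (expR (- rate) * ((rate * avoid y) ^+ l / l`!%:R) * (hconn r y)%:R)%:E))%E.
Proof.
have IE : (\int[mpow nu k]_y
    (expR (- rate) * ((rate * avoid y) ^+ l / l`!%:R) * (hconn r y)%:R)%:E =
    (expR (- rate) * (rate ^+ l / l`!%:R))%:E * I_ l)%E.
  rewrite -ge0_integralZl//; last 3 first.
  - apply/measurable_EFinP; apply: measurable_funM => //.
    by apply: measurable_funX; exact: measurable_avoid.
  - by move=> y _; rewrite lee_fin mulr_ge0// exprn_ge0// avoid_ge0.
  - by rewrite lee_fin mulr_ge0 ?expR_ge0// divr_ge0// exprn_ge0// ltW.
  apply: eq_integral => y _; rewrite -EFinM; congr EFin; rewrite exprMn; ring.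
rewrite IE muleA -EFinM.
transitivity (\sum_(J : {set 'I_(l + k)} | #|J| == k)
   \int[P]_w (((N w == (l + k)%N) && cluster_event J w)%:R%:E))%E.
  rewrite /summand; under eq_integral do rewrite big_mkcond.
  rewrite ge0_integral_sum//.
  - rewrite [RHS]big_mkcond; apply: eq_bigr => J _; case: ifP => // _.
    by rewrite integral0.
  - by move=> J; have [Jk|Jk] := boolP (#|J| == k); [exact: measurable_term|exact: measurable_cst].
  - by move=> J w _; case: ifP.
rewrite (eq_bigr (fun=> ((rate ^+ (l + k) * (l + k)`!%:R^-1 * expR (- rate))%:E * I_ l)%E)); last first.
  move=> J /eqP Jk; have [mJ PJ] := cluster_event_prob Jk.
  rewrite integral_bool//; apply: (etrans PJ); congr (_ * _)%E.
  by apply: (etrans (Npoisson _)); rewrite /poisson_pmf rate0.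
rewrite sumr_const (_ : #|_| = 'C(l + k, k)); last first.
  by rewrite -[in RHS](card_ord (l + k)) -card_draws cardsE.
have natE (c : \bar R) j : (c *+ j)%R = (j%:R%:E * c)%E.
  elim: j => [|j IHj]; first by rewrite mulr0n mul0e.
  by rewrite mulrS IHj -natr1 addrC EFinD ge0_muleDl ?lee_fin// mul1e.
rewrite natE muleA -EFinM; congr (_%:E * _)%E.
(* The binomial number of sets [J] splits the Poisson weight: [C(l+k, k) rate^(l+k) / (l+k)!] is
   [rate^k / k!] times [rate^l / l!], and the second factor builds up the exponential series. *)
have := bin_fact (leq_addl l k); rewrite addnK => /(congr1 (fun n => n%:R : R)).
rewrite !natrM exprD => <-.
have c0 : 'C(l + k, k)%:R != 0 :> R by rewrite pnatr_eq0 -lt0n bin_gt0 leq_addl.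
have l0 : l`!%:R != 0 :> R by rewrite pnatr_eq0 -lt0n fact_gt0.
have kk0 : k`!%:R != 0 :> R by rewrite pnatr_eq0 -lt0n fact_gt0.
by field; rewrite c0 l0 kk0.
Qed.

Lemma integral_cluster_count :
  (\int[P]_w cluster_count w = (rate ^+ k / k`!%:R)%:E *
     \int[mpow nu k]_y ((hconn r y)%:R * expR (- rate * (1 - avoid y)))%:E)%E.
Proof.
rewrite /cluster_count -/summand.
rewrite (integral_nneseries _ measurableT measurable_summand); last first.
  by move=> l w _; apply: sume_ge0.
rewrite (eq_eseriesr (fun l _ => integral_summand l)).
have t0 l y : 0 <= expR (- rate) * ((rate * avoid y) ^+ l / l`!%:R) * (hconn r y)%:R.
  by rewrite !mulr_ge0 ?expR_ge0 ?exprn_ge0 ?mulr_ge0 ?avoid_ge0// ltW.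
have mt l : measurable_fun setT (fun y => (expR (- rate) * ((rate * avoid y) ^+ l / l`!%:R) * (hconn r y)%:R)%:E).
  apply/measurable_EFinP; apply: measurable_funM => //; apply: measurable_funM => //.
  apply: measurable_funM => //; apply: measurable_funX; apply: measurable_funM => //.
  exact: measurable_avoid.
rewrite nneseriesZl; last first.
  by move=> l _; apply: integral_ge0 => y _; rewrite lee_fin.
congr (_ * _)%E; rewrite -(integral_nneseries _ measurableT mt); last first.
  by move=> l y _; rewrite lee_fin.
apply: eq_integral => y _.
transitivity (\sum_(l <oo) (((hconn r y)%:R * expR (- rate))%:E * ((rate * avoid y) ^+ l / l`!%:R)%:E))%E.
  by apply: eq_eseriesr => l _; rewrite -EFinM; congr EFin; ring.
rewrite nneseriesZl; last first.
  by move=> l _; rewrite lee_fin divr_ge0// exprn_ge0// mulr_ge0 ?avoid_ge0// ltW.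
rewrite nneseries_exp; last by rewrite mulr_ge0 ?avoid_ge0// ltW.
by rewrite -EFinM -mulrA -expRD; congr ((_ * expR _)%:E); ring.
Qed.

(* Summing over the number of points and over the sets of [k] indices: such a set is a component
   when its points are connected and all other points are far from them. *)
Theorem mecke :
  ('E_P[fun w => (num_components k r (sample (fun i => X i : Omega -> E) N w))%:R] =
   (rate ^+ k / k`!%:R)%:E *
     \int[mpow nu k]_y ((hconn r y)%:R * expR (- rate * (1 - avoid y)))%:E)%E.
Proof.
rewrite -integral_cluster_count unlock.
apply: (integral_ae_on measurable_distinct prob_distinct).
- by [].
- by move=> w; apply: nneseries_ge0 => l _ _; apply: sume_ge0.
- exact: measurable_cluster_count.
- exact: num_components_count.
Qed.

End mecke.

(** * Geometry of the boundary *)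

Lemma enorm_le_sum (R : realType) (d : nat) (x : 'rV[R]_d) :
  enorm x <= \sum_(i < d) `|x ord0 i|.
Proof.
rewrite -(@ler_pXn2r _ 2)// ?nnegrE ?enorm_ge0 ?sumr_ge0// enorm_sqr /dot expr2 big_distrl/=.
apply: ler_sum => i _; rewrite -expr2 -[leLHS]real_normK ?num_real// expr2.
by rewrite ler_wpM2l// (bigD1 i)//= lerDl sumr_ge0.
Qed.

(** * Boundary charts and their flattened form *)

Section taylor.
Context {R : realType} {p : nat}.
Notation V_ := 'rV[R]_p.
Variables (phi : V_ -> R) (V : set V_).

Definition grad (u : V_) : V_ := \row_j 'D_(delta_mx ord0 j) phi u.

Lemma derive_grad u w : differentiable phi u -> 'D_w phi u = dot w (grad u).
Proof.
move=> du; rewrite deriveE// [in LHS](matrix_sum_delta w) big_ord1 linear_sum.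
apply: eq_bigr => j _; rewrite linearZ /= /grad mxE deriveE//.
Qed.

Lemma segment_mvt u w : (forall t, 0 <= t <= 1 -> differentiable phi (u + t *: w)) ->
  exists2 t, 0 <= t <= 1 & phi (u + w) - phi u = dot w (grad (u + t *: w)).
Proof.
move=> dphi; pose g (t : R) := phi (u + t *: w).
have dg (t : R) : 0 <= t <= 1 -> is_derive t (1 : R) g (dot w (grad (u + t *: w))).
  move=> t01; have dt := dphi t t01.
  rewrite -(derive_grad w dt).
  have qE : (fun h : R => h^-1 *: (g (h *: (1 : R) + t) - g t)) =
      (fun h => h^-1 *: (phi (h *: w + (u + t *: w)) - phi (u + t *: w))).
    apply/funext => h; rewrite /g scalerDl [h *: 1]mulr1; congr (_ *: (phi _ - _)).
    by rewrite addrCA.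
  have := @diff_derivable _ _ _ _ _ w dt; rewrite /derivable -qE => dg.
  by apply: DeriveDef => //; rewrite /derive qE.
have [||t t01] := @MVT R g (fun t => dot w (grad (u + t *: w))) 0 1 ltr01.
- move=> t; rewrite in_itv/= => /andP[t0 t1]; apply: dg; lra.
- apply: derivable_within_continuous => t; rewrite in_itv/= => t01.
  by have [] := dg t t01.
rewrite /g scale1r scale0r addr0 subr0 mulr1 => gE; exists t => //.
by move: t01; rewrite in_itv/= => /andP[t0 t1]; lra.
Qed.

(** Lipschitz partial derivatives make the gradient Lipschitz; the mean value theorem on the segment
    then bounds the remainder by [L |v - u|^2]. The factor 1/2 of Taylor's formula is immaterial. *)
Lemma C11_taylor u0 : open V -> C11_on phi V -> V u0 ->
  exists rL : R * (R * R), [/\ 0 < rL.1, 0 <= rL.2.1, 0 <= rL.2.2,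
    (forall u, enorm (u - u0) < rL.1 -> V u) &
    forall u v, enorm (u - u0) < rL.1 -> enorm (v - u0) < rL.1 ->
      `|phi v - phi u - dot (v - u) (grad u)| <= rL.2.1 * enorm (v - u) ^+ 2 /\
      `|phi v - phi u| <= rL.2.2 * enorm (v - u)].
Proof.
move=> oV [dphi lip] Vu0.
have [rho rho0 HV] : exists2 e : R, 0 < e & forall u, enorm (u - u0) < e -> V u.
  by apply/nbhs_enormP; exact: open_nbhs_nbhs.
have /choice[Lj HL] := lip.
pose L : R := \sum_j `|Lj j|; have L0 : 0 <= L by rewrite sumr_ge0.
have gradL u v : V u -> V v -> enorm (grad u - grad v) <= L * enorm (u - v).
  move=> Vu Vv; apply: le_trans (enorm_le_sum _) _; rewrite /L mulr_suml.
  apply: ler_sum => j _; rewrite !mxE; apply: le_trans (HL j u v Vu Vv) _.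
  by rewrite ler_wpM2r ?enorm_ge0// ler_norm.
pose K : R := enorm (grad u0) + L * rho.
have K0 : 0 <= K by rewrite addr_ge0 ?enorm_ge0// mulr_ge0// ltW.
exists (rho, (L, K)); split => //= u v ur vr.
have seg t : 0 <= t <= 1 -> enorm (u + t *: (v - u) - u0) < rho.
  move=> /andP[t0 t1].
  rewrite (_ : _ - u0 = (1 - t) *: (u - u0) + t *: (v - u0)).
    apply: le_lt_trans (enormD _ _) _; rewrite !enormZ !ger0_norm//; [|lra].
    have : (1 - t) * enorm (u - u0) + t * enorm (v - u0) <=
       Num.max (enorm (u - u0)) (enorm (v - u0)).
      have m1 : enorm (u - u0) <= Num.max (enorm (u - u0)) (enorm (v - u0)) by rewrite le_max lexx.
      have m2 : enorm (v - u0) <= Num.max (enorm (u - u0)) (enorm (v - u0)) by rewrite le_max lexx orbT.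
      nra.
    by move=> /le_lt_trans; apply; rewrite gt_max ur vr.
  by apply/rowP => i; rewrite !mxE; lra.
have [t t01] := segment_mvt (w := v - u) (fun t t01 => dphi _ (HV _ (seg t t01))).
rewrite (_ : u + (v - u) = v); last by rewrite addrC subrK.
move=> ->; have w0 := enorm_ge0 (v - u); split.
  rewrite -dotBr; apply: le_trans (cauchy_schwarz _ _) _; rewrite expr2 mulrCA ler_wpM2l//.
  apply: le_trans (gradL _ _ (HV _ (seg t t01)) (HV _ ur)) _; rewrite ler_wpM2l//.
  rewrite addrC addKr enormZ; move: t01 => /andP[t0 t1]; rewrite ger0_norm//.
  by rewrite ler_piMl.
apply: le_trans (cauchy_schwarz _ _) _; rewrite mulrC ler_wpM2r//.
have := gradL _ _ (HV _ (seg t t01)) Vu0 => h.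
rewrite -(subrK (grad u0) (grad _)); apply: le_trans (enormD _ _) _.
rewrite addrC lerD2l; apply: le_trans h _; rewrite ler_wpM2l// ltW//; exact: seg.
Qed.

End taylor.

Section flattened.
Context {R : realType} {d : nat}.

(* After the rotation of the boundary chart, [h y] is the last coordinate of [y] minus [phi] of
   the others, and [e] is the last basis vector. The form is symmetric in the two sides of the
   boundary, and covers the end points of an interval. *)
Definition flattened (A : set 'rV[R]_d) (x0 : 'rV[R]_d) : Prop :=
  exists (h : 'rV[R]_d -> R) (e : 'rV[R]_d) (r L : R),
    [/\ 0 < r, 0 <= L, enorm e = 1, forall z t, h (z + t *: e) = h z + t &
    forall z, enorm (z - x0) < r -> (boundary A z <-> h z = 0) /\
      exists2 w, 1 <= enorm w & forall y, enorm (y - x0) < r ->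
        `|h y - h z| <= L * enorm (y - z) /\
        `|h y - h z - dot (y - z) w| <= L * enorm (y - z) ^+ 2].

End flattened.

Lemma dot_mulmx (R : realType) d (Q : 'M[R]_d) (x y : 'rV[R]_d) :
  dot (x *m Q) y = dot x (y *m Q^T).
Proof.
have dE (a b : 'rV[R]_d) : dot a b = (a *m b^T) ord0 ord0.
  by rewrite mxE; apply: eq_bigr => i _; rewrite mxE.
by rewrite !dE trmx_mul trmxK mulmxA.
Qed.

Lemma enorm_orthogonal (R : realType) d (Q : 'M[R]_d) (x : 'rV[R]_d) :
  Q *m Q^T = 1%:M -> enorm (x *m Q) = enorm x.
Proof.
move=> QQ; apply/eqP; rewrite -(@eqrXn2 _ 2)// ?enorm_ge0// !enorm_sqr.
by rewrite dot_mulmx -mulmxA QQ mulmx1.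
Qed.

Lemma enorm_col' (R : realType) p (x : 'rV[R]_p.+1) : enorm (col' ord_max x) <= enorm x.
Proof.
rewrite ler_sqrt ?sumr_ge0// => [|i _]; last exact: sqr_ge0.
rewrite [leRHS](bigD1_ord ord_max)//= ler_wpDl ?sqr_ge0//.
by apply: ler_sum => i _; rewrite mxE.
Qed.

Lemma dot_col' (R : realType) p (x : 'rV[R]_p.+1) (g : 'rV[R]_p) :
  dot (col' ord_max x) g =
  dot x (\row_i if unlift ord_max i is Some j then g ord0 j else 0).
Proof.
rewrite /dot [RHS](bigD1_ord ord_max)//= mxE unlift_none mulr0 add0r.
by apply: eq_bigr => i _; rewrite !mxE liftK.
Qed.

Lemma C11_flattened (R : realType) p (A : set 'rV[R]_p.+1) x0 :
  C11_boundary A -> boundary A x0 -> flattened A x0.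
Proof.
move=> HA bx0; have [U [Q [V [phi [nU [QQ _] oV phiC QE]]]]] := HA x0 bx0.
have QQ' : Q^T *m Q = 1%:M by exact: mulmx1C.
pose c (z : 'rV[R]_p.+1) := col' ord_max (z *m Q).
(* The chart is given as an equality of image sets; the injectivity of the rotation makes it
   pointwise. *)
have QP z : U z -> boundary A z <-> V (c z) /\ (z *m Q) ord0 ord_max = phi (c z).
  move=> Uz; split=> [bz|[Vz zE]].
    have : [set y *m Q | y in boundary A `&` U] (z *m Q) by exists z.
    rewrite QE => -[i [ip Vi iE]].
    by have im : i = ord_max by [apply/val_inj; case: ip]; subst i.
  have : last_coord_graph phi V (z *m Q) by exists ord_max.
  rewrite -QE => -[y [by_ Uy] yz].
  by rewrite -(mulmx1 z) -QQ mulmxA -yz -mulmxA QQ mulmx1.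
have [|[rho [L K]] /= [rho0 L0 K0 HV HT]] := @C11_taylor R p phi V (c x0) oV phiC.
  by have [/(_ bx0)[]] := QP x0 (nbhs_singleton nU).
have [R1 R10 HU] : exists2 e : R, 0 < e & forall u, enorm (u - x0) < e -> U u by apply/nbhs_enormP.
have cB y z : enorm (c y - c z) <= enorm (y - z).
  rewrite /c -(enorm_orthogonal (y - z) QQ) mulmxBl; apply: le_trans (enorm_col' _).
  rewrite (_ : col' _ _ - _ = col' ord_max (y *m Q - z *m Q))//.
  by apply/rowP => i; rewrite !mxE.
pose ep : 'rV[R]_p.+1 := delta_mx ord0 ord_max.
have epQ : enorm (ep *m Q^T) = 1.
  rewrite enorm_orthogonal ?trmxK//; apply/eqP; rewrite -(@eqrXn2 _ 2)// ?enorm_ge0// expr1n enorm_sqr.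
  rewrite /dot (bigD1 ord_max)//= !mxE !eqxx mulr1 big1 ?addr0// => i /negbTE im.
  by rewrite !mxE im andbF mulr0.
exists (fun z => (z *m Q) ord0 ord_max - phi (c z)), (ep *m Q^T), (Num.min R1 rho), (Num.max (1 + K) L).
split => //.
- by rewrite lt_min R10.
- by rewrite le_max L0 orbT.
- move=> z t; have cz : c (z + t *: (ep *m Q^T)) = c z.
    rewrite /c mulmxDl -scalemxAl -mulmxA QQ' mulmx1; apply/rowP => i; rewrite !mxE eqxx/=.
    by rewrite eq_sym (negbTE (neq_lift _ _)) mulr0 addr0.
  by rewrite cz mulmxDl -scalemxAl -mulmxA QQ' mulmx1 !mxE !eqxx mulr1 addrAC.
move=> z; rewrite lt_min => /andP[zR1 zrho].
have crho y : enorm (y - x0) < rho -> enorm (c y - c x0) < rho by exact: le_lt_trans.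
split.
  rewrite (QP z (HU _ zR1)); split=> [[_ ->]|/eqP]; first exact: subrr.
  by rewrite subr_eq0 => /eqP ->; split => //; exact/HV/crho.
(* The gradient of [phi] extended by 0. The gradient of [h], in rotated coordinates, is [ep - w0];
   its last coordinate is 1, whence the lower bound on its norm. *)
pose w0 : 'rV[R]_p.+1 := \row_i if unlift ord_max i is Some j then (grad phi (c z)) ord0 j else 0.
exists ((ep - w0) *m Q^T).
  rewrite enorm_orthogonal ?trmxK//; apply: le_trans (coord_le_enorm _ ord_max).
  by rewrite !mxE !eqxx unlift_none subr0 normr1.
move=> y; rewrite lt_min => /andP[yR1 yrho].
have [T1 T2] := HT (c z) (c y) (crho _ zrho) (crho _ yrho).
have yz0 := enorm_ge0 (y - z).
have lastE : (y *m Q) ord0 ord_max - (z *m Q) ord0 ord_max = ((y - z) *m Q) ord0 ord_max.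
  by rewrite mulmxBl !mxE.
split.
  rewrite opprB [_ - (z *m Q) _ _]addrC addrACA lastE.
  apply: le_trans (ler_normD _ _) _.
  apply: (@le_trans _ _ (enorm (y - z) + K * enorm (y - z))).
    apply: lerD.
      by rewrite -(enorm_orthogonal (y - z) QQ); exact: coord_le_enorm.
    rewrite addrC distrC; apply: le_trans T2 _; rewrite ler_wpM2l//.
  by rewrite -{1}(mul1r (enorm _)) -mulrDl ler_wpM2r// le_max lexx.
rewrite -dot_mulmx dotBr -dot_col'.
have -> : dot ((y - z) *m Q) ep = ((y - z) *m Q) ord0 ord_max.
  rewrite /dot (bigD1 ord_max)//= /ep [X in _ * X]mxE !eqxx mulr1 big1 ?addr0// => i /negbTE im.
  by rewrite [X in _ * X]mxE im andbF mulr0.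
rewrite -lastE.
have -> : col' ord_max ((y - z) *m Q) = c y - c z.
  by rewrite /c mulmxBl; apply/rowP => i; rewrite !mxE.
set a := (y *m Q) _ _; set b := (z *m Q) _ _; set D := dot _ _ in T1 *.
rewrite (_ : a - _ - _ - _ = - (phi (c y) - phi (c z) - D)); last by lra.
rewrite normrN; apply: le_trans T1 _; apply: ler_pM => //; rewrite ?sqr_ge0//.
  by rewrite le_max lexx orbT.
by rewrite ler_pXn2r ?nnegrE ?enorm_ge0.
Qed.

Lemma enorm1E (R : realType) (z : 'rV[R]_1) : enorm z = `|z ord0 ord0|.
Proof. by rewrite /enorm big_ord_recl big_ord0 addr0 sqrtr_sqr. Qed.

(** No boundary point lies strictly between [p] and [q], and [A] has at most one on each side. Two
    of them are thus at least [q - p] apart, so that [x0] is alone within this radius and [h] can be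
    the signed distance to it. *)
Lemma interval_flattened (R : realType) (A : set 'rV[R]_1) p q x0 :
  interval1 A -> closed A -> A p -> A q -> p ord0 ord0 < q ord0 ord0 ->
  boundary A x0 -> flattened A x0.
Proof.
move=> [I intI AI] cA Ap Aq pq bx0; pose z1 (z : 'rV[R]_1) := z ord0 ord0.
have AE z : A z = I (z1 z).
  by rewrite AI; apply/propext; split=> /= [/(_ ord0)//|Iz i]; rewrite (ord1 i).
have bA z : boundary A z -> A z by move=> [+ _]; rewrite -(proj1 (closure_id A) cA).
have inner a b z : A a -> A b -> z1 a < z1 z -> z1 z < z1 b -> ~ boundary A z.
  move=> Aa Ab az zb [_]; apply.
  apply/nbhs_enormP; exists (Num.min (z1 z - z1 a) (z1 b - z1 z)).
    by rewrite lt_min !subr_gt0 az.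
  move=> y; rewrite enorm1E !mxE lt_min !ltr_distl => /andP[/andP[y1 y2] /andP[y3 y4]].
  rewrite AE in Aa; rewrite AE in Ab; rewrite AE; apply: (intI _ _ Aa Ab).
  by rewrite /z1 in az zb y1 y2 y3 y4 *; apply/andP; split; lra.
have side z : boundary A z -> z1 z <= z1 p \/ z1 q <= z1 z.
  move=> bz; case: (leP (z1 z) (z1 p)) => [|pz]; first by left.
  by case: (leP (z1 q) (z1 z)) => [|zq]; [right|have /(_ bz) := inner _ _ z Ap Aq pz zq].
have uniq_boundary z : enorm (z - x0) < z1 q - z1 p -> boundary A z -> z1 z = z1 x0.
  rewrite enorm1E !mxE ltr_distl => /andP[zl zr] bz.
  have nlt y y' : boundary A y -> boundary A y' -> z1 y < z1 y' -> z1 y' <= z1 p -> False.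
    by move=> b b' yy' yp; apply: (inner y q y' (bA _ b) Aq yy' _ b'); exact: le_lt_trans yp pq.
  have ngt y y' : boundary A y -> boundary A y' -> z1 y < z1 y' -> z1 q <= z1 y -> False.
    by move=> b b' yy' yp; apply: (inner p y' y Ap (bA _ b') _ yy' b); exact: lt_le_trans pq yp.
  rewrite /z1 in pq zl zr *.
  case: (side z bz); case: (side x0 bx0) => hx hz; rewrite /z1 in hx hz.
  - by case: (ltgtP (z1 z) (z1 x0)) => // h; [case: (nlt z x0)|case: (nlt x0 z)].
  - lra.
  - lra.
  - by case: (ltgtP (z1 z) (z1 x0)) => // h; [case: (ngt z x0)|case: (ngt x0 z)].
have n1 : enorm (const_mx 1 : 'rV[R]_1) = 1 by rewrite enorm1E mxE normr1.
exists (fun z => z1 z - z1 x0), (const_mx 1), (z1 q - z1 p), 1; split => //.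
- by rewrite subr_gt0.
- by move=> z t; rewrite /z1 !mxE; lra.
move=> z zr; split.
  split=> [bz|/eqP]; first by rewrite (uniq_boundary z)// subrr.
  rewrite subr_eq0 => /eqP zx; rewrite (_ : z = x0)//.
  by apply/rowP => i; rewrite (ord1 i).
exists (const_mx 1); first by rewrite n1.
move=> y _; rewrite !mul1r (_ : _ - _ - _ = z1 y - z1 z); last by lra.
split; first by rewrite enorm1E !mxE.
rewrite (_ : dot _ _ = z1 y - z1 z) ?subrr ?normr0 ?sqr_ge0//.
by rewrite /dot big_ord_recl big_ord0 addr0 !mxE mulr1.
Qed.

(** * Paths off the boundary, and induction over a compact set *)

Section interior_paths.
Context {R : realType} {d : nat}.
Implicit Types (A : set 'rV[R]_d) (x y z : 'rV[R]_d).

(** On a segment that avoids the boundary, [A°] and the closed set [A] cut out the same parameters,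
    which therefore form an open and closed part of [[0, 1]]. This replaces any knowledge of the
    side on which [A] lies. *)
Lemma segment_interior A x y : closed A ->
  (forall t, 0 <= t <= 1 -> ~ boundary A (x + t *: (y - x))) -> A° x -> A° y.
Proof.
move=> cA nb Ax; pose g (t : R) := x + t *: (y - x).
have cg : continuous g.
  move=> t; apply: cvgD; first exact: cvg_cst.
  by apply: cvgZr_tmp; exact: cvg_id.
have AD t : 0 <= t <= 1 -> A (g t) -> A° (g t).
  move=> t01 At; apply: contrapT => nA; apply: (nb t t01); split => //.
  exact: subset_closure.
pose B : set R := `[0, 1]%classic `&` (g @^-1` A°).
have BE : B = `[0, 1]%classic.
  apply: (@segment_connected R 0 1).
  - exists 0; split; first by rewrite /= in_itv/= lexx ler01.
    by rewrite /= /g scale0r addr0.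
  - exists (g @^-1` A°) => //; apply: open_comp; first by move=> t _; exact: cg.
    exact: open_interior.
  - exists (g @^-1` A).
      by apply: closed_comp => // t _; exact: cg.
    apply/seteqP; split=> t [t01 At]; split=> //.
      exact: interior_subset At.
    by apply: AD => //; move: t01; rewrite /= in_itv.
have : B 1 by rewrite BE /= in_itv/= lexx ler01.
by case=> _; rewrite /= /g scale1r addrC subrK.
Qed.

End interior_paths.

(** If [K] were not good, the sets outside which [K] is good would form a proper filter containing
    [K]; it would cluster at a point of [K], against local goodness there. *)
Lemma compact_ind (T : topologicalType) (K : set T) (good : set T -> Prop) :
  compact K -> good set0 ->
  (forall U V, U `<=` V -> good V -> good U) ->
  (forall U V, good U -> good V -> good (U `|` V)) ->
  (forall x, K x -> exists2 U, nbhs x U & good (K `&` U)) -> good K.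
Proof.
move=> cK g0 gS gU gloc; apply: contrapT => nK.
pose F := [set W | good (K `\` W)].
have FF : Filter F.
  split.
  - by rewrite /F /= setDT.
  - move=> U V gU' gV; rewrite /F /= setDIr; exact: gU.
  - by move=> U V UV; apply: gS => x [Kx Vx]; split=> // /UV.
have FK : F K by rewrite /F /= setDv.
have PF : ProperFilter F.
  by split => //; rewrite /F /= setD0.
have [x [Kx cx]] := cK F PF FK.
have [U nU gKU] := gloc x Kx.
have FU : F (~` U) by rewrite /F /= setDE setCK.
by have [y [ny Uy]] := cx _ _ FU nU.
Qed.

Lemma sume_ord_const (R : realType) (c : \bar R) N : (0 <= c)%E ->
  (\sum_(i < N) c = N%:R%:E * c)%E.
Proof.
move=> c0; elim: N => [|N IH]; first by rewrite big_ord0 mul0e.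
by rewrite big_ord_recr IH/= -natr1 EFinD ge0_muleDl ?lee_fin// mul1e.
Qed.

(** * Tubes around the boundary *)

Section tubes.
Context {R : realType} {d : nat}.
Implicit Types (A B S : set 'rV[R]_d).

Lemma vol_translate S v : measurable S -> vol d [set x | S (x - v)] = vol d S.
Proof.
move=> mS; have := int_subst_measure (vol_affine (- v) (oner_neq0 R)) mS.
rewrite normr1 invr1 expr1n mul1e => <-; congr (vol d _).
by apply/seteqP; split=> x /=; rewrite scale1r.
Qed.

Lemma measurable_translate S v : measurable S -> measurable [set x | S (x - v)].
Proof.
move=> mS; rewrite -[X in measurable X]setTI.
have mf : measurable_fun setT (fun x : 'rV[R]_d => x - v).
  by apply: measurable_rVB; [exact: measurable_id|exact: measurable_cst].
exact: mf.
Qed.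

(** Disjoint translates of [S] inside [B] share its volume. Tubes and slabs are both measured in
    this way, without adapted coordinates. *)
Lemma packing S B (v : nat -> 'rV[R]_d) (N : nat) : measurable S -> measurable B ->
  (forall i j x, S (x - v i) -> S (x - v j) -> i = j) ->
  (forall i x, (i < N)%N -> S x -> B (x + v i)) ->
  (N%:R%:E * vol d S <= vol d B)%E.
Proof.
move=> mS mB inj sub; pose F i := [set x | S (x - v i)].
have mF i : measurable (F i) by exact: measurable_translate.
have tF : trivIset setT F.
  by apply/trivIsetP => i j _ _ /eqP ij; apply/seteqP; split=> x //= [Si Sj]; exact/ij/(inj _ _ x).
apply: (@le_trans _ _ (vol d (\big[setU/set0]_(i < N) F i))).
  rewrite measure_bigsetU//=.
  under eq_bigr do rewrite vol_translate//.
  by rewrite sume_ord_const.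
apply: le_measure; rewrite ?inE//; first exact: bigsetU_measurable.
move=> x; rewrite -bigcup_mkord => -[i /= iN Fi].
by rewrite -(subrK (v i) x); exact: sub.
Qed.

(** The strict inequality makes a tube open, hence measurable for every [B]. *)
Definition tube B s : set 'rV[R]_d := [set x | exists2 z, B z & enorm (x - z) < s].

Lemma open_tube B s : open (tube B s).
Proof.
rewrite (_ : tube B s = \bigcup_(z in B) [set x | enorm (x - z) < s]).
  by apply: bigcup_open => z _; exact: open_eball_lt.
by apply/seteqP; split=> x [z Bz xz]; exists z.
Qed.

Lemma measurable_tube B s : measurable (tube B s).
Proof. by apply: open_measurable_rV; exact: open_tube. Qed.

(* About [1 / s] translates of the tube along [e] are disjoint, since [h] separates them, and stay
   in a fixed ball. *)
Lemma vol_tube_flattened A x0 : flattened A x0 ->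
  exists2 U, nbhs x0 U & exists C s0 : R, [/\ 0 <= C, 0 < s0 &
    forall s, 0 < s < s0 -> (vol d (tube (boundary A `&` U) s) <= (C * s)%:E)%E].
Proof.
move=> [h [e [r [L [r0 L0 e1 he hB]]]]].
exists [set x | enorm (x - x0) < r / 2].
  by apply/nbhs_enormP; exists (r / 2) => //; rewrite divr_gt0.
(* The translations have length at most [3 (L + 1) (1 + s)], and [s < 1]. *)
pose rho := r + 6 * (L + 1).
have rho0 : 0 < rho by rewrite addr_gt0// mulr_gt0// ltr_wpDl.
exists (rho ^+ d * theta d), (Num.min (r / 2) 1); split.
- by rewrite mulr_ge0 ?exprn_ge0 ?ltW// theta_gt0.
- by rewrite lt_min divr_gt0//= ltr01.
move=> s /andP[s0]; rewrite lt_min => /andP[sr s1].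
pose T := tube (boundary A `&` [set x | enorm (x - x0) < r / 2]) s.
have TP x : T x -> enorm (x - x0) < r /\ `|h x| <= L * s.
  move=> [z [bz zx0] xz].
  have xr : enorm (x - x0) < r by apply: le_lt_trans (enormB_le _ z _) _; rewrite /= in zx0; lra.
  have zr : enorm (z - x0) < r by apply: lt_trans zx0 _; rewrite ltr_pdivrMr// mulr_natr mulr2n ltrDl.
  split=> //; have [[hz _] [w _ /(_ x xr)[hx _]]] := hB z zr.
  move: hx; rewrite (hz bz) subr0 => /le_trans; apply; rewrite ler_wpM2l// ltW//.
(* On the tube [|h| <= L * s], so steps of [3 (L + 1) s] exceed the range of [h] and separate the
   translates. *)
pose v (i : nat) : 'rV[R]_d := (3 * (L + 1) * s * i%:R) *: e.
have := @packing T (eball x0 rho) v (Num.truncn s^-1).+1 (measurable_tube _ _) (measurable_eball _ _).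
have a0 : 0 < 3 * (L + 1) * s by rewrite mulr_gt0// mulr_gt0// ltr_wpDl.
have e0 : 0 <= (L + 1) * s by rewrite mulr_ge0// ?addr_ge0// ltW.
have /andP[trl trr] := @Num.Theory.truncn_itv R s^-1 ltac:(by rewrite invr_ge0 ltW).
have Ns : (Num.truncn s^-1).+1%:R * s <= 1 + s.
  rewrite -natr1 mulrDl mul1r lerD2r; move: trl; rewrite -(ler_pM2r s0) mulVf//.
  by rewrite gt_eqF.
have hv i x : h (x - v i) = h x - 3 * (L + 1) * s * i%:R by rewrite /v -scaleNr he.
have lt i j x : T (x - v i) -> T (x - v j) -> ~ (i < j)%N.
  move=> /TP[_ +] /TP[_ +] ij; have {}ij : i%:R + 1 <= j%:R :> R by rewrite natr1 ler_nat.
  rewrite !hv !ler_norml => /andP[h1 h2] /andP[h3 h4].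
  have := ler_wpM2l (ltW a0) ij; have := mulr_ge0 L0 (ltW s0); nra.
have inj i j x : T (x - v i) -> T (x - v j) -> i = j.
  by move=> Ti Tj; case: (ltngtP i j) => // ij; [case: (lt i j x)|case: (lt j i x)].
move=> /(_ inj){inj} P0.
have sub i x : (i < (Num.truncn s^-1).+1)%N -> T x -> eball x0 rho (x + v i).
  move=> iN /TP[xr _]; rewrite /eball /= addrAC; apply: le_trans (enormD _ _) _.
  rewrite /v enormZ e1 mulr1 ger0_norm; last by rewrite mulr_ge0// ltW.
  have : 3 * (L + 1) * s * i%:R <= 3 * (L + 1) * (1 + s).
    rewrite -mulrA ler_wpM2l//; first by rewrite mulr_ge0// addr_ge0.
    by rewrite mulrC; apply: le_trans Ns; rewrite ler_wpM2r ?(ltW s0)// ler_nat ltnW.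
  rewrite /rho; nra.
move: P0 => /(_ sub).
have TB : (vol d T <= (rho ^+ d * theta d)%:E)%E.
  rewrite -(vol_eball x0 rho0); apply: le_measure; rewrite ?inE; [exact: measurable_tube|exact: measurable_eball|].
  move=> x /TP[xr _]; rewrite /eball/=; apply: (le_trans (ltW xr)).
  by rewrite /rho lerDl mulr_ge0// addr_ge0.
rewrite vol_eball// -/T.
have [t t0 ->] : exists2 t, 0 <= t & vol d T = t%:E.
  exists (fine (vol d T)); first by rewrite fine_ge0.
  rewrite fineK// ge0_fin_numE//.
  exact: le_lt_trans TB (ltry _).
rewrite -EFinM !lee_fin => NT.
rewrite -ler_pdivrMr//; apply: le_trans NT; rewrite mulrC ler_wpM2r// ltW//.
Qed.

Definition thin B := exists C s0 : R, [/\ 0 <= C, 0 < s0 &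
    forall s, 0 < s < s0 -> (vol d (tube B s) <= (C * s)%:E)%E].

Lemma thin_boundary A : compact A -> (forall x, boundary A x -> flattened A x) ->
  thin (boundary A).
Proof.
move=> cA fA; have clA : closed A by apply: compact_closed => //; exact: norm_hausdorff.
have cb : compact (boundary A).
  apply: (subclosed_compact _ cA); last by move=> x [+ _]; rewrite -(proj1 (closure_id A) clA).
  rewrite /boundary setDE; apply: closedI; first exact: closed_closure.
  exact/open_closedC/open_interior.
apply: (compact_ind cb).
- exists 0, 1; split => // s _; rewrite mul0r (_ : tube _ _ = set0) ?measure0//.
  by apply/seteqP; split => x // [].
- move=> U V UV [C [s0 [C0 s00 H]]]; exists C, s0; split => // s /H; apply: le_trans.
  by apply: le_measure; rewrite ?inE; [exact: measurable_tube..|move=> x [z /UV Vz xz]; exists z].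
- move=> U V [C [s0 [C0 s00 H]]] [C' [s0' [C0' s00' H']]].
  exists (C + C'), (Num.min s0 s0'); split; [exact: addr_ge0|by rewrite lt_min s00|].
  move=> s /andP[s1]; rewrite lt_min => /andP[s2 s3].
  have -> : tube (U `|` V) s = tube U s `|` tube V s.
    apply/seteqP; split=> [x [z [Uz|Vz] xz]|x [] [z Uz xz]]; [by left; exists z|by right; exists z| |].
      by exists z => //; left.
    by exists z => //; right.
  apply: (le_trans (measureU2 _ (measurable_tube _ _) (measurable_tube _ _))).
  by rewrite mulrDl EFinD leeD// ?H ?H' ?s1.
- by move=> x /fA; exact: vol_tube_flattened.
Qed.

Lemma thin_null B : thin B -> measurable B -> vol d B = 0%E.
Proof.
move=> [C [s0 [C0 s00 H]]] mB; apply/eqP; rewrite eq_le measure_ge0 andbT.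
apply/lee_addgt0Pr => e e0; rewrite add0e.
pose s := Num.min (s0 / 2) (e / (C + 1)).
have sP : 0 < s < s0.
  rewrite lt_min !divr_gt0 ?ltr_wpDl//= gt_min; apply/orP; left.
  by rewrite ltr_pdivrMr// mulr_natr mulr2n ltrDl.
apply: (@le_trans _ _ (vol d (tube B s))).
  apply: le_measure; rewrite ?inE//; first exact: measurable_tube.
  by move=> x Bx; exists x => //; rewrite subrr enorm0; case/andP: sP.
apply: le_trans (H s sP) _; rewrite lee_fin.
apply: (@le_trans _ _ (C * (e / (C + 1)))); first by rewrite ler_wpM2l// ge_min lexx orbT.
rewrite mulrCA ler_piMr ?(ltW e0)// ler_pdivrMr ?ltr_wpDl// mul1r lerDl//.
Qed.

(** A boundary point on a segment from [x] into the ball would be within [s], hence strictly within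
    [2 * s], of [x]; the factor 2 reconciles the closed ball with the open tube. *)
Lemma eball_interior A s x : closed A -> A° x -> ~ tube (boundary A) (2 * s) x ->
  0 < s -> eball x s `<=` A°.
Proof.
move=> clA Ax ntx s0 y xy; apply: (segment_interior clA _ Ax) => t /andP[t0 t1] bt.
apply: ntx; exists (x + t *: (y - x)) => //.
rewrite opprD addrA subrr sub0r enormN enormZ ger0_norm//.
move: xy; rewrite /eball/= => xy; have := enorm_ge0 (y - x); nra.
Qed.

End tubes.

(** * Half-balls inside the set *)

Section half_ball.
Context {R : realType} {d : nat}.
Implicit Types (A B S : set 'rV[R]_d).

(* The polygon [x, x + H e, y + H e, y] stays in [h > 0], hence off the boundary. *)
Lemma half_ball_above A (h : 'rV[R]_d -> R) e x0 r L w s x :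
  closed A -> 0 < s -> 0 <= L -> enorm e = 1 ->
  (forall z t, 0 <= t -> h (z + t *: e) = h z + t) ->
  (forall z, enorm (z - x0) < r -> boundary A z -> h z = 0) ->
  (forall y, enorm (y - x0) < r -> `|h y - h x| <= L * enorm (y - x) /\
        `|h y - h x - dot (y - x) w| <= L * enorm (y - x) ^+ 2) ->
  enorm (x - x0) + (L + 2) * s < r -> A° x -> 0 < h x ->
  forall y, enorm (y - x) <= s -> L * s ^+ 2 <= dot (y - x) w -> A° y.
Proof.
move=> clA s0 L0 e1 he hb hB xr Ax hx y yx yw.
(* Within [s] of [x] the function [h] drops by at most [L * s], so raising by [H] keeps it positive
   all along the upper side; the path stays within [s + H = (L + 2) s] of [x]. *)
have [H HE] : exists H, H = (L + 1) * s by eexists.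
have H0 : 0 <= H by rewrite HE mulr_ge0 ?addr_ge0 ?(ltW s0).
have stay u v : (forall t, 0 <= t <= 1 -> enorm (u + t *: (v - u) - x) <= (L + 2) * s /\
    0 < h (u + t *: (v - u))) -> A° u -> A° v.
  move=> Huv; apply: segment_interior => // t t01 bt; have [tx ht] := Huv t t01.
  move: ht; rewrite hb ?ltxx//; apply: le_lt_trans (enormB_le _ x _) _.
  by rewrite addrC; apply: le_lt_trans xr; rewrite lerD2l.
have zr z : enorm (z - x) <= s -> enorm (z - x0) < r.
  move=> zx; apply: le_lt_trans (enormB_le _ x _) _; apply: le_lt_trans xr.
  by rewrite addrC lerD2l; apply: le_trans zx _; rewrite ler_peMl ?(ltW s0)// ; lra.
have yz0 := enorm_ge0 (y - x).
have hy : 0 < h y.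
  have [_] := hB y (zr y yx); rewrite ler_norml => /andP[hh _].
  have : L * enorm (y - x) ^+ 2 <= L * s ^+ 2 by rewrite ler_wpM2l// ler_pXn2r// nnegrE// ltW.
  lra.
have up u : A° u -> enorm (u - x) <= s -> 0 < h u -> A° (u + H *: e).
  move=> Au ux hu; apply: (stay u) => // t /andP[t0 t1].
  rewrite [u + H *: e - u]addrAC subrr add0r scalerA he ?mulr_ge0//; split; last by rewrite ltr_wpDr ?mulr_ge0.
  rewrite addrAC; apply: le_trans (enormD _ _) _; rewrite enormZ e1 mulr1 ger0_norm ?mulr_ge0//.
  have := ler_wpM2r H0 t1; rewrite mul1r HE => h1; nra.
have AxH : A° (x + H *: e) by apply: up => //; rewrite subrr enorm0 ltW.
have AyH : A° (y + H *: e).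
  apply: (stay (x + H *: e)) => // t /andP[t0 t1].
  rewrite (_ : x + H *: e + _ *: _ = x + t *: (y - x) + H *: e); last first.
    by apply/rowP => i; rewrite !mxE; lra.
  have tx : enorm (x + t *: (y - x) - x) <= enorm (y - x).
    by rewrite [x + _]addrC addrK enormZ ger0_norm// ler_piMl.
  split.
    rewrite addrAC; apply: le_trans (enormD _ _) _; rewrite enormZ e1 mulr1 ger0_norm//.
    by rewrite HE; lra.
  rewrite he//; have [+ _] := hB _ (zr _ (le_trans tx yx)); rewrite ler_norml => /andP[h1 _].
  have := ler_wpM2l L0 (le_trans tx yx); rewrite HE; lra.
apply: (stay (y + H *: e)) => // t /andP[t0 t1].
rewrite (_ : y + H *: e + _ *: _ = y + ((1 - t) * H) *: e); last first.
  by apply/rowP => i; rewrite !mxE; lra.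
have t1' : 0 <= 1 - t by lra.
rewrite he ?mulr_ge0//; split; last by rewrite ltr_wpDr ?mulr_ge0.
rewrite addrAC; apply: le_trans (enormD _ _) _; rewrite enormZ e1 mulr1 ger0_norm ?mulr_ge0//.
have : (1 - t) * H <= H by rewrite ler_piMl//; lra.
rewrite HE; lra.
Qed.

End half_ball.

Section half_ball_uniform.
Context {R : realType} {p : nat}.
Notation d := p.+1.
Implicit Types (A B S : set 'rV[R]_d).

(** The vector [v] need not be a unit vector: norm at least 1 already makes the slab [|z.v| <= eta]
    thin. *)
Definition half_ball_at A eta s x := exists2 v, 1 <= enorm v &
  forall y, enorm (y - x) <= s -> dot (y - x) v < - (eta * s) -> A° y.

(** An interior point is off the boundary, so the sign of [h x] tells where the half-ball lies;
    [h x < 0] reduces to [h x > 0] by negating [h], [e] and [w]. For small [s] the gap [eta * s]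
    absorbs the quadratic error [L * s ^+ 2]. *)
Lemma half_ball_flattened A eta x0 : closed A -> 0 < eta -> flattened A x0 ->
  exists2 U, nbhs x0 U & exists2 s0, 0 < s0 &
    forall s, 0 < s < s0 -> forall x, A° x -> U x -> half_ball_at A eta s x.
Proof.
move=> clA eta0 [h [e [r [L [r0 L0 e1 he hB]]]]].
exists [set x | enorm (x - x0) < r / 2].
  by apply/nbhs_enormP; exists (r / 2) => //; rewrite divr_gt0.
have L2 : 0 < L + 2 by rewrite ltr_wpDl.
exists (Num.min (r / 2 / (L + 2)) (eta / (L + 2))).
  by rewrite lt_min !divr_gt0.
move=> s /andP[s0]; rewrite lt_min => /andP[sr se] x Ax /= xr.
have {}sr : (L + 2) * s < r / 2 by rewrite mulrC -ltr_pdivlMr.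
have {}se : L * s ^+ 2 <= eta * s.
  rewrite expr2 mulrA ler_wpM2r ?(ltW s0)//; move: se; rewrite ltr_pdivlMr// => se.
  nra.
have xr' : enorm (x - x0) + (L + 2) * s < r by lra.
have xr'' : enorm (x - x0) < r by have := mulr_gt0 L2 s0; lra.
have [hbx [w w1 hw]] := hB x xr''.
have hb z : enorm (z - x0) < r -> boundary A z -> h z = 0.
  by move=> zr; have [[+ _] _] := hB z zr.
have hx : h x != 0 by apply/eqP => /hbx[_]; exact.
case: (ltgtP (h x) 0) hx => // hx _.
  exists w => // y yx yw.
  apply: (@half_ball_above R d A (fun z => - h z) (- e) x0 r L (- w) s x) => //.
  - by rewrite enormN.
  - by move=> z t _; rewrite scalerN -scaleNr he opprD opprK.
  - by move=> z zr bz; rewrite hb// oppr0.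
  - move=> z zr; have [h1 h2] := hw z zr; rewrite -opprD normrN; split => //.
    by rewrite dotNr -opprD normrN.
  - by rewrite oppr_gt0.
  - by rewrite dotNr; lra.
exists (- w); first by rewrite enormN.
move=> y yx; rewrite dotNr => yw.
apply: (@half_ball_above R d A h e x0 r L w s x) => //; lra.
Qed.

Lemma half_ball_compact A eta : compact A -> (forall x, boundary A x -> flattened A x) ->
  0 < eta -> exists2 s0, 0 < s0 &
    forall s, 0 < s < s0 -> forall x, A° x -> half_ball_at A eta s x.
Proof.
move=> cA fA eta0; have clA : closed A by apply: compact_closed => //; exact: norm_hausdorff.
suff [s0 s00 H] : exists2 s0, 0 < s0 &
    forall s, 0 < s < s0 -> forall x, A° x -> A x -> half_ball_at A eta s x.
  by exists s0 => // s ss x Ax; apply: H => //; exact: interior_subset.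
pose good W := exists2 s0, 0 < s0 &
    forall s, 0 < s < s0 -> forall x, A° x -> W x -> half_ball_at A eta s x.
apply: (compact_ind (good := good) cA).
- by exists 1.
- by move=> U V UV [s0 s00 H]; exists s0 => // s ss x Ax /UV; exact: H.
- move=> U V [s0 s00 H] [s0' s00' H']; exists (Num.min s0 s0'); first by rewrite lt_min s00.
  move=> s /andP[s1]; rewrite lt_min => /andP[s2 s3] x Ax [] Ux; [apply: H|apply: H'] => //;
    by rewrite s1.
move=> x0 Ax0; have [Dx|nDx] := pselect (A° x0); last first.
  have [|U nU [s0 s00 H]] := @half_ball_flattened A eta x0 clA eta0.
    by apply: fA; split => //; exact: subset_closure.
  by exists U => //; exists s0 => // s ss x Ax [_]; exact: H.
have [r r0 Hr] : exists2 r, 0 < r & forall y, enorm (y - x0) < r -> A° y.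
  by apply/nbhs_enormP; exact: open_nbhs_nbhs (conj (open_interior A) Dx).
exists [set x | enorm (x - x0) < r / 2].
  by apply/nbhs_enormP; exists (r / 2) => //; rewrite divr_gt0.
exists (r / 2); first by rewrite divr_gt0.
(* Away from the boundary the whole ball is interior, and any admissible vector will do. *)
move=> s /andP[s0 sr] x _ [_ /= xr]; exists (const_mx 1).
  by apply: le_trans (coord_le_enorm _ ord0); rewrite mxE normr1.
move=> y yx _; apply: Hr; apply: le_lt_trans (enormB_le _ x _) _; lra.
Qed.

Lemma slab_measurable (v : 'rV[R]_d) (c : R) :
  [/\ measurable (eball 0 1 `&` [set z | dot z v < c]),
   measurable (eball 0 1 `&` [set z | c < dot z v]) &
   measurable (eball 0 1 `&` [set z | `|dot z v| <= c])].
Proof.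
have md : measurable_fun setT (fun z : 'rV[R]_d => dot z v).
  by apply: measurable_dot; [exact: measurable_id|exact: measurable_cst].
split; apply: measurableI; (try exact: measurable_eball); apply: measurable_bool_set.
- by apply: measurable_fun_ltr.
- by apply: measurable_fun_ltr.
- by apply: measurable_fun_ler => //; exact: measurableT_comp.
Qed.

(** [N] translates along [v], with steps of [3 * eta] in the value of [dot z v], are disjoint and
    move the unit ball by at most 1, hence stay in the ball of radius 2. *)
Lemma vol_slab (v : 'rV[R]_d) (N : nat) eta : 1 <= enorm v -> 0 < eta ->
  3 * eta * N%:R <= 1 ->
  (N%:R%:E * vol d (eball 0 1%R `&` [set z | (`|dot z v| <= eta)%R]) <=
    (2 ^+ d * theta d)%:E)%E.
Proof.
move=> v1 eta0 etaN; have v0 : 0 < enorm v by exact: lt_le_trans v1.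
have [_ _ mS] := slab_measurable v eta.
rewrite -(vol_eball (0 : 'rV[R]_d))//.
pose t (i : nat) : 'rV[R]_d := (3 * eta * i%:R / enorm v ^+ 2) *: v.
have tv i : dot (t i) v = 3 * eta * i%:R.
  by rewrite dotZl -enorm_sqr mulfVK// expf_neq0// gt_eqF.
have lt i j x : `|dot (x - t i) v| <= eta -> `|dot (x - t j) v| <= eta -> ~ (i < j)%N.
  move=> + + ij; have {}ij : i%:R + 1 <= j%:R :> R by rewrite natr1 ler_nat.
  rewrite !dotBl !tv !ler_norml => /andP[h1 h2] /andP[h3 h4]; nra.
apply: (packing (v := t)) => //; first exact: measurable_eball.
- move=> i j x [_ /= Ti] [_ /= Tj].
  by case: (ltngtP i j) => // ij; [case: (lt i j x)|case: (lt j i x)].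
- move=> i x iN [xB _]; rewrite /eball /= subr0; apply: le_trans (enormD _ _) _.
  move: xB; rewrite /eball/= subr0 => xB.
  suff : enorm (t i) <= 1 by lra.
  rewrite enormZ ger0_norm ?divr_ge0 ?mulr_ge0 ?exprn_ge0 ?(ltW eta0) ?(ltW v0)//.
  rewrite expr2 invfM mulrA mulfVK ?gt_eqF// ler_pdivrMr// mul1r; apply: le_trans v1.
  apply: le_trans etaN; rewrite ler_wpM2l ?mulr_ge0 ?(ltW eta0)// ler_nat ltnW//.
Qed.

(** The reflection [z -> - z] exchanges the two caps that remain when the slab is cut out of the
    ball. *)
Lemma vol_half_ball (v : 'rV[R]_d) (N : nat) eta : 1 <= enorm v -> 0 < eta ->
  (0 < N)%N -> 3 * eta * N%:R <= 1 ->
  ((theta d / 2 - 2 ^+ d * theta d / N%:R)%:E <=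
    vol d (eball 0 1%R `&` [set z | (dot z v < - eta)%R]))%E.
Proof.
move=> v1 eta0 N0 etaN.
have [mSl _ _] := slab_measurable v (- eta).
have [_ mSr mS] := slab_measurable v eta.
set Sl := (X in measurable X) in mSl; set Sr := (X in measurable X) in mSr.
set S := (X in measurable X) in mS.
have flip : vol d Sr = vol d Sl.
  have := int_subst_measure (vol_affine (0 : 'rV[R]_d) (ltac:(rewrite oppr_eq0 oner_neq0; reflexivity) : (-1 : R) != 0)) mSl.
  rewrite normrN1 invr1 expr1n mul1e => <-; congr (vol d _).
  apply/seteqP; split=> z; rewrite /Sr /Sl /eball/= addr0 scaleN1r !subr0 enormN dotNl ltrN2//.
have cover : (vol d (eball (0 : 'rV[R]_d) 1) <= vol d Sl + (vol d S + vol d Sr))%E.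
  apply: (@le_trans _ _ (vol d (Sl `|` (S `|` Sr)))).
    apply: le_measure; rewrite ?inE; [exact: measurable_eball|by do !apply: measurableU|].
    move=> z zB; case: (ltP (dot z v) (- eta)) => h1; first by left.
    right; case: (ltP eta (dot z v)) => h2; first by right.
    by left; split => //=; rewrite ler_norml h1.
  apply: le_trans (measureU2 _ mSl (measurableU _ _ mS mSr)) _; rewrite leeD2l//.
  exact: (measureU2 _ mS mSr).
have := vol_slab v1 eta0 etaN; rewrite -/S.
move: cover; rewrite flip thetaE.
have fin B : measurable B -> B `<=` eball (0 : 'rV[R]_d) 1 -> vol d B = (fine (vol d B))%:E.
  move=> mB BB; rewrite fineK// ge0_fin_numE//; apply: le_lt_trans (vol_eball1_lty (R := R) (d := d)).
  by apply: le_measure; rewrite ?inE//; exact: measurable_eball.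
rewrite (fin S mS) 1?(fin Sl mSl); try by move=> z [].
set a := fine _; set b := fine _; rewrite -!EFinD -EFinM !lee_fin => h1 h2.
have N1 : 0 < N%:R :> R by rewrite ltr0n.
have : b <= 2 ^+ d * theta d / N%:R by rewrite ler_pdivlMr// mulrC.
have : 0 <= b by rewrite /b fine_ge0.
lra.
Qed.

Lemma interior_lower_density A eps : compact A -> (forall x, boundary A x -> flattened A x) ->
  0 < eps -> exists2 s0, 0 < s0 & forall s, 0 < s < s0 -> forall x, A° x ->
    (((theta d / 2 - eps) * s ^+ d)%:E <= vol d (A° `&` eball x s))%E.
Proof.
move=> cA fA eps0; pose c := 2 ^+ d * theta d / eps : R.
have th0 : 0 <= theta d :> R by apply/ltW/theta_gt0.
have c0 : 0 <= c by rewrite divr_ge0 ?(ltW eps0)// mulr_ge0// exprn_ge0.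
pose N := (Num.truncn c).+1; have N0 : 0 < N%:R :> R by rewrite ltr0n.
pose eta : R := (3 * N%:R)^-1; have eta0 : 0 < eta by rewrite invr_gt0 mulr_gt0.
have etaN : 3 * eta * N%:R <= 1.
  by rewrite /eta invfM mulrA divff ?pnatr_eq0// mul1r mulVf// gt_eqF.
have [s0 s00 H] := half_ball_compact cA fA eta0; exists s0 => // s ss x Ax.
have [v v1 Hv] := H s ss x Ax; have /andP[sp _] := ss.
have [mS _ _] := slab_measurable v (- eta).
set S := (X in measurable X) in mS.
have s1 : s^-1 != 0 by rewrite invr_eq0 gt_eqF.
have := int_subst_measure (vol_affine (- (s^-1 *: x)) s1) mS.
rewrite gtr0_norm ?invr_gt0// invrK => sub.
apply: (@le_trans _ _ ((s ^+ d)%:E * vol d S)%E).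
  rewrite mulrC EFinM lee_wpmul2l ?lee_fin ?exprn_ge0 ?(ltW sp)//.
  apply: le_trans (vol_half_ball v1 eta0 (ltn0Sn _) etaN); rewrite lee_fin lerD2l lerN2.
  rewrite ler_pdivrMr// [eps * _]mulrC -ler_pdivrMr// -/c; apply/ltW; exact: Num.Theory.truncnS_gt.
rewrite -sub; apply: le_measure; rewrite ?inE.
- rewrite -[X in measurable X]setTI; have [mf _ _] := vol_affine (- (s^-1 *: x)) s1.
  exact: mf.
- by apply: measurableI; [apply: open_measurable_rV; exact: open_interior|exact: measurable_eball].
move=> y; rewrite /S /eball/= subr0 -scalerBr enormZ gtr0_norm ?invr_gt0// dotZl.
rewrite ler_pdivrMl// mulr1 ltr_pdivrMl// mulrN mulrC => -[yx yv].
by split => //; exact: Hv.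
Qed.

End half_ball_uniform.

(** * The expected number of components *)

Section restricted_law.
Local Open Scope ereal_scope.
Context {disp : measure_display} {T : measurableType disp} {R : realType}.
Variables (nu mu : {sigma_finite_measure set T -> \bar R}) (c : R) (D : set T).
Hypotheses (c0 : (0 <= c)%R) (mD : measurable D).
Hypothesis nuE : forall B, measurable B -> nu B = c%:E * mu (B `&` D).

Lemma integral_restricted (F : T -> \bar R) : measurable_fun setT F -> (forall x, 0 <= F x) ->
  \int[nu]_x F x = c%:E * \int[mu]_x ((x \in D)%:R%:E * F x).
Proof.
move=> mF F0.
have FD x : (x \in D)%:R%:E * F x = (F \_ D) x.
  by rewrite patchE; case: ifP => _; rewrite ?mul1e ?mul0e.
under [in RHS]eq_integral do rewrite FD.
have mFD : measurable_fun setT (F \_ D).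
  by apply/(measurable_restrict _ mD measurableT); rewrite setTI; exact: measurable_funS mF.
have nuD : nu (~` D) = 0.
  by rewrite nuE ?setICl ?measure0 ?mule0//; exact: measurableC.
rewrite (@integral_ae_on _ _ _ nu F (F \_ D) D mD nuD)//; last 2 first.
- by move=> x; rewrite patchE; case: ifP.
- by move=> x Dx; rewrite patchE mem_set.
rewrite -!integral_mkcond.
rewrite (eq_measure_integral (mscale (NngNum c0) mu)).
  rewrite ge0_integral_mscale//; exact: measurable_funS mF.
by move=> B mB BD; apply: (etrans (nuE mB)); rewrite setIidl.
Qed.

Definition all_in n (t : n.-tuple T) : bool := [forall i, tnth t i \in D].

Lemma measurable_all_in n : measurable_fun setT (@all_in n).
Proof.
apply: measurable_forall => i.
exact: (measurableT_comp (measurable_mem mD) (measurable_tnth i)).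
Qed.

Lemma all_in_tcons n x (t : n.-tuple T) : all_in (tcons (x, t)) = (x \in D) && all_in t.
Proof.
apply/forallP/andP => [h|[h1 /forallP h2] i].
  split; first exact: (h ord0).
  by apply/forallP => i; have := h (lift ord0 i); rewrite tnthS.
by case: (unliftP ord0 i) => [j ->|->] //; rewrite tnthS.
Qed.

Lemma integral_mpow_restricted n (F : n.-tuple T -> \bar R) :
  measurable_fun setT F -> (forall t, 0 <= F t) ->
  \int[mpow nu n]_t F t = (c ^+ n)%:E * \int[mpow mu n]_t ((all_in t)%:R%:E * F t).
Proof.
elim: n F => [|n IH] F mF F0.
  rewrite expr0 mul1e !integral_mpow0//.
    rewrite (_ : all_in _ = true) ?mul1e//; by apply/forallP => -[].
  apply: emeasurable_funM => //; apply/measurable_EFinP.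
  by apply: measurable_bool_real; exact: measurable_all_in.
have mF1 x : measurable_fun setT (fun t => F (tcons (x, t))).
  apply: (measurableT_comp mF).
  by apply: (measurableT_comp (measurable_tcons (n := n))); exact: pair1_measurable.
have mb m : measurable_fun setT (fun t : m.-tuple T => (all_in t)%:R%:E : \bar R).
  by apply/measurable_EFinP; apply: measurable_bool_real; exact: measurable_all_in.
rewrite integral_mpowS// (integral_restricted (measurable_mpow_inner nu mF F0)); last first.
  by move=> x; apply: integral_ge0.
rewrite integral_mpowS; last 2 first.
- exact: (emeasurable_funM (mb _) mF).
- by move=> t; rewrite mule_ge0.
rewrite exprS EFinM -muleA; congr (c%:E * _).
pose H (t : n.+1.-tuple T) := (all_in t)%:R%:E * F t.
have mH : measurable_fun setT H by exact: (emeasurable_funM (mb _) mF).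
have H0 t : 0 <= H t by rewrite /H mule_ge0.
have mG := @measurable_mpow_inner _ _ _ mu n H mH H0.
have G0 x : 0 <= \int[mpow mu n]_t H (tcons (x, t)) by apply: integral_ge0.
have cn0 : 0 <= (c ^+ n)%:E by rewrite lee_fin exprn_ge0.
apply: (etrans _ (ge0_integralZl mu measurableT mG (fun x _ => G0 x) cn0)).
apply: eq_integral => x _; have bE (t : n.-tuple T) := all_in_tcons x t.
rewrite /H IH//; case: (x \in D) bE => bE.
  by rewrite mul1e; congr (_ * _); apply: eq_integral => t _; rewrite bE.
by rewrite mul0e integral0_eq ?mule0// => t _; rewrite bE mul0e.
Qed.

End restricted_law.

Section scaling.
Context {R : realType} {d : nat}.
Variable (j : nat) (r : R) (r0 : 0 < r).
Notation E := 'rV[R]_d.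

Lemma tcons_tscale (x : E) (z : j.-tuple E) :
  tcons (x, tscale r x z) = [tuple r *: tnth (cons0 z) i + x | i < j.+1].
Proof.
apply: eq_from_tnth => i; rewrite tnth_mktuple.
case: (unliftP ord0 i) => [k ->|->]; first by rewrite !tnthS tnth_mktuple.
by rewrite tnth_cons00 scaler0 add0r.
Qed.

Lemma hconn_tscale (x : E) (z : j.-tuple E) :
  hconn r (tcons (x, tscale r x z)) = hconn 1 (cons0 z).
Proof. by rewrite tcons_tscale -{1}(mulr1 r) hconn_affine. Qed.

Lemma vol_ball_union_tscale (x : E) (z : j.-tuple E) :
  vol d (ball_union r (tcons (x, tscale r x z))) = (r ^+ d * bvol (cons0 z))%:E.
Proof.
have r1 : r^-1 != 0 by rewrite invr_eq0 gt_eqF.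
have := int_subst_measure (vol_affine (- (r^-1 *: x)) r1) (measurable_ball_union 1 (cons0 z)).
rewrite gtr0_norm ?invr_gt0// invrK => H.
rewrite EFinM -(bvolE (cons0 z)); apply: (etrans _ H); congr (vol d _).
have scaled (w y : E) : r^-1 *: y - r^-1 *: x - w = r^-1 *: (y - (r *: w + x)).
  by rewrite scalerBr scalerDr scalerA mulVf ?gt_eqF// scale1r opprD addrA addrAC.
by apply/seteqP; split=> y /existsP[i yi]; apply/existsP; exists i; move: yi;
  rewrite tcons_tscale tnth_mktuple /= scaled enormZ gtr0_norm ?invr_gt0// ler_pdivrMl// mulr1.
Qed.

Lemma cluster_integral0_lty : (@cluster_integral R d j 0 < +oo)%E.
Proof.
pose C : R := expR (j%:R * j.+1%:R).
apply: (@le_lt_trans _ _ (\int[mpow (vol d) j]_z (C%:E * (expR (- (1 * tsum z)))%:E))%E).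
  apply: le_ge0_integral => z; first by rewrite lee_fin mulr_ge0// expR_ge0.
  rewrite oppr0 mul0r expR0 mulr1 -EFinM lee_fin mul1r /C -expRD.
  case: (boolP (hconn _ _)) => [hz|_]; last by rewrite expR_ge0.
  apply: le_trans (expR_ge1Dx _); rewrite lerDl subr_ge0 /tsum.
  apply: (@le_trans _ _ (\sum_(i < j) j.+1%:R)); last by rewrite sumr_const card_ord mulr_natl.
  apply: ler_sum => i _; have := hconn_diam (lift ord0 i) ord0 ler01 hz.
  by rewrite tnthS tnth_cons00 subr0 mul1r.
rewrite ge0_integralZl//; last 2 first.
- exact: measurable_exp_tsum.
- by rewrite lee_fin expR_ge0.
by apply: lte_mul_pinfty; rewrite ?lee_fin ?expR_ge0//; exact: exp_tsum_integral_lty.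
Qed.

End scaling.

Section inner_integral.
Context {R : realType} {d : nat}.
Notation E := 'rV[R]_d.
Variables (D : set E) (j : nat) (kap r : R).
Hypotheses (mD : measurable D) (kap0 : 0 <= kap) (r0 : 0 < r).

Definition local_mass (y : j.+1.-tuple E) : R := fine (vol d (ball_union r y `&` D)).

Lemma measurable_local_set (y : j.+1.-tuple E) : measurable (ball_union r y `&` D).
Proof. by apply: measurableI => //; exact: measurable_ball_union. Qed.

Lemma local_massE y : vol d (ball_union r y `&` D) = (local_mass y)%:E.
Proof.
rewrite fineK// ge0_fin_numE//; apply: le_lt_trans (vol_ball_union_lty y r0).
by apply: le_measure; rewrite ?inE; [exact: measurable_local_set|exact: measurable_ball_union|exact: subIsetl].
Qed.

Lemma measurable_local_mass : measurable_fun setT local_mass.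
Proof.
have mb : measurable_fun setT (fun p : j.+1.-tuple E * E =>
    [exists i, enorm (p.2 - tnth p.1 i) <= r] && (p.2 \in D)).
  apply: measurable_and; first exact: measurable_in_ball_union.
  exact: (measurableT_comp (measurable_mem mD) measurable_snd).
have := measurable_section_measure (vol d) mb => m.
apply: measurableT_comp => //.
rewrite (_ : (fun _ => _) = (fun x => vol d [set y | [exists i, enorm (y - tnth x i) <= r] && (y \in D)])).
  exact: m.
apply/funext => x; congr (vol d _); apply/seteqP; split=> y /=.
  by move=> [-> /mem_set].
by move=> /andP[h /set_mem Dy]; split.
Qed.

Definition cluster_weight (y : j.+1.-tuple E) : R :=
  (hconn r y)%:R * expR (- kap * local_mass y).

Lemma cluster_weight_ge0 y : 0 <= cluster_weight y.
Proof. by rewrite mulr_ge0// expR_ge0. Qed.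

Lemma measurable_cluster_weight : measurable_fun setT cluster_weight.
Proof.
apply: measurable_funM.
  by apply: measurable_bool_real; exact: measurable_hconn.
apply: measurableT_comp => //; apply: measurable_funM => //.
exact: measurable_local_mass.
Qed.

Definition inner (x : E) : \bar R :=
  (\int[mpow (vol d) j]_z ((all_in D (tcons (x, z)))%:R%:E * (cluster_weight (tcons (x, z)))%:E))%E.

Lemma inner_out x : ~ D x -> inner x = 0%E.
Proof.
move=> Dx; apply: integral0_eq => z _; rewrite all_in_tcons memNset//= mul0e//.
Qed.

Lemma inner_ge0 x : (0 <= inner x)%E.
Proof. by apply: integral_ge0 => z _; rewrite mule_ge0// lee_fin cluster_weight_ge0. Qed.

Lemma subst_tscale x (F : j.-tuple E -> R) : measurable_fun setT F -> (forall z, 0 <= F z) ->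
  (\int[mpow (vol d) j]_z (F z)%:E =
   (r ^+ (j * d))%:E * \int[mpow (vol d) j]_z (F (tscale r x z))%:E)%E.
Proof.
move=> mF F0; have [_ _ H] := @mpow_tscale R d j r x r0.
rewrite (H (fun z => (F z)%:E)); last 2 first.
- exact/measurable_EFinP.
- by move=> z; rewrite lee_fin.
by rewrite muleA -EFinM mulfV ?mul1e// gt_eqF// exprn_gt0.
Qed.

Lemma measurable_tcons1 (x : E) : measurable_fun setT (fun z : j.-tuple E => tcons (x, z)).
Proof. by apply: (measurableT_comp (measurable_tcons (n := j))); exact: pair1_measurable. Qed.

Lemma hconn_near x (z : j.-tuple E) i : hconn r (tcons (x, z)) ->
  enorm (tnth (tcons (x, z)) i - x) <= r * j.+1%:R.
Proof. by move=> /(hconn_diam i ord0 (ltW r0)). Qed.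

Lemma inner_eq x : eball x (r * j.+2%:R) `<=` D ->
  inner x = ((r ^+ (j * d))%:E * @cluster_integral R d j (kap * r ^+ d))%E.
Proof.
move=> xD.
pose F (z : j.-tuple E) := (hconn r (tcons (x, z)))%:R * expR (- kap * fine (vol d (ball_union r (tcons (x, z))))).
transitivity (\int[mpow (vol d) j]_z (F z)%:E)%E.
  apply: eq_integral => z _; rewrite /cluster_weight /F.
  case: (boolP (hconn _ _)) => hz; last by rewrite !mul0r mule0.
  have near := hconn_near _ hz.
  have sub : ball_union r (tcons (x, z)) `<=` D.
    move=> y /existsP[i yi]; apply: xD; rewrite /eball/=.
    apply: le_trans (enormB_le _ (tnth (tcons (x, z)) i) _) _.
    by rewrite -natr1 mulrDr mulr1 addrC lerD.
  rewrite (_ : all_in D _ = true) ?mul1e /local_mass ?setIidl//.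
  apply/forallP => i; apply/mem_set/xD; rewrite /eball/=; apply: le_trans (near i) _.
  by rewrite ler_wpM2l ?(ltW r0)// ler_nat.
have FE z : F (tscale r x z) =
    (hconn 1 (cons0 z))%:R * expR (- (kap * r ^+ d) * bvol (cons0 z)).
  rewrite /F hconn_tscale// (_ : fine _ = r ^+ d * bvol (cons0 z)).
    by rewrite -mulNr mulrA.
  exact: (congr1 fine (vol_ball_union_tscale r0 x z)).
have mF : measurable_fun setT F.
  apply: measurable_funM.
    apply: measurable_bool_real.
    exact: (measurableT_comp (measurable_hconn (n := j.+1) r) (measurable_tcons1 x)).
  apply: measurableT_comp => //; apply: measurable_funM => //.
  apply: measurableT_comp => //.
  exact: (measurableT_comp (measurable_section_measure (vol d) (@measurable_in_ball_union R d j.+1 r)) (measurable_tcons1 x)).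
have F0 z : 0 <= F z by rewrite /F mulr_ge0// expR_ge0.
rewrite (subst_tscale x mF F0); apply: (congr1 (mule _)).
by apply: eq_integral => z _; rewrite FE.
Qed.

Lemma inner_le x c : (c%:E <= vol d (D `&` eball x r))%E ->
  (inner x <= (r ^+ (j * d) * expR (- kap * c))%:E * @cluster_integral R d j 0)%E.
Proof.
move=> cx.
pose F (z : j.-tuple E) : R := (hconn r (tcons (x, z)))%:R.
have mF : measurable_fun setT F.
  apply: measurable_bool_real.
  exact: (measurableT_comp (measurable_hconn (n := j.+1) r) (measurable_tcons1 x)).
have F0 z : 0 <= F z by rewrite /F.
have -> : ((r ^+ (j * d) * expR (- kap * c))%:E * @cluster_integral R d j 0)%E =
    (\int[mpow (vol d) j]_z ((expR (- kap * c))%:E * (F z)%:E))%E.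
  have mFE : measurable_fun setT (EFin \o F) by exact/measurable_EFinP.
  have FE0 z : (0 <= (F z)%:E)%E by rewrite lee_fin.
  have e0 : (0 <= (expR (- kap * c))%:E)%E by rewrite lee_fin expR_ge0.
  apply/esym/(etrans (ge0_integralZl (mpow (vol d) j) measurableT mFE (fun z _ => FE0 z) e0)).
  rewrite (subst_tscale x mF F0) muleA -EFinM mulrC; apply: (congr1 (mule _)).
  apply: eq_integral => z _; by rewrite /F hconn_tscale// oppr0 mul0r expR0 mulr1.
apply: le_ge0_integral => z; first by rewrite mule_ge0// lee_fin cluster_weight_ge0.
rewrite /cluster_weight -!EFinM lee_fin mulrC mulrAC /F mulrC.
have e0 := expR_ge0 (- kap * local_mass (tcons (x, z))).
have ec : expR (- kap * local_mass (tcons (x, z))) <= expR (- kap * c).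
  rewrite ler_expR !mulNr lerN2 ler_wpM2l// -lee_fin -local_massE; apply: le_trans cx _.
  apply: le_measure; rewrite ?inE; [|exact: measurable_local_set|].
    by apply: measurableI => //; exact: measurable_eball.
  by move=> y [Dy yx]; split => //; rewrite ball_union_tcons; left.
case: (hconn _ _); case: (all_in _ _); rewrite ?mulr1 ?mulr0 ?mul1r ?mul0r//; exact: expR_ge0.
Qed.

End inner_integral.

Section uniform_law.
Context {R : realType} {d : nat}.
Variable A : set 'rV[R]_d.
Hypotheses (cA : compact A) (nullA : vol d (boundary A) = 0%E) (volA : (0 < vol d A)%E).

Let clA : closed A.
Proof. by apply: compact_closed => //; exact: norm_hausdorff. Qed.

Lemma measurable_interior : measurable A°.
Proof. by apply: open_measurable_rV; exact: open_interior. Qed.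

Lemma vol_compact_lty : (vol d A < +oo)%E.
Proof.
have [M [_ HM]] := compact_bounded cA.
pose s := `|M| + 1; have s0 : 0 < d.+1%:R * s by rewrite mulr_gt0// /s ltr_wpDl.
apply: (@le_lt_trans _ _ (vol d (eball (0 : 'rV[R]_d) (d.+1%:R * s)))); last by rewrite vol_eball// ltry.
apply: le_measure; rewrite ?inE; [exact: closed_measurable_rV|exact: measurable_eball|].
move=> x Ax; rewrite /eball/= subr0; apply: le_trans (enorm_le_norm x) _.
have Ms : M < s by rewrite /s; apply: le_lt_trans (ler_norm M) _; rewrite ltrDl.
apply: ler_pM => //; first by rewrite ler_nat.
exact: HM Ms _ Ax.
Qed.

Lemma vol_interior B : measurable B -> vol d (B `&` A) = vol d (B `&` A°).
Proof.
move=> mB; apply/eqP; rewrite eq_le; apply/andP; split.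
  apply: (@le_trans _ _ (vol d ((B `&` A°) `|` boundary A))).
    apply: le_measure; rewrite ?inE.
    - by apply: measurableI => //; exact: closed_measurable_rV.
    - apply: measurableU; first by apply: measurableI => //; exact: measurable_interior.
      apply: measurableD; last exact: measurable_interior.
      by apply: closed_measurable_rV; exact: closed_closure.
    - move=> x [Bx Ax]; have [iA|niA] := pselect (A° x); first by left.
      by right; split => //; exact: subset_closure.
  apply: (le_trans (measureU2 _ _ _)).
  - by apply: measurableI => //; exact: measurable_interior.
  - apply: measurableD; last exact: measurable_interior.
    by apply: closed_measurable_rV; exact: closed_closure.
  have nullA' : (vol d (boundary A) <= 0)%E by rewrite nullA.
  by rewrite -[leRHS]adde0; apply: leeD.
apply: le_measure; rewrite ?inE.
- by apply: measurableI => //; exact: measurable_interior.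
- by apply: measurableI => //; exact: closed_measurable_rV.
- by move=> x [Bx /interior_subset].
Qed.

Lemma f0_gt0 : 0 < f0 A.
Proof. by rewrite invr_gt0 fine_gt0// volA vol_compact_lty. Qed.

Lemma vol_interior_f0 : vol d A° = ((f0 A)^-1)%:E.
Proof.
rewrite invrK -(setTI A°) -vol_interior// setTI fineK// ge0_fin_numE//.
exact: vol_compact_lty.
Qed.

Lemma uniform_law (disp : measure_display) (Omega : measurableType disp) (P : probability Omega R)
    (X : {RV P >-> 'rV[R]_d}) (B : set 'rV[R]_d) :
  has_density X (unif_density A) -> measurable B ->
  distribution P X B = ((f0 A)%:E * vol d (B `&` A°))%E.
Proof.
move=> HX mB; have mA : measurable A by exact: closed_measurable_rV.
rewrite HX// -vol_interior// /unif_density; under eq_integral do rewrite EFinM.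
rewrite ge0_integralZl//; last 2 first.
- by apply/measurable_EFinP; exact: measurable_indic.
- by rewrite lee_fin ltW// f0_gt0.
by apply: (congr1 (mule _)); rewrite integral_indic// setIC.
Qed.

End uniform_law.

Section expected_count.
Context {R : realType} {d : nat}.
Variable A : set 'rV[R]_d.
Hypotheses (d0 : (0 < d)%N) (cA : compact A) (nullA : vol d (boundary A) = 0%E).
Hypothesis volA : (0 < vol d A)%E.
Context {disp : measure_display} {Omega : measurableType disp}.
Variables (P : probability Omega R) (X : nat -> {RV P >-> 'rV[R]_d}) (N : {RV P >-> nat}).
Variables (j : nat) (r rate : R).
Hypotheses (r0 : 0 < r) (rate0 : 0 < rate).
Hypothesis Xdensity : forall i, has_density (X i) (unif_density A).
Hypothesis Xindep : mutually_independent P (fun i => X i : Omega -> 'rV[R]_d).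
Hypothesis Nindep : independent_of_sequence P N (fun i => X i : Omega -> 'rV[R]_d).
Hypothesis Npoisson : poisson_rv N rate.

Notation nu := (distribution P (X 0%N)).

Let nuE B : measurable B -> nu B = ((f0 A)%:E * vol d (B `&` A°))%E.
Proof. exact: uniform_law. Qed.

Lemma one_sub_avoid (y : j.+1.-tuple 'rV[R]_d) :
  1 - avoid X r y = f0 A * local_mass A° r y.
Proof.
have mB := measurable_ball_union r y.
have E1 : nu (ball_union r y) = (f0 A * local_mass A° r y)%:E.
  apply: (etrans (nuE mB)); rewrite EFinM -local_massE//; exact: measurable_interior.
rewrite /avoid (_ : [set x | _] = ~` ball_union r y); last first.
  by apply/seteqP; split=> x /=; [move/negP|move=> h; apply/negP].
have E2 := etrans (probability_setC nu mB) (congr1 (fun z => (1 - z)%E) E1).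
apply: (etrans (congr1 (fun z => 1 - fine z) E2)).
by rewrite /= opprB addrC subrK.
Qed.

Lemma expected_num_components :
  ('E_P[fun w => (num_components j.+1 r (sample (fun i => X i : Omega -> 'rV[R]_d) N w))%:R] =
   ((rate * f0 A) ^+ j.+1 / j.+1`!%:R)%:E *
     \int[vol d]_x inner A° j (rate * f0 A) r x)%E.
Proof.
have mD := @measurable_interior _ _ A.
have f00 : 0 <= f0 A by apply/ltW/f0_gt0.
have atomless x : nu [set x] = 0%E.
  have m1 : measurable [set x] by exact: measurable_set1_rV.
  apply: (etrans (nuE m1)); apply/eqP; rewrite eq_le; apply/andP; split; last by rewrite mule_ge0.
  rewrite -(mule0 (f0 A)%:E) lee_wpmul2l//.
  apply: (@le_trans _ _ (vol d [set x])); last by rewrite (vol_set1 d0).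
  by apply: le_measure; rewrite ?inE//; apply: measurableI.
have law i B : measurable B -> distribution P (X i) B = nu B.
  by move=> mB; apply: (etrans _ (esym (nuE mB))); exact: uniform_law.
have H := mecke (ltn0Sn j) (ltW r0) rate0 law Xindep atomless Nindep Npoisson.
apply: (etrans H).
pose G (y : j.+1.-tuple 'rV[R]_d) : \bar R := (cluster_weight A° (rate * f0 A) r y)%:E.
have mG : measurable_fun setT G.
  by apply/measurable_EFinP; exact: measurable_cluster_weight.
have G0 y : (0 <= G y)%E by rewrite lee_fin cluster_weight_ge0.
have E1 : (\int[mpow nu j.+1]_y ((hconn r y)%:R * expR (- rate * (1 - avoid X r y)))%:E =
    \int[mpow nu j.+1]_y G y)%E.
  apply: eq_integral => y _.
  by rewrite one_sub_avoid /G /cluster_weight mulrA mulNr.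
rewrite E1.
have E2 := integral_mpow_restricted f00 mD nuE mG G0.
rewrite E2 muleA -EFinM; congr (_ * _)%E.
  by rewrite exprMn mulrAC.
apply: integral_mpowS.
- apply: emeasurable_funM => //; apply/measurable_EFinP; apply: measurable_bool_real.
  exact: measurable_all_in.
- by move=> t; rewrite mule_ge0.
Qed.

End expected_count.

Lemma integral_two_steps (disp : measure_display) (T : measurableType disp) (R : realType)
    (mu : {measure set T -> \bar R}) (a b : R) (D S : set T) :
  0 <= a -> 0 <= b -> measurable D -> measurable S ->
  (\int[mu]_x (a%:E * (x \in D)%:R%:E + b%:E * (x \in S)%:R%:E) =
   a%:E * mu D + b%:E * mu S)%E.
Proof.
move=> a0 b0 mD mS.
have mb (B : set T) : measurable B -> measurable_fun setT (fun x => (x \in B)%:R%:E : \bar R).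
  by move=> mB; apply/measurable_EFinP; apply: measurable_bool_real; exact: measurable_mem.
have ib (B : set T) : measurable B -> (\int[mu]_x (x \in B)%:R%:E = mu B)%E.
  move=> mB; rewrite (integral_bool _ (measurable_mem mB)); congr (mu _).
  by apply/seteqP; split=> x /=; [exact: set_mem|exact: mem_set].
have mZ (c : R) (B : set T) : measurable B ->
    measurable_fun setT (fun x => c%:E * (x \in B)%:R%:E : \bar R)%E.
  by move=> mB; apply: emeasurable_funM => //; exact: mb.
rewrite (ge0_integralD mu measurableT _ (mZ a D mD) _ (mZ b S mS)); last 2 first.
- by move=> x _; rewrite mule_ge0.
- by move=> x _; rewrite mule_ge0.
by rewrite (ge0_integralZl mu measurableT (mb D mD))// (ge0_integralZl mu measurableT (mb S mS))// !ib.
Qed.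

Section total_mass.
Context {R : realType} {p : nat}.
Notation d := p.+1.
Variables (A : set 'rV[R]_d) (j : nat).
Hypotheses (cA : compact A) (fA : forall x, boundary A x -> flattened A x).

Let clA : closed A.
Proof. by apply: compact_closed => //; exact: norm_hausdorff. Qed.

Notation J lam := (fine (@cluster_integral R d j lam)).

Lemma integral_inner_bounds eps : 0 < eps -> (vol d A° < +oo)%E ->
  exists C s0 : R, [/\ 0 <= C, 0 < s0 & forall r kap, 0 < r < s0 -> 0 <= kap ->
    1 <= kap * r ^+ d ->
    ((r ^+ (j * d) * J (kap * r ^+ d) * (fine (vol d A°) - C * r))%:E <=
       \int[vol d]_x inner A° j kap r x <=
     (r ^+ (j * d) * (J (kap * r ^+ d) * fine (vol d A°) +
       J 0 * expR (- (kap * r ^+ d) * (theta d / 2 - eps)) * (C * r)))%:E)%E].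
Proof.
move=> eps0 volD.
have [C1 [s1 [C10 s10 tubeC]]] := thin_boundary cA fA.
have [s2 s20 dens] := interior_lower_density cA fA eps0.
have mD : measurable A° := measurable_interior A.
pose m : R := 2 * j.+2%:R; have m0 : 0 < m by rewrite mulr_gt0.
exists (C1 * m), (Num.min (s1 / m) s2); split; first by rewrite mulr_ge0 ?(ltW m0).
  by rewrite lt_min divr_gt0.
move=> r kap /andP[r0]; rewrite lt_min => /andP[rs1 rs2] kap0 lam1.
pose s := 2 * (r * j.+2%:R); have sE : s = r * m by rewrite /s /m; ring.
have s0 : 0 < s by rewrite sE mulr_gt0.
have ss1 : s < s1 by rewrite sE -ltr_pdivlMr.
pose S := tube (boundary A) s; have mS : measurable S by exact: measurable_tube.
have volS : (vol d S <= (C1 * m * r)%:E)%E.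
  have := tubeC s; rewrite s0 ss1 => /(_ isT) /le_trans; apply.
  by rewrite lee_fin sE [r * m]mulrC mulrA.
have [C _ /(_ _ lam1)[Jfin _]] := @cluster_integral_asymptotics R p.+1 (ltn0Sn p) j.
pose lam := kap * r ^+ d.
have Jge0 l : (0 <= @cluster_integral R d j l)%E.
  by apply: integral_ge0 => z _; rewrite lee_fin mulr_ge0// expR_ge0.
have JE : @cluster_integral R d j lam = (J lam)%:E by rewrite fineK// ge0_fin_numE.
have J0E : @cluster_integral R d j 0 = (J 0)%:E.
  have J0fin := @cluster_integral0_lty R d j; by rewrite fineK// ge0_fin_numE.
have J0 l : 0 <= J l by apply: fine_ge0; exact: Jge0.
pose a := r ^+ (j * d) * J lam; pose b := r ^+ (j * d) * (J 0 * expR (- lam * (theta d / 2 - eps))).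
have rj0 : 0 <= r ^+ (j * d) by rewrite exprn_ge0// ltW.
have a0 : 0 <= a by rewrite mulr_ge0.
have b0 : 0 <= b by rewrite mulr_ge0// mulr_ge0// expR_ge0.
have offS x : A° x -> ~ S x -> inner A° j kap r x = a%:E.
  move=> Dx Sx; rewrite inner_eq//; first by rewrite JE -EFinM.
  by apply: (eball_interior clA Dx) => //; rewrite mulr_gt0.
have onD x : A° x -> (inner A° j kap r x <= b%:E)%E.
  move=> Dx; have dx := dens r _ x Dx; have := inner_le j mD kap0 r0 (dx _).
  rewrite r0 rs2 => /(_ isT); rewrite J0E -EFinM; set u := (X in (_ <= X%:E)%E -> _).
  suff -> : u = b by [].
  by rewrite /u /b /lam mulrA -!mulrA; congr (_ * _); rewrite mulrC; congr (_ * expR _); ring.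
have volDE : vol d A° = (fine (vol d A°))%:E by rewrite fineK// ge0_fin_numE.
apply/andP; split.
  apply: (@le_trans _ _ (\int[vol d]_x (a%:E * (x \in A° `\` S)%:R%:E + 0%:E * (x \in S)%:R%:E))%E).
    have mDS : measurable (A° `\` S) by exact: measurableD.
    rewrite integral_two_steps// mul0e adde0 -/lam -/a EFinM lee_wpmul2l ?lee_fin//.
    have cover : (vol d A° <= vol d (A° `\` S) + vol d S)%E.
      apply: le_trans (measureU2 _ mDS mS).
      apply: le_measure; rewrite ?inE//; first exact: measurableU.
      by move=> x Dx; have [Sx|nSx] := pselect (S x); [right|left].
    have finDS : (vol d (A° `\` S) < +oo)%E.
      by apply: le_lt_trans volD; apply: le_measure; rewrite ?inE//; exact: subDsetl.
    have DSE : vol d (A° `\` S) = (fine (vol d (A° `\` S)))%:E by rewrite fineK// ge0_fin_numE.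
    apply: (@le_trans _ _ (fine (vol d (A° `\` S)))%:E); last by rewrite -DSE; exact: lexx.
    rewrite lee_fin lerBlDr -lee_fin -volDE EFinD -DSE.
    by apply: le_trans cover _; rewrite leeD2l.
  apply: le_ge0_integral => x; first by rewrite mul0e adde0 mule_ge0.
  rewrite mul0e adde0; case: (boolP (x \in _)) => [/set_mem[Dx Sx]|_].
    by rewrite mule1 offS.
  by rewrite mule0; exact: inner_ge0.
have ub : (\int[vol d]_x inner A° j kap r x <=
    \int[vol d]_x (a%:E * (x \in (A° : set 'rV[R]_d))%:R%:E + b%:E * (x \in S)%:R%:E))%E.
  apply: le_ge0_integral => x; first exact: inner_ge0.
  have [Dx|nDx] := pselect (A° x); last first.
    by rewrite inner_out// adde_ge0// mule_ge0.
  rewrite (mem_set Dx) mule1; have [Sx|nSx] := pselect (S x).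
    by rewrite (mem_set Sx) mule1; apply: le_trans (onD x Dx) _; rewrite leeDr// lee_fin.
  by rewrite memNset// mule0 adde0 offS.
apply: (le_trans ub); rewrite integral_two_steps//.
apply: (@le_trans _ _ ((a * fine (vol d A°))%:E + (b * (C1 * m * r))%:E)%E).
  have volDle : (vol d A° <= (fine (vol d A°))%:E)%E by rewrite -volDE.
  apply: leeD; first by rewrite (EFinM a) lee_wpmul2l// ?lee_fin//; exact: volDle.
  by rewrite (EFinM b) lee_wpmul2l.
by rewrite -EFinD lee_fin /a /b /lam [leRHS]mulrDr !mulrA lexx.
Qed.

End total_mass.

Lemma power_exp_bound (R : realType) (m : nat) (delta x : R) : 0 < delta -> 0 <= x ->
  x ^+ m.+1 * expR (- (delta * x)) <= m.+1`!%:R / delta ^+ m.+1.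
Proof.
move=> d0 x0; rewrite expRN ler_pdivrMr ?expR_gt0// -mulrA [_^-1 * _]mulrC mulrA.
rewrite ler_pdivlMr ?exprn_gt0// mulrC -exprMn.
have := expR_ge1Dxn m (mulr_ge0 (ltW d0) x0) => h.
rewrite -ler_pdivrMl ?ltr0n ?fact_gt0// mulrC; apply: le_trans h.
by rewrite lerDr.
Qed.

Lemma limf_esup_lt_near (R : realType) (u : R -> R) (b : R) : 0 < b ->
  (limf_esup (fun n => (u n)%:E) +oo%R < b%:E)%E ->
  exists c, [/\ 0 < c, c < b & \forall n \near +oo, u n <= c].
Proof.
move=> b0; rewrite /limf_esup => /ereal_inf_lt[_ [V FV <-] Vb].
pose s := ereal_sup ((fun n => (u n)%:E) @` V).
have usV n : V n -> ((u n)%:E <= s)%E by move=> Vn; apply: ereal_sup_ubound; exists n.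
exists (Num.max (b / 2) (fine s)); split.
- by rewrite lt_max divr_gt0.
- rewrite gt_max ltr_pdivrMr// ltr_pMr// ltr1n /=.
  move: Vb; rewrite -/s; case: s {usV} => //= t; by rewrite lte_fin.
- near=> n; have Vn : V n by near: n.
  have := usV n Vn; move: Vb; rewrite -/s le_max; case: s {usV} => //= t _; rewrite lee_fin => ->.
  by rewrite orbT.
Unshelve. all: by end_near.
Qed.

Section growth.
Context {R : realType}.
Variables (d m : nat) (th f c : R) (r : R -> R).
Hypotheses (d0 : (0 < d)%N) (th0 : 0 < th) (f0 : 0 < f) (c0 : 0 < c).
Hypothesis cd : c < 2 / (d%:R * f).
Hypothesis r_gt0 : forall n : R, 0 < n -> 0 < r n.
Hypothesis r_cvg : n * r n ^+ d @[n --> +oo] --> +oo.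
Hypothesis r_log : \forall n \near +oo, th * n * r n ^+ d / ln n <= c.

Lemma boundary_term_bounded : exists eps C : R, [/\ 0 < eps, 0 <= C &
  \forall n \near +oo, [/\ 0 < n, 1 <= f * n * r n ^+ d &
    (f * n * r n ^+ d) ^+ m * r n * expR (f * n * r n ^+ d * (th / 2 + eps)) <= C]].
Proof.
have dR : 0 < d%:R :> R by rewrite ltr0n.
pose q := f * c * d%:R / 2; have q0 : 0 < q by rewrite divr_gt0// !mulr_gt0.
have q1 : q < 1.
  move: cd; rewrite ltr_pdivlMr ?mulr_gt0// => h; rewrite /q ltr_pdivrMr// mul1r.
  by rewrite (_ : f * c * d%:R = c * (d%:R * f))//; ring.
pose eps := th / 4 * (q^-1 - 1).
have eps0 : 0 < eps by rewrite mulr_gt0 ?divr_gt0// subr_gt0 invf_gt1.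
(* In the [d]-th power of the bounded quantity, [r ^ d = lam / (f n)], and the logarithmic bound
   reads [1 / n <= exp (- lam th d / (2 q))] with [q < 1]. *)
pose delta := d%:R * eps; have delta0 : 0 < delta by rewrite mulr_gt0.
pose C3 : R := ((m * d).+1`!%:R / delta ^+ (m * d).+1) / f.
have C30 : 0 <= C3 by rewrite divr_ge0 ?(ltW f0)// divr_ge0// exprn_ge0// ltW.
exists eps, (1 + C3); split => //; first by rewrite addr_ge0.
near=> n.
have n1 : 1 < n by near: n; exact: nbhs_pinfty_gt.
have n0 : 0 < n by exact: lt_trans n1.
have rn0 := r_gt0 n0.
have [lam lamE] : exists lam, lam = f * n * r n ^+ d by eexists.
have lam1 : 1 <= lam.
  rewrite lamE -mulrA mulrC -ler_pdivrMr//; near: n.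
  by move/cvgryPge : r_cvg; apply.
have lam0 : 0 < lam by exact: lt_le_trans lam1.
rewrite -lamE; split => //.
have logn : lam * th * d%:R / (2 * q) <= ln n.
  have : th * n * r n ^+ d / ln n <= c by near: n.
  rewrite ler_pdivrMr ?ln_gt0// => h.
  rewrite ler_pdivrMr ?mulr_gt0// /q lamE.
  rewrite (_ : f * n * r n ^+ d * th * d%:R = f * d%:R * (th * n * r n ^+ d)); last by ring.
  rewrite (_ : ln n * _ = f * d%:R * (c * ln n)); last by field.
  by rewrite ler_wpM2l// mulr_ge0// ltW.
have ninv : n^-1 <= expR (- (lam * th * d%:R / (2 * q))).
  rewrite -[n in n^-1]lnK ?posrE// -expRN ler_expR lerN2//.
pose x := lam ^+ m * r n * expR (lam * (th / 2 + eps)).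
have x0 : 0 <= x by rewrite mulr_ge0 ?expR_ge0// mulr_ge0 ?exprn_ge0 ?(ltW lam0) ?(ltW rn0).
have xd : x ^+ d <= C3.
  have rE : r n ^+ d = lam / f * n^-1 by rewrite lamE; field; rewrite !gt_eqF.
  rewrite /x !exprMn rE -expRM_natl -exprM.
  apply: (@le_trans _ _ (lam ^+ (m * d) * (lam / f * expR (- (lam * th * d%:R / (2 * q)))) *
     expR (d%:R * (lam * (th / 2 + eps))))).
    rewrite ler_wpM2r ?expR_ge0// ler_wpM2l ?exprn_ge0 ?(ltW lam0)// ler_wpM2l//.
    by rewrite divr_ge0// ltW.
  rewrite (_ : _ * _ * _ = (lam ^+ (m * d).+1 * (expR (- (lam * th * d%:R / (2 * q))) *
     expR (d%:R * (lam * (th / 2 + eps))))) / f); last by rewrite exprS; field; rewrite gt_eqF.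
  rewrite -expRD ler_wpM2r ?invr_ge0 ?(ltW f0)//.
  rewrite (_ : _ + _ = - (delta * lam)); first exact: power_exp_bound (ltW lam0).
  by rewrite /delta /eps; field; rewrite gt_eqF.
have [x1|x1] := leP x 1; first by rewrite (le_trans x1)// lerDl.
apply: (@le_trans _ _ C3); last by rewrite lerDr.
by apply: le_trans xd; rewrite ler_eXnr// ltW.
Unshelve. all: by end_near.
Qed.

End growth.

Lemma boundary_flattened (R : realType) p (A : set 'rV[R]_p.+1) :
  compact A -> (0 < vol p.+1 A)%E -> ((2 <= p.+1)%N -> C11_boundary A) ->
  (p.+1 = 1%N -> interval1 A) -> forall x, boundary A x -> flattened A x.
Proof.
case: p A => [|p] A cA vA HC HI x bx; last exact: C11_flattened (HC isT) bx.
have clA : closed A by apply: compact_closed => //; exact: norm_hausdorff.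
have [y [z [Ay Az yz]]] : exists y z, [/\ A y, A z & y ord0 ord0 < z ord0 ord0].
  apply: contrapT => H; move: vA; rewrite ltNge => /negP; apply.
  have Ax : A x by case: bx => + _; rewrite -(proj1 (closure_id A) clA).
  rewrite -(vol_set1 (ltn0Sn 0) x); apply: le_measure; rewrite ?inE.
  - exact: closed_measurable_rV.
  - exact: measurable_set1_rV.
  - move=> y Ay /=; apply/rowP => i; rewrite (ord1 i); case: (ltgtP (y ord0 ord0) (x ord0 ord0)) => // yx.
      by case: H; exists y, x.
    by case: H; exists x, y.
exact: (interval_flattened (HI erefl) clA Ay Az yz bx).
Qed.

Lemma f1_le_f0 (R : realType) d (A : set 'rV[R]_d) : closed A -> 0 <= f0 A -> f1 A <= f0 A.
Proof.
move=> clA f00; rewrite /f1; have [bA|nbA] := pselect (boundary A !=set0); last first.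
  rewrite (_ : [set _ | _ in _] = set0) ?inf0//.
  by apply/seteqP; split=> // t [x bx _]; case: nbA; exists x.
rewrite (_ : [set _ | _ in _] = [set f0 A]) ?inf1//.
apply/seteqP; split=> [_ [x bx <-]|_ ->]; last case: bA => x bx.
  have Ax : A x by case: bx => + _; rewrite -(proj1 (closure_id A) clA).
  by rewrite /unif_density indicE mem_set// mulr1.
exists x => //; have Ax : A x by case: bx => + _; rewrite -(proj1 (closure_id A) clA).
by rewrite /unif_density indicE mem_set// mulr1.
Qed.

Lemma radius_bound (R : realType) (q : nat) (lam r t C : R) :
  1 <= lam -> 0 < r -> 0 <= t -> lam ^+ q.+1 * r * expR (lam * t) <= C -> lam * r <= C.
Proof.
move=> lam1 r0 t0; apply: le_trans; have lam0 : 0 < lam by exact: lt_le_trans lam1.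
have e1 : 1 <= expR (lam * t) by apply: le_trans (expR_ge1Dx _); rewrite lerDl mulr_ge0// ltW.
have l1 : 1 <= lam ^+ q by rewrite exprn_ege1.
have le1 : 1 <= lam ^+ q * expR (lam * t).
  by apply: le_trans l1 _; rewrite ler_peMr// exprn_ge0// ltW.
rewrite exprS (_ : _ * expR _ = lam * r * (lam ^+ q * expR (lam * t))); last by ring.
by rewrite ler_peMr// mulr_ge0// ltW.
Qed.

Lemma rescaled_bounds (R : realType) (j p : nat) (n f r lam th eps C H J M g C1 C2 K E I : R) :
  0 < n -> 0 < f -> 0 < r -> 1 <= lam -> lam = f * n * r ^+ p.+1 -> 0 <= C -> 0 <= H ->
  0 <= g -> 0 <= C1 -> 0 <= C2 -> 1 <= K -> 0 <= th / 2 + eps ->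
  M = lam ^+ (j * p.+1) * expR (lam * th) * J -> `|M - g| <= C1 / lam ->
  lam ^+ (j * p.+1).+1 * r * expR (lam * (th / 2 + eps)) <= C2 ->
  r ^+ (j * p.+1) * J * (f^-1 - C * r) <= I ->
  I <= r ^+ (j * p.+1) * (J * f^-1 + H * expR (- lam * (th / 2 - eps)) * (C * r)) ->
  E = (n * f) ^+ j.+1 / K * I ->
  `|n^-1 * lam ^+ (j * p) * expR (lam * th) * E - g / K| <=
    (C1 + f * C * (g + C1) * C2 + f * C * H * C2) / f * (n * r ^+ p.+1)^-1.
Proof.
move=> n0 f0 r0 lam1 lamE C0 H0 g0 C10 C20 K1 te ME Mg small lo hi EE.
have lam0 : 0 < lam by exact: lt_le_trans lam1.
have K0 : 0 < K by exact: lt_le_trans K1.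
pose T := n^-1 * lam ^+ (j * p) * expR (lam * th) * E.
pose W := n^-1 * lam ^+ (j * p) * expR (lam * th) * ((n * f) ^+ j.+1 / K).
have W0 : 0 <= W.
  by rewrite !mulr_ge0 ?expR_ge0 ?invr_ge0 ?exprn_ge0 ?mulr_ge0// ltW.
have TW : T = W * I by rewrite /T /W EE; ring.
have Wr : W * r ^+ (j * p.+1) = f * (lam ^+ (j * p.+1) * expR (lam * th)) / K.
  rewrite {2}mulnS exprD.
  have -> : lam ^+ j = (n * f) ^+ j * r ^+ (j * p.+1).
    by rewrite {1}lamE mulnC exprM -exprMn; congr (_ ^+ _); ring.
  by rewrite /W exprS; field; rewrite !gt_eqF.
have Tlo : f * M / K * (f^-1 - C * r) <= T.
  rewrite TW; apply: le_trans (ler_wpM2l W0 lo); rewrite ME.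
  rewrite [leRHS](_ : _ = W * r ^+ (j * p.+1) * J * (f^-1 - C * r)); last by ring.
  by rewrite Wr le_eqVlt; apply/orP; left; apply/eqP; field; rewrite !gt_eqF.
have Thi : T <= M / K + f * C * H / K * (lam ^+ (j * p.+1) * r * expR (lam * (th / 2 + eps))).
  rewrite TW; apply: le_trans (ler_wpM2l W0 hi) _.
  rewrite [leLHS](_ : _ = W * r ^+ (j * p.+1) * (J * f^-1) +
     W * r ^+ (j * p.+1) * (H * expR (- lam * (th / 2 - eps)) * (C * r))); last by ring.
  rewrite Wr ME; apply: lerD.
    by rewrite le_eqVlt; apply/orP; left; apply/eqP; field; rewrite !gt_eqF.
  have -> : expR (lam * (th / 2 + eps)) = expR (lam * th) * expR (- lam * (th / 2 - eps)).
    by rewrite -expRD; congr expR; field.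
  by rewrite le_eqVlt; apply/orP; left; apply/eqP; field; rewrite !gt_eqF.
have lr := radius_bound lam1 r0 te small.
have small' : lam ^+ (j * p.+1) * r * expR (lam * (th / 2 + eps)) <= C2 / lam.
  by rewrite ler_pdivlMr//; apply: le_trans small; rewrite exprS le_eqVlt; apply/orP; left; apply/eqP; ring.
have r_small : r <= C2 / lam by rewrite ler_pdivlMr// mulrC.
have Cl : C1 / lam <= C1 by rewrite ler_pdivrMr// ler_peMr.
have [M1 M2] : M <= g + C1 / lam /\ g - C1 / lam <= M.
  by move: Mg; rewrite ler_norml => /andP[m1 m2]; split; lra.
have MC : M <= g + C1 by lra.
have lamn : (n * r ^+ p.+1)^-1 = f / lam by rewrite lamE; field; rewrite !gt_eqF// exprn_gt0.
rewrite -/T lamn.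
set D := f * C * (g + C1) * C2; set D' := f * C * H * C2.
have D0 : 0 <= D by rewrite /D !mulr_ge0 ?addr_ge0// ltW.
have D'0 : 0 <= D' by rewrite /D' !mulr_ge0// ltW.
have -> : (C1 + D + D') / f * (f / lam) = C1 / lam + D / lam + D' / lam.
  by field; rewrite !gt_eqF.
have Ki : K^-1 <= 1 by rewrite invf_le1.
have Ki0 : 0 <= K^-1 by rewrite invr_ge0 ltW.
have li0 : 0 <= lam^-1 by rewrite invr_ge0 ltW.
rewrite ler_norml; apply/andP; split.
  rewrite lerNl opprB.
  have h1 : f * M * C * r <= D / lam.
    rewrite /D (_ : f * M * C * r = f * C * (M * r)); last by ring.
    rewrite (_ : _ / lam = f * C * ((g + C1) * (C2 / lam))); last by ring.
    rewrite ler_wpM2l ?mulr_ge0 ?(ltW f0)//.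
    apply: (@le_trans _ _ ((g + C1) * r)); first by rewrite ler_wpM2r// ltW.
    by rewrite ler_wpM2l// addr_ge0.
  have h2 : g / K - T <= (C1 / lam + D / lam) / K.
    have : f * M / K * (f^-1 - C * r) = (M - f * M * C * r) * K^-1 by field; rewrite !gt_eqF.
    move=> e; move: Tlo; rewrite e => Tlo.
    have : (g - (M - f * M * C * r)) * K^-1 <= (C1 / lam + D / lam) * K^-1.
      by rewrite ler_wpM2r//; lra.
    rewrite mulrBl; lra.
  apply: le_trans h2 _; apply: (@le_trans _ _ (C1 / lam + D / lam)).
    by rewrite ler_piMr// addr_ge0// mulr_ge0.
  by rewrite lerDl mulr_ge0.
have h3 : f * C * H / K * (lam ^+ (j * p.+1) * r * expR (lam * (th / 2 + eps))) <= D' / lam.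
  apply: (@le_trans _ _ (f * C * H / K * (C2 / lam))).
    by rewrite ler_wpM2l// !mulr_ge0// ltW.
  rewrite /D' (_ : f * C * H / K * (C2 / lam) = (f * C * H * C2 / lam) * K^-1); last by ring.
  by rewrite ler_piMr// mulr_ge0.
have h4 : M / K - g / K <= C1 / lam.
  rewrite -mulrBl; apply: (@le_trans _ _ (C1 / lam / K)).
    by rewrite ler_wpM2r//; lra.
  by rewrite ler_piMr// mulr_ge0.
have : 0 <= D / lam by rewrite mulr_ge0.
lra.
Qed.
Theorem theorem3p3 (R : realType) (d k : nat) (A : set 'rV[R]_d)
    (disp : measure_display) (Omega : measurableType disp)
    (P : probability Omega R)
    (X : nat -> {RV P >-> 'rV[R]_d}) (Z : R -> {RV P >-> nat}) (r : R -> R)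
    (hd : (1 <= d)%N) (hk : (1 <= k)%N)
    (A_compact : compact A) (A_vol : (0 < vol d A)%E)
    (A_boundary : (2 <= d)%N -> C11_boundary A)
    (A_interval : d = 1%N -> interval1 A)
    (X_density : forall i, has_density (X i) (unif_density A))
    (X_support : forall i, msupport (distribution P (X i)) = A)
    (X_indep : mutually_independent P X)
    (Z_poisson : forall n : R, 0 < n -> poisson_rv (Z n) n)
    (Z_indep : forall n : R, 0 < n -> independent_of_sequence P (Z n) X)
    (r_gt0 : forall n : R, 0 < n -> 0 < r n)
    (r_cvg : n * r n ^+ d @[n --> +oo] --> +oo)
    (r_limsup :
      (limf_esup (fun n : R => (theta d * n * r n ^+ d / ln n)%:E) +oo%R
       < ((Num.max (f0 A) (d%:R * (f0 A - f1 A / 2)))^-1)%:E)%E) :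
  exists C : R, \forall n \near +oo,
    `| n^-1 * (f0 A * n * r n ^+ d) ^+ (k.-1 * d.-1)
         * expR (f0 A * theta d * n * r n ^+ d)
         * expected_clusters P X (Z n) k (r n)
       - k%:R^-1 * alpha d k |
    <= C * (n * r n ^+ d)^-1.
Proof.
case: d hd A X A_compact A_vol A_boundary A_interval X_density X_support X_indep Z_indep r_cvg r_limsup
  => [//|p] _ A X cA vA HC HI Xd _ Xi Zi rc rl.
case: k hk => [//|j] _.
have clA : closed A by apply: compact_closed => //; exact: norm_hausdorff.
have fA := boundary_flattened cA vA HC HI.
have thinA := thin_boundary cA fA.
have nullA : vol p.+1 (boundary A) = 0%E.
  apply: thin_null thinA _; apply: measurableD; last exact: measurable_interior.
  by apply: closed_measurable_rV; exact: closed_closure.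
have f00 := f0_gt0 cA vA; have th0 : 0 < theta p.+1 :> R by exact: theta_gt0.
have volDE := vol_interior_f0 cA nullA.
pose Mx : R := Num.max (f0 A) (p.+1%:R * (f0 A - f1 A / 2)).
have Mx_ge : p.+1%:R * f0 A / 2 <= Mx.
  rewrite le_max; apply/orP; right; rewrite -mulrA ler_wpM2l//.
  have := f1_le_f0 clA (ltW f00); lra.
have Mx0 : 0 < Mx by rewrite lt_max f00.
have Mxi0 : 0 < Mx^-1 by rewrite invr_gt0.
have [c [c0 cM clog]] := limf_esup_lt_near Mxi0 rl.
have cd : c < 2 / (p.+1%:R * f0 A).
  apply: lt_le_trans cM _; rewrite -invf_div lef_pV2 ?posrE//.
  by apply: divr_gt0 => //; exact: mulr_gt0.
have [eps [C2 [eps0 C20 small]]] :=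
  boundary_term_bounded (j * p.+1).+1 (ltn0Sn p) th0 f00 c0 cd r_gt0 rc clog.
have volD : (vol p.+1 A° < +oo)%E by rewrite volDE ltry.
have [C [s0 [C0 s00 bounds]]] := integral_inner_bounds j cA fA eps0 volD.
have [C1 C10 asym] := @cluster_integral_asymptotics R p.+1 (ltn0Sn p) j.
pose g : R := fine (@gauge_integral R p.+1 j).
have g0 : 0 <= g.
  by apply: fine_ge0; apply: integral_ge0 => z _; rewrite lee_fin expR_ge0.
pose H : R := fine (@cluster_integral R p.+1 j 0).
have H0 : 0 <= H.
  by apply: fine_ge0; apply: integral_ge0 => z _; rewrite lee_fin mulr_ge0// expR_ge0.
pose K : R := j.+1`!%:R.
have K1 : 1 <= K by rewrite ler1n fact_gt0.
exists ((C1 + f0 A * C * (g + C1) * C2 + f0 A * C * H * C2) / f0 A).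
have lam_big : \forall n \near +oo, 1 + C2 / s0 <= f0 A * (n * r n ^+ p.+1).
  near=> n; rewrite -ler_pdivrMl//; near: n.
  by move/cvgryPge : rc; apply.
have alphaK : j.+1%:R^-1 * alpha p.+1 j.+1 = g / K.
  by rewrite alphaE// /K factS natrM invfM [LHS]mulrA [RHS]mulrC.
rewrite alphaK.
near=> n.
have [n0 lam1 smalln] : [/\ 0 < n, 1 <= f0 A * n * r n ^+ p.+1 &
    (f0 A * n * r n ^+ p.+1) ^+ (j * p.+1).+1 * r n * expR (f0 A * n * r n ^+ p.+1 * (theta p.+1 / 2 + eps)) <= C2]
  by near: n.
have rn0 := r_gt0 n n0.
have te0 : 0 <= theta p.+1 / 2 + eps by rewrite addr_ge0 ?divr_ge0// ltW.
have rs : r n < s0.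
  have lr := radius_bound lam1 rn0 te0 smalln.
  have big : 1 + C2 / s0 <= f0 A * n * r n ^+ p.+1 by rewrite -mulrA; near: n.
  rewrite ltNge; apply/negP => sr.
  have : (1 + C2 / s0) * s0 <= C2.
    have C2s : 0 <= C2 / s0 by rewrite divr_ge0// ltW.
    by apply: le_trans lr; apply: ler_pM => //; [rewrite addr_ge0|exact: ltW].
  by rewrite mulrDl mul1r divfK ?gt_eqF// gerDr leNgt s00.
pose lam := f0 A * n * r n ^+ p.+1.
have lamK : n * f0 A * r n ^+ p.+1 = lam by rewrite /lam; ring.
have := bounds (r n) (n * f0 A); rewrite rn0 rs lamK => /(_ isT).
rewrite mulr_ge0 ?(ltW n0) ?(ltW f00)// => /(_ isT lam1) /andP[lo hi].
rewrite volDE /= in lo hi.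
have IE : (\int[vol p.+1]_x inner A° j (n * f0 A) (r n) x)%E =
   (fine (\int[vol p.+1]_x inner A° j (n * f0 A) (r n) x)%E)%:E.
  rewrite fineK// fin_numElt (lt_le_trans (ltNyr _) lo)/=; exact: le_lt_trans hi (ltry _).
rewrite IE !lee_fin in lo hi.
have EE : expected_clusters P X (Z n) j.+1 (r n) =
    (n * f0 A) ^+ j.+1 / K * fine (\int[vol p.+1]_x inner A° j (n * f0 A) (r n) x)%E.
  have EC := expected_num_components (ltn0Sn p) cA nullA vA j rn0 n0 Xd Xi (Zi n n0) (Z_poisson n n0).
  apply: (etrans (congr1 fine EC)); by rewrite IE -EFinM.
have [_ Mg] := asym lam lam1.
have -> : f0 A * theta p.+1 * n * r n ^+ p.+1 = lam * theta p.+1 by rewrite /lam; ring.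
apply: (rescaled_bounds n0 f00 rn0 lam1 erefl C0 H0 g0 C10 C20 K1 _ erefl Mg smalln lo hi EE).
exact: te0.
Unshelve. all: by end_near.
Qed.
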